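(* For every integer $i$ and every integer $j\ge a+d$ one has $$J^{i}:\mathfrak m^{j}=\mathfrak m^{i-j+a+d}\ \bigoplus\ \bigoplus_{l=i-j+b+d}^{i-j+a+d-1}\big[\mathrm{ann}_R([\omega]_{i-j-l+d-1}R)\big]_{l}$$ (a direct sum of $k$-subspaces of $R$).
   Context: $k$ is a field and $R$ is a standard graded Cohen-Macaulay $k$-algebra (so $[R]_0=k$ and $R$ is generated over $k$ by finitely many elements of degree $1$) of dimension $d\ge 1$, with homogeneous maximal ideal $\mathfrak m$ and graded canonical module $\omega=\omega_R$, normalized as usual (if $R=S/I$ with $S=k[X_1,\dots,X_n]$ a standard graded polynomial ring and $I$ a homogeneous ideal of height $g$, then $\omega_R\cong \mathrm{Ext}^g_S(R,S(-n))$). For a graded module $M$, $[M]_i$ is the degree $i$ component and $[M]_tR$ is the submodule generated by $[M]_t$. Set $a=a(R)=-\min\{i : [\omega]_i\ne 0\}$ (the $a$-invariant) and $b=b(R)=-\min\{i : [\omega]_iR \text{ is a faithful } R\text{-module}\}$; one has $a\ge b$. The ideal $J=(y_1,\dots,y_d)$ is generated by a system of parameters $y_1,\dots,y_d$ of $R$ consisting of linear forms. Convention: powers of ideals with non-positive exponent are the unit ideal. Colons are taken in $R$. *)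

(* Defs.v *)
From HB Require Import structures.
From mathcomp Require Import all_boot all_order all_algebra.
From mathcomp Require Import mpoly.
From mathcomp Require Import classical_sets.

Set Implicit Arguments.
Unset Strict Implicit.
Unset Printing Implicit Defensive.

Import Order.TTheory GRing.Theory Num.Theory.
Local Open Scope classical_set_scope.
Local Open Scope ring_scope.

(** Ideals and submodules are Prop-valued subsets ([set A]). *)

Definition submodule_gen (A : comNzRingType) (V : lmodType A) (X : set V) :
    set V :=
  [set v | exists (m : nat) (c : 'I_m -> A) (u : 'I_m -> V),
     (forall p, X (u p)) /\ v = \sum_p c p *: u p].

Section Ideals.
Variable A : comNzRingType.
Implicit Types (I J P X : set A).

Definition is_ideal I :=
  [/\ I 0, forall u v, I u -> I v -> I (u + v)
    & forall r u, I u -> I (r * u)].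

Definition is_prime_ideal P :=
  [/\ is_ideal P, ~ P 1 & forall u v, P (u * v) -> P u \/ P v].

Definition ideal_gen X : set A := submodule_gen (V := A^o) X.

Definition ideal_mul I J : set A :=
  ideal_gen [set z | exists u v, [/\ I u, J v & z = u * v]].

Fixpoint ideal_pow I (n : nat) : set A :=
  if n is n'.+1 then ideal_mul I (ideal_pow I n') else setT.

(* Powers with non-positive exponent are the unit ideal. *)
Definition ideal_powz I (e : int) : set A :=
  if e is Posz n then ideal_pow I n else setT.

Definition colon I J : set A := [set r | forall u, J u -> I (r * u)].

(* Strictly increasing chain C 0 < C 1 < ... < C h of primes (length h);
   the values of C beyond h are irrelevant. *)
Definition prime_chain (h : nat) (C : nat -> set A) :=
  (forall i, (i <= h)%N -> is_prime_ideal (C i)) /\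
  (forall i, (i < h)%N -> C i `<` C i.+1).

Definition krull_dim_is (d : nat) :=
  (exists C, prime_chain d C) /\
  (forall h C, prime_chain h C -> (h <= d)%N).

Definition prime_height_is P (h : nat) :=
  (exists2 C, prime_chain h C & C h = P) /\
  (forall h' C, prime_chain h' C -> C h' = P -> (h' <= h)%N).

(* The height of an ideal is the minimal height of a prime containing it. *)
Definition height_is I (g : nat) :=
  (exists P, [/\ is_prime_ideal P, I `<=` P & prime_height_is P g]) /\
  (forall P h, is_prime_ideal P -> I `<=` P -> prime_height_is P h ->
     (g <= h)%N).

Definition regular_sequence (e : nat) (x : 'I_e -> A) :=
  let first (i : nat) := ideal_gen [set z | exists2 q : 'I_e, (q < i)%N & z = x q] in
  (forall (p : 'I_e) r, first p (x p * r) -> first p r) /\ ~ first e 1.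

(* Maximal length of a regular sequence contained in the ideal I. *)
Definition depth_is I (e : nat) :=
  (exists2 x : 'I_e -> A, (forall p, I (x p)) & regular_sequence x) /\
  (forall e' (x : 'I_e' -> A), (forall p, I (x p)) -> regular_sequence x ->
     (e' <= e)%N).

End Ideals.

(* U is the internal direct sum of the (possibly infinite) family B. *)
Definition is_direct_sum (T : eqType) (V : zmodType) (U : set V)
    (B : T -> set V) :=
  (forall v, U v <-> exists (s : seq T) (f : T -> V),
     [/\ uniq s, forall i, i \in s -> B i (f i) & v = \sum_(i <- s) f i]) /\
  (forall (s : seq T) (f : T -> V), uniq s ->
     (forall i, i \in s -> B i (f i)) ->
     \sum_(i <- s) f i = 0 -> forall i, i \in s -> f i = 0).

Definition is_add_subgroup (V : zmodType) (U : set V) :=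
  U 0 /\ (forall u v, U u -> U v -> U (u - v)).

(* The k-algebra map k[X_0,...,X_(n-1)] -> R sending 'X_i to x i. *)
Definition alg_eval (k : fieldType) (R : comAlgType k) (n : nat)
    (x : 'I_n -> R) (p : {mpoly k[n]}) : R :=
  mmap (in_alg R) x p.

Section Graded.
Variables (k : fieldType) (R : comAlgType k) (Rg : int -> set R).

Definition algebra_generators (n : nat) (x : 'I_n -> R) :=
  forall r, exists p : {mpoly k[n]}, r = alg_eval x p.

(* R is a graded ring, concentrated in degrees >= 0, with [R]_0 = k, generated
   over k by finitely many elements of degree 1. *)
Definition standard_graded :=
  [/\ forall i, is_add_subgroup (Rg i),
      is_direct_sum setT Rg,
      forall i j u v, Rg i u -> Rg j v -> Rg (i + j) (u * v),
      (forall i, i < 0 -> Rg i = [set 0]) /\ Rg 0 = range (in_alg R)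
    & exists (n : nat) (x : 'I_n -> R),
        (forall i, Rg 1 (x i)) /\ algebra_generators x].

Definition homog_max_ideal : set R :=
  ideal_gen [set r | exists2 i : int, 0 < i & Rg i r].

Definition cohen_macaulay :=
  exists2 d, krull_dim_is R d & depth_is homog_max_ideal d.

(* d = dim R elements of the homogeneous maximal ideal generating an ideal
   primary to it. *)
Definition system_of_parameters (d : nat) (y : 'I_d -> R) :=
  [/\ krull_dim_is R d, forall p, homog_max_ideal (y p)
    & exists N, ideal_pow homog_max_ideal N `<=` ideal_gen (range y)].

Definition graded_module (W : lmodType R) (Wg : int -> set W) :=
  [/\ forall i, is_add_subgroup (Wg i), is_direct_sum setT Wg
    & forall i j r w, Rg i r -> Wg j w -> Wg (i + j) (r *: w)].

End Graded.

Definition homog_of_degree (k : fieldType) (n : nat) (t : int)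
    (p : {mpoly k[n]}) : Prop :=
  if t is Posz m then p \is m.-homog else p = 0.

(* Graded free resolution ... -> F_1 -> F_0 -> R -> 0 over S = k[X_0..X_(n-1)],
   R being an S-module through alg_eval x. Here F_i is free of rank [rk i] with
   basis elements of degrees [deg i p]; its elements are row vectors, and the
   differential F_(i+1) -> F_i is right multiplication by [diff i]. *)
Record graded_free_resolution (k : fieldType) (R : comAlgType k)
    (Rg : int -> set R) (n : nat) (x : 'I_n -> R) := GradedFreeResolution {
  rk : nat -> nat;
  deg : forall i, 'I_(rk i) -> int;
  diff : forall i, 'M[{mpoly k[n]}]_(rk i.+1, rk i);
  aug : 'I_(rk 0) -> R;
  diff_homog : forall i p q,
    homog_of_degree (deg p - deg q) (diff i p q);
  aug_homog : forall q, Rg (deg q) (aug q);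
  aug_surj : forall r, exists v : 'rV[{mpoly k[n]}]_(rk 0),
    r = \sum_q alg_eval x (v 0 q) * aug q;
  exact_aug : forall v : 'rV[{mpoly k[n]}]_(rk 0),
    \sum_q alg_eval x (v 0 q) * aug q = 0 <-> exists u, v = u *m diff 0;
  exact_diff : forall i (v : 'rV[{mpoly k[n]}]_(rk i.+1)),
    v *m diff i = 0 <-> exists u, v = u *m diff i.+1 }.

Section Ext.
Variables (k : fieldType) (R : comAlgType k) (Rg : int -> set R).
Variables (n : nat) (x : 'I_n -> R) (F : graded_free_resolution Rg x).
Local Notation S := {mpoly k[n]}.

(* The complex Hom_S(F, S): a map F_g -> S is the column vector w of its values
   on the basis, and precomposition with F_(g+1) -> F_g is w |-> diff g *m w. *)
Definition cocycle (g : nat) : set 'cV[S]_(rk F g) :=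
  [set w | diff F g *m w = 0].

Definition coboundary (g : nat) : set 'cV[S]_(rk F g) :=
  match g return set 'cV[S]_(rk F g) with
  | 0 => [set 0]
  | g'.+1 => [set w | exists u, w = diff F g' *m u]
  end.

(* Homogeneous elements of degree t in Hom_S(F_g, S(-n)): a basis element of
   degree e goes to [S(-n)]_(t + e) = [S]_(t + e - n). *)
Definition hom_degree (g : nat) (t : int) : set 'cV[S]_(rk F g) :=
  [set w | forall p, homog_of_degree (t + deg p - n%:Z) (w p 0)].

(* W is isomorphic, as a graded module, to
   Ext^g_S(R, S(-n)) = cocycle g / coboundary g: psi is only meaningful on
   cocycles, where it induces the isomorphism. *)
Definition graded_iso_Ext (g : nat) (W : lmodType R) (Wg : int -> set W) :=
  exists psi : 'cV[S]_(rk F g) -> W,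
    [/\ forall s w1 w2, cocycle w1 -> cocycle w2 ->
          psi (s *: w1 + w2) = alg_eval x s *: psi w1 + psi w2,
        forall v, exists2 w, cocycle w & psi w = v,
        forall w, cocycle w -> (psi w = 0 <-> coboundary w)
      & forall t w, cocycle w -> hom_degree t w -> Wg t (psi w)].

End Ext.

Section Canonical.
Variables (k : fieldType) (R : comAlgType k) (Rg : int -> set R).
Variables (W : lmodType R) (Wg : int -> set W).

(* R = S/I with S = k[X_0..X_(n-1)] (X_i |-> x i of degree 1), ht I = g, and
   W = Ext^g_S(R, S(-n)). *)
Definition canonical_module :=
  graded_module Rg Wg /\
  exists (n : nat) (x : 'I_n -> R) (g : nat)
         (F : graded_free_resolution Rg x),
    [/\ forall i, Rg 1 (x i), algebra_generators x,
        height_is [set p | alg_eval x p = 0] g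
      & graded_iso_Ext F g Wg].

Definition ann (N : set W) : set R := [set r | forall w, N w -> r *: w = 0].

Definition faithful (N : set W) := ann N = [set 0].

Definition is_min (E : set int) (m : int) :=
  E m /\ forall i, E i -> m <= i.

Definition a_invariant_is (a : int) :=
  is_min [set i | Wg i <> [set 0]] (- a).

Definition b_invariant_is (b : int) :=
  is_min [set i | faithful (submodule_gen (Wg i))] (- b).

End Canonical.

(* Main.v *)
Require Import Defs.
From HB Require Import structures.
From mathcomp Require Import all_boot all_order all_algebra.
From mathcomp Require Import ssrcomplements mpoly.
From mathcomp Require Import boolp classical_sets.
From mathcomp Require Import zify ring.

(** Write [A] for the polynomial ring in the linear parameters [y_1, ..., y_d] and
    [omega] for the canonical module.  As [R] is Cohen-Macaulay it is a free
    [A]-module on finitely many homogeneous elements [e_s], of degrees [delta_s],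
    and [omega] is its graded dual [Hom_A(R, A)] shifted by [d].  Both sides of the
    formula are thereby read off on coordinates with respect to the [e_s].

    - A homogeneous [r] kills [omega] in degree [t] exactly when no multiple of
      [r] has a component along an [e_s] with [delta_s >= d - t]
      ([annihilator_criterion]): [omega] contains in degree [t] a nonzero multiple
      of the dual basis element of [e_s] precisely for these [s].
    - The ideal generated by the parameters is [A_+ R], so membership in its
      [i]-th power is a condition on the degrees of the coordinates
      ([param_power_coord]).  If all [delta_s] are at most [j], a homogeneous [r]
      of degree [l] multiplies the [j]-th power of the maximal ideal into it
      exactly when no multiple of [r] has a component along an [e_s] with
      [delta_s > l + j - i] ([colon_homog]).

    With [t = i - l - j + d - 1] the two conditions coincide.  As [omega]
    vanishes in degrees below [-a], all [delta_s] are at most [a + d <= j], and the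
    condition is void for [l >= i - j + a + d]; as [omega] is faithful from degree
    [-b] on, it forces [r = 0] for [l < i - j + b + d].  This is the asserted
    decomposition, degree by degree.

    Freeness ([free_over_parameters]) comes from Koszul homology.  A regular
    sequence of length [d] in the maximal ideal makes the Koszul complex of the
    parameters acyclic in positive degrees ([kos_exact]), because powers of its
    elements lie in the parameter ideal, which kills Koszul homology.  Vanishing
    in degree one says that a relation among lifts of a basis of [R/(y)] is a
    combination, with coefficients in [A_+], of relations, hence zero.

    The duality with [Hom_A(R, A)] is extracted from an arbitrary graded free
    resolution of [R] over the polynomial ring [S].  After a linear change of
    variables [S = A[Z_1, ..., Z_g]].  For cochains that are linear only over [A]
    the cohomology is [Hom_A(R, S)] in degree zero, as the resolution splits over
    [A].  Passing from linearity over [A[Z_1, ..., Z_s]] to one variable more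
    replaces the cohomology by the cokernel of the commutator with [Z_{s+1}], one
    degree higher: on free modules this commutator is onto ([var_comm_surj]), and
    on the cohomology reached so far it is injective ([comm_image_inj]).  After
    [g] steps the cohomology is concentrated in degree [g] ([exact_neq]), where it
    is [Hom_A(R, S)] modulo commutators ([connecting_kernel]); letting the [Z_j]
    act through [R] identifies this quotient with [Hom_A(R, A)]
    ([dual_eval_kernel]).  In particular a nonzero Ext module determines [g]. *)

Import Order.TTheory GRing.Theory Num.Theory.
Local Open Scope classical_set_scope.
Local Open Scope ring_scope.
Set Implicit Arguments.
Unset Strict Implicit.
Unset Printing Implicit Defensive.

(** * Koszul complexes *)

(** The Koszul complex as an iterated mapping cone: the pair [(u, v)] stands for
    [u + v /\ e_n].  All exterior degrees are kept together, and [kos_in P j] cuts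
    out the chains of degree [j] with entries in [P]. *)
Fixpoint kos (V : zmodType) (n : nat) : zmodType :=
  if n is n'.+1 then (kos V n' * kos V n')%type else V.

Fixpoint kos_map (V V' : zmodType) (f : V -> V') n : kos V n -> kos V' n :=
  match n return kos V n -> kos V' n with
  | 0 => f
  | n'.+1 => fun z => (kos_map f z.1, kos_map f z.2)
  end.

Fixpoint kos_diff (V : zmodType) (T : nat -> V -> V) n : kos V n -> kos V n :=
  match n return kos V n -> kos V n with
  | 0 => fun=> 0
  | n'.+1 => fun z => (kos_diff T z.1 + kos_map (T n') z.2, - kos_diff T z.2)
  end.

Fixpoint kos_in (V : zmodType) (P : set V) (j n : nat) : kos V n -> Prop :=
  match n return kos V n -> Prop with
  | 0 => fun z => if j is 0 then P z else z = 0
  | n'.+1 => fun z => kos_in P j z.1 /\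
                      (if j is j'.+1 then kos_in P j' z.2 else z.2 = 0)
  end.

Fixpoint kos_emb (V : zmodType) n : V -> kos V n :=
  match n return V -> kos V n with
  | 0 => id
  | n'.+1 => fun v => (kos_emb n' v, 0)
  end.

Definition additive_map (V V' : zmodType) (f : V -> V') :=
  forall u v, f (u + v) = f u + f v.

Lemma additive_map0 (V V' : zmodType) (f : V -> V') :
  additive_map f -> f 0 = 0.
Proof. by move=> fD; apply: (@addrI _ (f 0)); rewrite -fD !addr0. Qed.

Lemma additive_mapN (V V' : zmodType) (f : V -> V') u :
  additive_map f -> f (- u) = - f u.
Proof.
move=> fD; apply: (@addrI _ (f u)).
by rewrite -fD !subrr additive_map0.
Qed.

Lemma additive_mapB (V V' : zmodType) (f : V -> V') u v :
  additive_map f -> f (u - v) = f u - f v.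
Proof. by move=> fD; rewrite fD additive_mapN. Qed.

Lemma additive_map_sum (V V' : zmodType) (f : V -> V') I (r : seq I)
    (Q : pred I) F : additive_map f ->
  f (\sum_(i <- r | Q i) F i) = \sum_(i <- r | Q i) f (F i).
Proof.
move=> fD; apply: (big_morph f fD); exact: additive_map0.
Qed.

Lemma kos_mapD (V V' : zmodType) (f : V -> V') n : additive_map f -> additive_map (@kos_map _ _ f n).
Proof.
move=> fD; elim: n => [|n IH] //= u v.
by rewrite /= !IH.
Qed.

Lemma kos_map_comp (V V' V'' : zmodType) (f : V -> V') (h : V' -> V'') n (z : kos V n) :
  kos_map h (kos_map f z) = kos_map (h \o f) z.
Proof. by elim: n z => [|n IH] //= [u v]; rewrite /= !IH. Qed.

Lemma kos_map_emb (V V' : zmodType) (f : V -> V') n v : additive_map f ->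
  kos_map f (kos_emb n v) = kos_emb n (f v).
Proof.
move=> fD; elim: n => //= n ->.
by rewrite (additive_map0 (kos_mapD fD)).
Qed.

Lemma eq_kos_map (V V' : zmodType) (f h : V -> V') n (z : kos V n) : f =1 h ->
  kos_map f z = kos_map h z.
Proof. by move=> fh; elim: n z => [|n IH] //= [u v]; rewrite /= !IH. Qed.

Lemma kos_in_map (V V' : zmodType) (P : set V) (P' : set V') (f : V -> V') j n (z : kos V n) :
  f 0 = 0 -> (forall v, P v -> P' (f v)) -> kos_in P j z ->
  kos_in P' j (kos_map f z).
Proof.
move=> f0 fP; elim: n j z => [|n IH] [|j] //=.
- by move=> z ->.
- move=> [u v] /= [hu ->]; split; first exact: IH.
  have {}f0 : forall m, kos_map f (0 : kos V m) = 0.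
    by elim=> //= m ->.
  exact: f0.
- by move=> [u v] /= [hu hv]; split; apply: IH.
Qed.

Lemma kos_diff_map (V V' : zmodType) (T : nat -> V -> V) (T' : nat -> V' -> V') (f : V -> V') n
    (z : kos V n) :
  additive_map f -> (forall p v, (p < n)%N -> f (T p v) = T' p (f v)) ->
  kos_map f (kos_diff T z) = kos_diff T' (kos_map f z).
Proof.
move=> fD; elim: n z => [|n IH] //=; first by move=> *; exact: additive_map0.
move=> [u v] fT /=.
have fT' p w : (p < n)%N -> f (T p w) = T' p (f w).
  by move=> pn; apply: fT; exact: ltnW.
rewrite kos_mapD // (additive_mapN _ (kos_mapD fD)) !IH //.
congr (_ + _, _); rewrite !kos_map_comp; apply: eq_kos_map => w /=.
exact: fT.
Qed.

Lemma kos_embD (V : zmodType) n : additive_map (@kos_emb V n).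
Proof.
elim: n => //= n IH x y; rewrite IH.
by congr (_, _); rewrite addr0.
Qed.

Lemma kos_in_deg0 (V : zmodType) (P : set V) n (z : kos V n) :
  kos_in P 0 z -> exists2 v, P v & z = kos_emb n v.
Proof.
elim: n z => [|n IH] /=; first by move=> v Pv; exists v.
by move=> [u v] /= [/IH[v0 P0 ->] ->]; exists v0.
Qed.

Lemma kos_in_emb (V : zmodType) (P : set V) n v : P v -> kos_in P 0 (kos_emb n v).
Proof. by move=> Pv; elim: n => //= n IH; split. Qed.

Section Koszul.
Variables (V : zmodType) (T : nat -> V -> V).
Hypothesis TD : forall p, additive_map (T p).
Hypothesis TC : forall p q v, T p (T q v) = T q (T p v).

Lemma kos_diffD n : additive_map (@kos_diff _ T n).
Proof.
elim: n => [|n IH] /= u v; first by rewrite addr0.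
rewrite /= !IH (kos_mapD (TD n)).
by congr (_, _); rewrite ?opprD // addrACA.
Qed.

Lemma kos_diff_emb n v : kos_diff T (kos_emb n v) = 0.
Proof.
elim: n => //= n ->.
rewrite (additive_map0 (kos_mapD (TD n))).
by rewrite (additive_map0 (@kos_diffD n)) addr0 oppr0.
Qed.

Lemma kos_diffK n (z : kos V n) : kos_diff T (kos_diff T z) = 0.
Proof.
elim: n z => [|n IH] //= [u v] /=.
rewrite kos_diffD IH add0r (additive_mapN _ (@kos_diffD n)) IH.
rewrite (additive_mapN _ (kos_mapD (TD n))).
rewrite (kos_diff_map (T' := T)) ?subrr ?oppr0 // => p w _; exact: TC.
Qed.

Lemma kos_in0 (P : set V) j n : P 0 -> kos_in P j (0 : kos V n).
Proof. by move=> P0; elim: n j => [|n IH] [|j] //=. Qed.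

Lemma kos_inD (P : set V) j n (u v : kos V n) :
  (forall a b, P a -> P b -> P (a + b)) ->
  kos_in P j u -> kos_in P j v -> kos_in P j (u + v).
Proof.
move=> PD; elim: n j u v => [|n IH] [|j] //=; try exact: PD.
- by move=> u v -> ->; rewrite addr0.
- by move=> [u u'] [v v'] /= [hu ->] [hv ->]; rewrite addr0; split=> //; apply: IH.
- by move=> [u u'] [v v'] /= [hu hu'] [hv hv']; split; apply: IH.
Qed.

Lemma kos_in_sum (P : set V) j n I (r : seq I) (F : I -> kos V n) :
  P 0 -> (forall a b, P a -> P b -> P (a + b)) ->
  (forall i, kos_in P j (F i)) -> kos_in P j (\sum_(i <- r) F i).
Proof.
move=> P0 PD PF; elim: r => [|i r IH]; first by rewrite big_nil; exact: kos_in0.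
by rewrite big_cons; apply: kos_inD.
Qed.

Lemma kos_in_sub (P P' : set V) j n (u : kos V n) :
  P `<=` P' -> kos_in P j u -> kos_in P' j u.
Proof.
move=> PP'; elim: n j u => [|n IH] [|j] //=; try exact: PP'.
- by move=> [u v] /= [hu ->]; split=> //; apply: IH.
- by move=> [u v] /= [hu hv]; split; apply: IH.
Qed.

Lemma kos_inN (P : set V) j n (u : kos V n) :
  (forall a, P a -> P (- a)) -> kos_in P j u -> kos_in P j (- u).
Proof.
move=> PN; elim: n j u => [|n IH] [|j] //=; try exact: PN.
- by move=> u ->; rewrite oppr0.
- by move=> [u v] /= [hu ->]; rewrite oppr0; split=> //; apply: IH.
- by move=> [u v] /= [hu hv]; split; apply: IH.
Qed.

Lemma kos_in_gt j n (z : kos V n) : (n < j)%N -> kos_in setT j z -> z = 0.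
Proof.
elim: n j z => [|n IH] [|j] //= [u v] nj /= [hu hv].
by rewrite (IH _ _ _ hu) ?(IH _ _ _ hv) // ltnW.
Qed.

Lemma kos_in_diff (P : set V) j n (z : kos V n) :
  P 0 -> (forall a b, P a -> P b -> P (a + b)) -> (forall a, P a -> P (- a)) ->
  (forall p a, P a -> P (T p a)) ->
  kos_in P j.+1 z -> kos_in P j (kos_diff T z).
Proof.
move=> P0 PD PN PT; elim: n j z => [|n IH] j /=.
  by case: j => [|j] z _ //=.
move=> [u v] /= [hu hv]; split.
  apply: kos_inD => //; first exact: IH.
  by apply: kos_in_map hv => //; [exact: additive_map0 | exact: PT].
case: j hu hv => [|j] hu hv; last by apply: kos_inN => //; apply: IH.
by have [v0 _ ->] := kos_in_deg0 hv; rewrite kos_diff_emb oppr0.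
Qed.

(** Contraction against the p-th exterior generator; it is a homotopy between
    multiplication by the p-th operator and zero, which is why the ideal
    generated by the sequence kills Koszul homology. *)
Fixpoint kos_contr (p : nat) n : kos V n -> kos V n :=
  match n return kos V n -> kos V n with
  | 0 => fun=> 0
  | n'.+1 => fun z => if p == n' then (0, z.1)
                      else (kos_contr p z.1, - kos_contr p z.2)
  end.

Lemma kos_contrD p n : additive_map (@kos_contr p n).
Proof.
elim: n => [|n IH] /= u v; first by rewrite addr0.
by case: ifP => _; rewrite /= ?IH; congr (_, _); rewrite ?addr0 ?opprD.
Qed.

Lemma kos_contr_map p (f : V -> V) n (z : kos V n) : additive_map f ->
  kos_contr p (kos_map f z) = kos_map f (kos_contr p z).
Proof.
move=> fD; elim: n z => [|n IH] //=; first by rewrite additive_map0.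
move=> [u v] /=; case: ifP => _ /=.
  by rewrite (additive_map0 (kos_mapD fD)).
by rewrite !IH (additive_mapN _ (kos_mapD fD)).
Qed.

Lemma kos_homotopy p n (z : kos V n) : (p < n)%N ->
  kos_diff T (kos_contr p z) + kos_contr p (kos_diff T z) = kos_map (T p) z.
Proof.
elim: n z => [|n IH] //= [u v] /=; rewrite ltnS leq_eqVlt.
case: (eqVneq p n) => [->|pn] /= h.
  rewrite (additive_map0 (@kos_diffD n)) add0r.
  by congr (_, _) => /=; rewrite ?addr0 // addKr.
rewrite (additive_mapN _ (kos_mapD (TD n))) !(additive_mapN _ (@kos_diffD n)).
rewrite (additive_mapN _ (@kos_contrD p n)) kos_contrD kos_contr_map //.
rewrite !opprK -!IH //; congr (_, _) => /=.
by rewrite [X in _ + X]addrC addrA subrK.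
Qed.

Lemma kos_in_contr (P : set V) p j n (z : kos V n) :
  P 0 -> (forall a, P a -> P (- a)) ->
  kos_in P j z -> kos_in P j.+1 (kos_contr p z).
Proof.
move=> P0 PN; elim: n j z => [|n IH] j z //=.
case: ifP => _ /= [hu hv]; first by split=> //; apply: kos_in0.
split; first exact: IH.
apply: kos_inN => //; case: j hu hv => [|j] hu; last exact: IH.
by move=> ->; rewrite (additive_map0 (@kos_contrD p n)); exact: kos_in0.
Qed.

(** A boundary of a chain of degree one is a combination of the operators; the
    entries of the chain are the coefficients. *)
Lemma kos_diff1 (P : set V) n (z : kos V n) :
  P 0 -> kos_in P 1 z ->
  exists2 b : nat -> V, (forall p, P (b p)) &
    kos_diff T z = kos_emb n (\sum_(p < n) T p (b p)).
Proof.
move=> P0; elim: n z => [|n IH] /=.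
  by move=> z _; exists (fun=> 0) => //; rewrite big_ord0.
move=> [u v] /= [/IH[b Pb ->] /kos_in_deg0[v0 Pv ->]].
exists (fun p => if p == n then v0 else b p); first by move=> p; case: ifP.
rewrite kos_diff_emb oppr0 kos_map_emb // big_ord_recr /= eqxx -kos_embD.
congr (kos_emb _ (_ + _), _); apply: eq_bigr => p _.
by rewrite ltn_eqF.
Qed.

Lemma kos_diff1_ex n (b : nat -> V) :
  exists2 z : kos V n, kos_in setT 1 z &
    kos_diff T z = kos_emb n (\sum_(p < n) T p (b p)).
Proof.
elim: n => [|n [z hz dz]] /=; first by exists 0 => //; rewrite big_ord0.
exists (z, kos_emb n (b n)) => /=; first by split=> //; exact: kos_in_emb.
by rewrite dz kos_diff_emb oppr0 kos_map_emb // big_ord_recr /= -kos_embD.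
Qed.

End Koszul.

Lemma kos_in_lift (V V' : zmodType) (f : V -> V') j n (z : kos V' n) :
  f 0 = 0 -> (forall v, exists u, f u = v) -> kos_in setT j z ->
  exists2 w, kos_in setT j w & kos_map f w = z.
Proof.
move=> f0 fs.
have f0' m : kos_map f (0 : kos V m) = 0 by elim: m => //= m ->.
elim: n j z => [|n IH] [|j] /=.
- by move=> z _; have [u <-] := fs z; exists u.
- by move=> z ->; exists 0.
- move=> [u v] /= [/IH[w hw <-] ->]; exists (w, 0) => //=.
  by rewrite f0'.
- by move=> [u v] /= [/IH[w hw <-] /IH[w' hw' <-]]; exists (w, w').
Qed.

Lemma kos_in_zero (V : zmodType) j n (z : kos V n) : kos_in [set 0] j z -> z = 0.
Proof.
elim: n j z => [|n IH] [|j] //=.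
- by move=> [u v] /= [/IH -> ->].
- by move=> [u v] /= [/IH -> /IH ->].
Qed.

Lemma kos_in_preim (V V' : zmodType) (f : V -> V') (P : set V') j n (z : kos V n) :
  kos_in setT j z -> kos_in P j (kos_map f z) -> kos_in [set v | P (f v)] j z.
Proof.
elim: n j z => [|n IH] [|j] //=.
- by move=> [u v] /= [hu ->] [hu' _]; split=> //; apply: IH.
- by move=> [u v] /= [hu hv] [hu' hv']; split; apply: IH.
Qed.

(** * Depth sensitivity of the Koszul complex *)

Section IdealGen.
Variable B : comNzRingType.
Implicit Type X : set B.

Lemma ideal_gen0 X : ideal_gen X 0.
Proof. by exists 0, (fun=> 0), (fun=> 0); split=> [[]//|]; rewrite big_ord0. Qed.

Lemma ideal_gen_sub X : X `<=` ideal_gen X.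
Proof.
move=> v Xv; exists 1, (fun=> 1), (fun=> v); split=> //.
by rewrite big_ord1 scale1r.
Qed.

Lemma ideal_genD X u v : ideal_gen X u -> ideal_gen X v -> ideal_gen X (u + v).
Proof.
move=> [m [c [f [Xf ->]]]] [m' [c' [f' [Xf' ->]]]].
pose C (i : 'I_(m + m')) := match split i with inl j => c j | inr j => c' j end.
pose G (i : 'I_(m + m')) := match split i with inl j => f j | inr j => f' j end.
exists (m + m')%N, C, G; split=> [p|].
  by rewrite /G; case: splitP => j _; [exact: Xf | exact: Xf'].
rewrite big_split_ord /=; congr (_ + _); apply: eq_bigr => p _.
  by rewrite /C /G (unsplitK (inl p)).
by rewrite /C /G (unsplitK (inr p)).
Qed.

Lemma ideal_genM X r u : ideal_gen X u -> ideal_gen X (r * u).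
Proof.
move=> [m [c [f [Xf ->]]]]; exists m, (fun p => r * c p), f; split=> //.
rewrite mulr_sumr; apply: eq_bigr => p _.
by rewrite -[RHS]mulrA.
Qed.

Lemma ideal_genN X u : ideal_gen X u -> ideal_gen X (- u).
Proof. by rewrite -mulN1r; exact: ideal_genM. Qed.

Lemma ideal_gen_ind X (P : set B) :
  P 0 -> (forall u v, P u -> P v -> P (u + v)) ->
  (forall r u, X u -> P (r * u)) -> ideal_gen X `<=` P.
Proof.
move=> P0 PD PM _ [m [c [f [Xf ->]]]].
by apply: (big_ind P) => // p _; apply: PM; exact: Xf.
Qed.

Lemma ideal_gen_range n (y : 'I_n -> B) r :
  ideal_gen (range y) r <-> exists c, r = \sum_p c p * y p.
Proof.
split; last first.
  move=> [c ->]; apply: (big_ind (ideal_gen (range y))).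
  - exact: ideal_gen0.
  - exact: ideal_genD.
  - by move=> p _; apply: ideal_genM; apply: ideal_gen_sub; exists p.
move: r; apply: ideal_gen_ind.
- by exists (fun=> 0); rewrite big1 // => p _; rewrite mul0r.
- move=> _ _ [c ->] [c' ->]; exists (fun p => c p + c' p).
  by rewrite -big_split; apply: eq_bigr => p _; rewrite mulrDl.
- move=> r _ [p _ <-]; exists (fun q => if q == p then r else 0).
  rewrite (bigD1 p) //= eqxx big1 ?addr0 // => q /negPf ->.
  by rewrite mul0r.
Qed.

End IdealGen.

Section DepthSensitivity.
Variables (B : comNzRingType) (n e : nat) (y : nat -> B) (x : 'I_e -> B).

Let first (i : nat) := ideal_gen [set z | exists2 q : 'I_e, (q < i)%N & z = x q].
Let T (p : nat) (v : B) := y p * v.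

(** Entrywise, [first i.+1] is [first i] plus the multiples of [x i]. *)
Lemma kos_in_ideal_step (i : 'I_e) j m (z : kos B m) :
  kos_in (first i.+1) j z ->
  exists w1 w2, [/\ kos_in setT j w1, kos_in (first i) j w2 &
    z = kos_map (fun v => x i * v) w1 + w2].
Proof.
have x0 q : kos_map (fun v => x i * v) (0 : kos B q) = 0.
  by elim: q => [|q IH] //=; rewrite ?mulr0 // IH.
have base r : first i.+1 r -> exists s t, first i t /\ r = x i * s + t.
  apply: (ideal_gen_ind (P := [set r | exists s t, first i t /\ r = x i * s + t])).
  - by exists 0, 0; split; [exact: ideal_gen0 | rewrite mulr0 addr0].
  - move=> _ _ [s [t [ht ->]]] [s' [t' [ht' ->]]].
    exists (s + s'), (t + t'); split; first exact: ideal_genD.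
    by rewrite mulrDr addrACA.
  - move=> {}r _ [q + ->]; rewrite ltnS leq_eqVlt => /orP[/eqP/val_inj->|qi].
      by exists r, 0; rewrite mulrC addr0; split=> //; exact: ideal_gen0.
    exists 0, (r * x q); rewrite mulr0 add0r; split=> //.
    by apply: ideal_genM; apply: ideal_gen_sub; exists q.
elim: m j z => [|m IH] [|j] /=.
- by move=> z /base[s [t [ht ->]]]; exists s, t.
- by move=> z ->; exists 0, 0; split=> //; rewrite mulr0 addr0.
- move=> [u v] /= [/IH[s [t [hs ht ->]]] ->].
  by exists (s, 0), (t, 0); split=> //=; rewrite x0; congr (_, _); rewrite addr0.
- move=> [u v] /= [/IH[s [t [hs ht ->]]] /IH[s' [t' [hs' ht' ->]]]].
  by exists (s, s'), (t, t').
Qed.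

Hypothesis x_regular : forall (i : 'I_e) r, first i (x i * r) -> first i r.
Hypothesis x_nilp : exists N, forall i, exists c : nat -> B,
  x i ^+ N = \sum_(p < n) c p * y p.
Hypothesis n_le_e : (n <= e)%N.

Let mulD b : additive_map (fun v : B => b * v).
Proof. by move=> u v; rewrite mulrDr. Qed.

Let TD p : additive_map (T p).
Proof. exact: mulD. Qed.

Let TC p q v : T p (T q v) = T q (T p v).
Proof. by rewrite /T mulrCA. Qed.

(** The induction runs downwards on the number [i] of elements of the regular
    sequence divided out: for [i = e] there are no chains left in degrees above
    [i], and the exact sequence of multiplication by [x i] shows that [x i] acts
    injectively on the homology of the previous quotient, while a power of [x i]
    lies in the ideal of the [y p] and so acts as zero. *)
Lemma kos_exact_mod i j (z : kos B n) : (i <= e)%N -> (i < j)%N ->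
  kos_in setT j z -> kos_in (first i) j.-1 (kos_diff T z) ->
  exists2 w, kos_in setT j.+1 w & kos_in (first i) j (z - kos_diff T w).
Proof.
have I0 l : first l 0 by exact: ideal_gen0.
have ID l a b : first l a -> first l b -> first l (a + b) by exact: ideal_genD.
have IN l a : first l a -> first l (- a) by exact: ideal_genN.
have IM l b a : first l a -> first l (b * a) by exact: ideal_genM.
have dD := kos_diffD (n := n) TD.
have setTD : forall a b : B, setT a -> setT b -> setT (a + b) by [].
move=> ie; rewrite -(subKn ie); move: (e - i)%N (leq_subr i e) => l le {i ie}.
elim: l le j z => [|l IH] le j z.
  rewrite subn0 => ej hz _; exists 0; first exact: kos_in0.
  rewrite (additive_map0 dD) subr0 (kos_in_gt _ hz) ?(leq_ltn_trans n_le_e) //.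
  by apply: kos_in0; exact: I0.
set i := (e - l.+1)%N => ij hz hdz.
have ie : (i < e)%N by rewrite /i; lia.
have eS : (e - l)%N = i.+1 by rewrite /i; lia.
move/(_ (ltnW le)): IH; rewrite eS => IH.
pose X := x (Ordinal ie); pose mX := fun v : B => X * v.
have XD : additive_map mX by exact: mulD.
have TX p v : (p < n)%N -> mX (T p v) = T p (mX v) by rewrite /mX /T mulrCA.
case: j ij hz hdz => // j ij hz hdz.
have inj (u : kos B n) : kos_in setT j.+1 u ->
  (exists2 w, kos_in setT j.+2 w &
     kos_in (first i) j.+1 (kos_map mX u - kos_diff T w)) ->
  exists2 w, kos_in setT j.+2 w & kos_in (first i) j.+1 (u - kos_diff T w).
  move=> hu [w hw huw].
  have dw : kos_in (first i.+1) j.+1 (kos_diff T w).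
    have -> : kos_diff T w = - (kos_map mX u - kos_diff T w) + kos_map mX u.
      by rewrite opprB subrK.
    apply: (kos_inD (@ID _)).
      apply: (kos_inN (@IN _)); apply: kos_in_sub huw.
      apply: ideal_gen_ind; [exact: I0 | exact: ID |].
      move=> r _ [q qi ->]; apply: IM; apply: ideal_gen_sub; exists q => //.
      exact: ltnW.
    apply: kos_in_map hu => // [|v _]; first exact: additive_map0.
    rewrite /mX mulrC; apply: IM; apply: ideal_gen_sub.
    by exists (Ordinal ie).
  have [|w' hw' hww'] := IH j.+2 w _ hw dw; first by rewrite ltnS.
  have [w1 [w2 [hw1 hw2 e12]]] := kos_in_ideal_step (i := Ordinal ie) hww'.
  exists w1 => //.
  have hXin : kos_in (first i) j.+1 (kos_map mX (u - kos_diff T w1)).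
    have -> : kos_map mX (u - kos_diff T w1) =
        (kos_map mX u - kos_diff T w) + kos_diff T w2.
      rewrite (additive_mapB _ _ (kos_mapD XD)) (kos_diff_map _ XD TX).
      rewrite -addrA; congr (_ + _).
      have {1}-> : w = kos_diff T w' + (kos_map mX w1 + w2) by rewrite -e12 addrC subrK.
      by rewrite !dD (kos_diffK TD TC) add0r opprD subrK.
    apply: (kos_inD (@ID _)) => //.
    apply: (kos_in_diff TD (I0 _) (@ID _) (@IN _)) hw2 => p a; exact: IM.
  have hS : kos_in setT j.+1 (u - kos_diff T w1).
    by apply: kos_inD => //; apply: kos_inN => //; exact: kos_in_diff hw1.
  apply: kos_in_sub (kos_in_preim hS hXin) => v.
  exact: (x_regular (i := Ordinal ie)).
have [N /(_ (Ordinal ie))[c xN]] := x_nilp.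
pose mP m := fun v : B => X ^+ m * v.
have down m : (exists2 w, kos_in setT j.+2 w &
     kos_in (first i) j.+1 (kos_map (mP m) z - kos_diff T w)) ->
  exists2 w, kos_in setT j.+2 w & kos_in (first i) j.+1 (z - kos_diff T w).
  elim: m => [|m IHm] h.
    have -> // : z = kos_map (mP 0) z.
    have : forall q (t : kos B q), t = kos_map (mP 0) t; last exact.
    by elim=> [|q IHq] //= t; [rewrite /mP mul1r | case: t => a b /=; rewrite -!IHq].
  apply: IHm; apply: inj; first by apply: kos_in_map hz => //; rewrite /mP mulr0.
  case: h => w hw h; exists w => //.
  rewrite kos_map_comp (@eq_kos_map _ _ _ (mP m.+1)) // => v.
  by rewrite /= /mX /mP exprS mulrA.
apply: (down N).
exists (\sum_(p < n) kos_map (fun v => c p * v) (kos_contr p z)).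
  apply: kos_in_sum => // p; by apply: (kos_in_map (P := setT)) => //; [rewrite mulr0 | exact: kos_in_contr].
have -> : kos_map (mP N) z = \sum_(p < n) kos_map (fun v => c p * v) (kos_map (T p) z).
  have e1 q (t : kos B q) : kos_map (mP N) t =
      \sum_(p < n) kos_map (fun v => c p * v) (kos_map (T p) t).
    elim: q t => [|q IHq] t /=.
      by rewrite /mP xN mulr_suml; apply: eq_bigr => p _; rewrite /T mulrA.
    by rewrite !IHq; elim/big_rec3: _ => [|p a b _ _ <-].
  exact: e1.
rewrite (additive_map_sum _ _ _ dD) -sumrB.
apply: (kos_in_sum _ (I0 _) (@ID _)) => p.
rewrite -(kos_homotopy TD z (ltn_ord p)) (kos_mapD (mulD _)).
rewrite (kos_diff_map (T' := T)) //; last by move=> q v _; rewrite /T mulrCA.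
rewrite addrAC subrr add0r.
apply: kos_in_map (kos_in_contr _ (I0 _) (@IN _) hdz) => //; first by rewrite mulr0.
by move=> v; exact: IM.
Qed.

Lemma kos_exact j (z : kos B n) : kos_in setT j.+1 z -> kos_diff T z = 0 ->
  exists2 w, kos_in setT j.+2 w & kos_diff T w = z.
Proof.
move=> hz dz; have [|w hw /kos_in_sub h] := kos_exact_mod (leq0n e) (ltn0Sn j) hz.
  by rewrite dz; apply: kos_in0; exact: ideal_gen0.
exists w => //; apply/esym/eqP; rewrite -subr_eq0; apply/eqP.
apply: (@kos_in_zero _ j.+1); apply: h; apply: ideal_gen_ind => //.
- by move=> a b -> ->; rewrite /= addr0.
- by move=> r u [[]].
Qed.

End DepthSensitivity.

(** * Homogeneous components *)

Lemma sum_uniq_widen (T : eqType) (V : zmodType) (s t : seq T) (f : T -> V) : uniq s -> uniq t ->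
  {subset s <= t} -> \sum_(i <- s) f i = \sum_(i <- t) (if i \in s then f i else 0).
Proof.
move=> us ut st; rewrite -big_mkcond -[RHS]big_filter; apply: perm_big.
apply: uniq_perm => //; first exact: filter_uniq.
by move=> i; rewrite mem_filter; case: (boolP (i \in s)) => // /st ->.
Qed.

Section Components.
Variables (T : eqType) (V : zmodType) (B : T -> set V).
Hypothesis B_sub : forall i, is_add_subgroup (B i).
Hypothesis B_dsum : is_direct_sum setT B.

(** The decomposition of [v] is not part of the data: [component] picks the
    coordinate in any of them, and uniqueness makes this well defined. *)
Definition component (i : T) (v : V) : V :=
  xget 0 [set w | exists (s : seq T) (f : T -> V),
    [/\ uniq s, forall j, j \in s -> B j (f j), v = \sum_(j <- s) f j
      & w = if i \in s then f i else 0]].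

Lemma subgroup0 i : B i 0. Proof. by case: (B_sub i). Qed.

Lemma subgroupB i u v : B i u -> B i v -> B i (u - v).
Proof. by case: (B_sub i) => _; apply. Qed.

Lemma subgroupN i u : B i u -> B i (- u).
Proof. by rewrite -sub0r => Bu; apply: subgroupB => //; exact: subgroup0. Qed.

Lemma subgroupD i u v : B i u -> B i v -> B i (u + v).
Proof. by move=> Bu Bv; rewrite -(opprK v); apply/subgroupB/subgroupN. Qed.

Lemma subgroup_sum i I (r : seq I) (P : pred I) F :
  (forall j, P j -> B i (F j)) -> B i (\sum_(j <- r | P j) F j).
Proof.
by move=> BF; apply: (big_ind (B i)) => //; [exact: subgroup0|exact: subgroupD].
Qed.

Lemma component_unique (s t : seq T) (f h : T -> V) i : uniq s -> uniq t ->
  (forall j, j \in s -> B j (f j)) -> (forall j, j \in t -> B j (h j)) ->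
  \sum_(j <- s) f j = \sum_(j <- t) h j ->
  (if i \in s then f i else 0) = (if i \in t then h i else 0).
Proof.
move=> us ut Bf Bh e; pose u := undup (s ++ t).
pose F j := (if j \in s then f j else 0) - (if j \in t then h j else 0).
have BF j : j \in u -> B j (F j).
  move=> _; apply: subgroupB; case: ifP => hj; try exact: subgroup0.
    exact: Bf.
  exact: Bh.
have F0 : \sum_(j <- u) F j = 0.
  rewrite sumrB -!sum_uniq_widen ?undup_uniq ?e ?subrr //.
    by move=> j js; rewrite mem_undup mem_cat js orbT.
  by move=> j js; rewrite mem_undup mem_cat js.
have [ui|] := boolP (i \in u).
  by apply/eqP; rewrite -subr_eq0; apply/eqP; exact: (B_dsum.2 u F (undup_uniq _) BF F0 i ui).
by rewrite mem_undup mem_cat negb_or => /andP[/negPf-> /negPf->].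
Qed.

Lemma componentE (s : seq T) (f : T -> V) i : uniq s ->
  (forall j, j \in s -> B j (f j)) ->
  component i (\sum_(j <- s) f j) = if i \in s then f i else 0.
Proof.
move=> us Bf; rewrite /component; case: xgetP => [w _|/(_ (if i \in s then f i else 0))].
  by move=> /= [t [h [ut Bh e ->]]]; apply: component_unique.
by case; exists s, f.
Qed.

Lemma component_split v : exists s : seq T,
  [/\ uniq s, forall i, i \notin s -> component i v = 0
     & v = \sum_(i <- s) component i v].
Proof.
have [s [f [us Bf ->]]] := (B_dsum.1 v).1 I.
exists s; split=> // [i /negPf|]; first by rewrite componentE // => ->.
by apply: eq_big_seq => i si; rewrite componentE // si.
Qed.

Lemma component_in i v : B i (component i v).
Proof.
have [s [f [us Bf ->]]] := (B_dsum.1 v).1 I.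
by rewrite componentE //; case: ifP => [/Bf|_] //; exact: subgroup0.
Qed.

Lemma component_id i v : B i v -> component i v = v.
Proof.
move=> Bv; have := @componentE [:: i] (fun=> v) i isT.
by rewrite big_seq1 inE eqxx; apply=> j; rewrite inE => /eqP ->.
Qed.

Lemma component_neq i j v : B j v -> i != j -> component i v = 0.
Proof.
move=> Bv /negPf ij; have := @componentE [:: j] (fun=> v) i isT.
by rewrite big_seq1 inE ij; apply=> l; rewrite inE => /eqP ->.
Qed.

Lemma componentD i : additive_map (component i).
Proof.
move=> u v; have [s [us s0 eu]] := component_split u.
have [t [ut t0 ev]] := component_split v.
pose r := undup (s ++ t).
have eq w q : uniq q -> (forall i, i \notin q -> component i w = 0) ->
    {subset q <= r} ->
    w = \sum_(i <- q) component i w -> w = \sum_(i <- r) component i w.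
  move=> uq q0 qr {1}->; rewrite (sum_uniq_widen _ uq (undup_uniq _) qr).
  by apply: eq_bigr => j _; case: ifPn => // /q0.
rewrite {1}(eq u s) // 1?{1}(eq v t) //; first last.
- by move=> j jt; rewrite mem_undup mem_cat jt.
- by move=> j jt; rewrite mem_undup mem_cat jt orbT.
rewrite -big_split componentE ?undup_uniq //=; last first.
  by move=> j _; apply: subgroupD; exact: component_in.
case: ifPn => //; rewrite mem_undup mem_cat negb_or => /andP[/s0-> /t0->].
by rewrite addr0.
Qed.

(** Homogeneous elements generate the group. *)
Lemma additive_map_homog (V' : zmodType) (f h : V -> V') :
  additive_map f -> additive_map h ->
  (forall i v, B i v -> f v = h v) -> f =1 h.
Proof.
move=> fD hD fh v; have [s [_ _ ->]] := component_split v.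
rewrite (additive_map_sum _ _ _ fD) (additive_map_sum _ _ _ hD).
by apply: eq_bigr => i _; apply: fh; exact: component_in.
Qed.

(** The universal property of the direct sum. *)
Lemma additive_map_glue (V' : zmodType) (f : T -> V -> V') :
  (forall i, additive_map (f i)) ->
  exists2 h : V -> V', additive_map h & forall i v, B i v -> h v = f i v.
Proof.
move=> fD.
have [S HS] := boolp.choice component_split.
pose h v := \sum_(i <- S v) f i (component i v).
have hE v (r : seq T) : uniq r -> {subset S v <= r} ->
    h v = \sum_(i <- r) f i (component i v).
  move=> ur sr; rewrite /h; have [us s0 _] := HS v.
  rewrite (sum_uniq_widen _ us ur sr); apply: eq_bigr => i _.
  by case: ifPn => // /s0 ->; rewrite additive_map0.
exists h.
  move=> u v; pose r := undup (S u ++ S v ++ S (u + v)).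
  rewrite !(hE _ r) ?undup_uniq //.
  - by rewrite -big_split; apply: eq_bigr => i _; rewrite componentD fD.
  - by move=> i hi; rewrite mem_undup !mem_cat hi ?orbT.
  - by move=> i hi; rewrite mem_undup !mem_cat hi ?orbT.
  - by move=> i hi; rewrite mem_undup !mem_cat hi ?orbT.
move=> i v Bv; rewrite (hE v (undup (i :: S v))) ?undup_uniq //; last first.
  by move=> j hj; rewrite mem_undup inE hj orbT.
rewrite (bigD1_seq i) ?undup_uniq ?mem_undup ?inE ?eqxx //=.
rewrite component_id // big1 ?addr0 // => j ji.
by rewrite (component_neq Bv ji) additive_map0.
Qed.

End Components.

Lemma dsum_of_projections (T : eqType) (V : zmodType) (B : T -> set V)
    (pi : T -> V -> V) :
  (forall i, additive_map (pi i)) -> (forall i v, B i (pi i v)) ->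
  (forall i v, B i v -> pi i v = v) ->
  (forall i j v, B j v -> i != j -> pi i v = 0) ->
  (forall v, exists s : seq T, uniq s /\ v = \sum_(i <- s) pi i v) ->
  is_direct_sum setT B.
Proof.
move=> piD piB pi_id pi_neq pis; split.
  move=> v; split=> // _; have [s [us e]] := pis v.
  by exists s, (fun i => pi i v); split.
move=> s f us Bf f0 i si; have := congr1 (pi i) f0.
rewrite (additive_map_sum _ _ _ (piD i)) (bigD1_seq i) //= pi_id; last exact: Bf.
rewrite (additive_map0 (piD i)) big_seq_cond big1 ?addr0 // => j /andP[js ij].
by apply: (pi_neq _ j); [exact: Bf | rewrite eq_sym].
Qed.

Lemma dsum_matrix (V : zmodType) (B : int -> set V) m n (sh : 'I_m -> 'I_n -> int) :
  (forall t, is_add_subgroup (B t)) -> is_direct_sum setT B ->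
  is_direct_sum setT (fun t => [set M : 'M[V]_(m, n) |
    forall p q, B (t + sh p q) (M p q)]).
Proof.
move=> Bs Bd; have cD := componentD Bs Bd.
apply: (dsum_of_projections (pi := fun t (M : 'M[V]_(m, n)) =>
  \matrix_(p, q) component B (t + sh p q) (M p q))).
- by move=> t M M'; apply/matrixP => p q; rewrite !mxE cD.
- by move=> t M p q; rewrite mxE; apply: component_in.
- by move=> t M BM; apply/matrixP => p q; rewrite mxE component_id.
- move=> t t' M BM tt'; apply/matrixP => p q; rewrite !mxE.
  by apply: (component_neq Bs Bd (BM p q)); rewrite (inj_eq (addIr _)).
move=> M.
have [S HS] := boolp.choice (fun pq => component_split Bs Bd (M pq.1 pq.2)).
pose s := undup (flatten [seq [seq l - sh pq.1 pq.2 | l <- S pq] | pq <- enum {: 'I_m * 'I_n}]).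
exists s; split; first exact: undup_uniq.
apply/matrixP => p q; rewrite summxE.
under eq_bigr do rewrite mxE.
have [us s0 {1}->] := HS (p, q); rewrite /= in us s0 *.
rewrite -[RHS](big_map (fun t => t + sh p q) xpredT (fun t => component B t (M p q))).
rewrite (sum_uniq_widen _ us (t := [seq t + sh p q | t <- s])).
- by apply: eq_bigr => l _; case: ifPn => // /s0 ->.
- by rewrite map_inj_uniq ?undup_uniq //; exact: addIr.
- move=> l ls; apply/mapP; exists (l - sh p q); last by rewrite subrK.
  rewrite mem_undup; apply/flattenP; exists [seq l - sh p q | l <- S (p, q)].
    by apply/mapP; exists (p, q) => //; rewrite mem_enum.
  by apply/mapP; exists l.
Qed.

Lemma subgroup_matrix (V : zmodType) (B : int -> set V) m n (sh : 'I_m -> 'I_n -> int) t :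
  (forall t, is_add_subgroup (B t)) ->
  is_add_subgroup [set M : 'M[V]_(m, n) | forall p q, B (t + sh p q) (M p q)].
Proof.
move=> Bs; split=> [p q|M M' hM hM' p q]; rewrite !mxE; first exact: subgroup0.
exact: subgroupB.
Qed.

Section HomogPoly.
Variables (k : fieldType) (n : nat).
Local Notation S := {mpoly k[n]}.
Implicit Types p q : S.

Definition hpart (t : int) (p : S) : S :=
  if t is Posz m then pihomog mdeg m p else 0.

Lemma homog_subgroup t : is_add_subgroup [set p : S | homog_of_degree t p].
Proof.
case: t => m /=; split=> //=; rewrite ?dhomog0 //.
- by move=> u v hu hv; rewrite rpredB.
- by move=> u v -> ->; rewrite subr0.
Qed.

Lemma hpartD t : additive_map (hpart t).
Proof. by case: t => m p q /=; rewrite ?addr0 // pihomogD. Qed.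

Lemma hpart_homog t p : homog_of_degree t (hpart t p).
Proof. by case: t => m //=; exact: pihomogP. Qed.

Lemma hpart_id t p : homog_of_degree t p -> hpart t p = p.
Proof. by case: t => m /=; [exact: pihomog_dE | move->]. Qed.

Lemma hpart_neq t t' p : homog_of_degree t' p -> t != t' -> hpart t p = 0.
Proof.
case: t => m //=; case: t' => m' /= hp; last by rewrite hp pihomog0.
by move=> mm'; apply: pihomog_ne0 hp; rewrite eq_sym.
Qed.

Lemma homog_dsum : is_direct_sum setT (fun t => [set p : S | homog_of_degree t p]).
Proof.
apply: (dsum_of_projections (pi := hpart)).
- exact: hpartD.
- exact: hpart_homog.
- exact: hpart_id.
- by move=> t t' p; exact: hpart_neq.
move=> p; exists [seq Posz i | i <- iota 0 (msize p)]; split.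
  by rewrite map_inj_uniq ?iota_uniq // => ? ? [].
rewrite big_map -{1}[msize p]subn0 -/(index_iota _ _) big_mkord.
exact: (pihomog_partitionE (leqnn _)).
Qed.

Lemma homogM t t' p q : homog_of_degree t p -> homog_of_degree t' q ->
  homog_of_degree (t + t') (p * q).
Proof.
case: t => m /= hp; last by rewrite hp mul0r => _; case: (_ + _) => l //=; exact: dhomog0.
case: t' => m' /= hq; last by rewrite hq mulr0; case: (_ + _) => l //=; exact: dhomog0.
exact: dhomogM.
Qed.

Lemma homogC c : homog_of_degree 0 (c%:MP : S).
Proof. by rewrite /= -[c%:MP]mulr1 mul_mpolyC; apply: dhomogZ; exact: dhomog1. Qed.

Lemma hpartM t t' p q : homog_of_degree t p -> hpart (t + t') (p * q) = p * hpart t' q.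
Proof.
move=> hp; move: q; apply: (additive_map_homog homog_subgroup homog_dsum).
- by move=> u v; rewrite mulrDr hpartD.
- by move=> u v; rewrite hpartD mulrDr.
move=> l v hv; have [->|ne] := eqVneq t' l.
  by rewrite !hpart_id //; exact: homogM.
rewrite (hpart_neq hv ne) mulr0 (hpart_neq (homogM hp hv)) //.
by rewrite (inj_eq (addrI _)).
Qed.

Lemma homog_neg t p : t < 0 -> homog_of_degree t p -> p = 0.
Proof. by case: t. Qed.

Lemma mpoly_add_ind (P : S -> Prop) :
  P 0 -> (forall p q, P p -> P q -> P (p + q)) ->
  (forall c m, P (c%:MP * 'X_[m])) -> forall p, P p.
Proof.
move=> P0 PD PX; elim/mpolyind => [//|c m p _ _ Pp].
by apply: PD => //; rewrite -mul_mpolyC; exact: PX.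
Qed.

Lemma mpoly_ring_ind (P : S -> Prop) :
  (forall c, P c%:MP) -> (forall i, P 'X_i) ->
  (forall p q, P p -> P q -> P (p + q)) ->
  (forall p q, P p -> P q -> P (p * q)) -> forall p, P p.
Proof.
move=> PC PX PD PM; have P1 : P 1 by rewrite -mpolyC1; exact: PC.
apply: mpoly_add_ind => //; first by rewrite -mpolyC0; exact: PC.
move=> c m; apply: (PM) => //; rewrite mpolyXE_id.
apply: (big_ind P) => [|p q|i _]; [exact: P1|exact: PM|].
elim: (m i) => [|l IH]; rewrite ?expr0 // exprS.
exact: PM.
Qed.

Lemma addm_subU (m : 'X_{1..n}) i : (0 < m i)%N -> m = (U_(i) + (m - U_(i)))%MM.
Proof.
move=> mi; rewrite addmC submK //; apply/mnm_lepP => q.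
by rewrite mnm1E; case: eqP => [<-|].
Qed.

Lemma mcoeffXM i p (m : 'X_{1..n}) :
  ('X_i * p)@_m = if (0 < m i)%N then p@_(m - U_(i)) else 0.
Proof.
rewrite mulrC; case: ifPn => [mi|]; first by rewrite {1}(addm_subU mi) mcoeffMX.
rewrite -leqNgt leqn0 => /eqP mi; apply/eqP; rewrite mcoeff_eq0.
rewrite (perm_mem (msuppMX _ _)); apply/mapP => -[m' _ em].
by move: mi; rewrite em mnmDE mnm1E eqxx.
Qed.

Variable (R : comAlgType k) (x : 'I_n -> R).

Lemma alg_evalD p q : alg_eval x (p + q) = alg_eval x p + alg_eval x q.
Proof. exact: rmorphD. Qed.
Lemma alg_evalM p q : alg_eval x (p * q) = alg_eval x p * alg_eval x q.
Proof. exact: rmorphM. Qed.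
Lemma alg_evalC c : alg_eval x c%:MP = in_alg R c.
Proof. exact: mmapC. Qed.
Lemma alg_evalX i : alg_eval x 'X_i = x i.
Proof. by rewrite /alg_eval mmapX mmap1U. Qed.
Lemma alg_eval0 : alg_eval x 0 = 0.
Proof. exact: rmorph0. Qed.
Lemma alg_evalB p q : alg_eval x (p - q) = alg_eval x p - alg_eval x q.
Proof. exact: rmorphB. Qed.
Lemma alg_eval1 : alg_eval x 1 = 1.
Proof. exact: rmorph1. Qed.

Lemma alg_eval_sum I (r : seq I) (P : pred I) (F : I -> S) :
  alg_eval x (\sum_(i <- r | P i) F i) = \sum_(i <- r | P i) alg_eval x (F i).
Proof. exact: rmorph_sum. Qed.
Lemma alg_evalZ c p : alg_eval x (c *: p) = c *: alg_eval x p.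
Proof. by rewrite -mul_mpolyC alg_evalM alg_evalC /= mulr_algl. Qed.

End HomogPoly.

(** * A homogeneous basis over the parameters *)

Section IdealPowers.
Variable B : comNzRingType.
Implicit Types I J : set B.

Lemma ideal_pow_ideal I i : is_ideal (ideal_pow I i).
Proof.
case: i => [|i] //=; split; [exact: ideal_gen0|exact: ideal_genD|exact: ideal_genM].
Qed.

Lemma ideal_powS_sub I i : ideal_pow I i.+1 `<=` ideal_pow I i.
Proof.
have [I0 ID IM] := ideal_pow_ideal I i.
apply: ideal_gen_ind => // r _ [u [v [_ Iv ->]]]; apply: (IM); exact: IM.
Qed.

Lemma ideal_pow_le I i j : (i <= j)%N -> ideal_pow I j `<=` ideal_pow I i.
Proof.
move=> /subnK <-; elim: (j - i)%N => [//|l IH] r /ideal_powS_sub; exact: IH.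
Qed.

Lemma ideal_powSM I i u v : I u -> ideal_pow I i v -> ideal_pow I i.+1 (u * v).
Proof. by move=> Iu Iv; apply: ideal_gen_sub; exists u, v. Qed.

Lemma ideal_pow_exp I u i : I u -> ideal_pow I i (u ^+ i).
Proof. by move=> Iu; elim: i => //= i IH; rewrite exprS; exact: ideal_powSM. Qed.

End IdealPowers.

Lemma ideal_pow_monomial (k : fieldType) (R : comAlgType k) n (x : 'I_n -> R)
    (I : set R) m : (forall i, I (x i)) ->
  ideal_pow I (mdeg m) (alg_eval x 'X_[m]).
Proof.
move=> xI; move: {2}(mdeg m) (erefl (mdeg m)) => l; elim: l m => [|l IH] m hl.
  by rewrite hl.
have [i mi] : exists i, (0 < m i)%N.
  apply/existsP; apply: contraPT hl; rewrite negb_exists => /forallP m0.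
  rewrite mdegE big1 // => i _; apply/eqP; rewrite -leqn0 leqNgt; exact: m0.
move: hl; rewrite (addm_subU mi) mdegD mdeg1 add1n => /eqP; rewrite eqSS => /eqP hl.
rewrite mpolyXD alg_evalM alg_evalX; apply: ideal_powSM; first exact: xI.
exact: IH.
Qed.

Lemma krull_dim_unique (B : comNzRingType) d d' :
  krull_dim_is B d -> krull_dim_is B d' -> d = d'.
Proof.
move=> [[C hC] hm] [[C' hC'] hm']; apply/eqP; rewrite eqn_leq.
by rewrite (hm' _ _ hC) (hm _ _ hC').
Qed.

Section GradedRing.
Variables (k : fieldType) (R : comAlgType k) (Rg : int -> set R).
Hypothesis Rsg : standard_graded Rg.

Lemma graded_subgroup t : is_add_subgroup (Rg t).
Proof. by case: Rsg. Qed.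

Lemma graded_dsum : is_direct_sum setT Rg.
Proof. by case: Rsg. Qed.

Lemma gradedM i j u v : Rg i u -> Rg j v -> Rg (i + j) (u * v).
Proof. by case: Rsg => _ _ + _ _; apply. Qed.

Lemma graded_neg i u : i < 0 -> Rg i u -> u = 0.
Proof. by case: Rsg => _ _ _ [+ _] _ i0; move=> /(_ _ i0) ->. Qed.

Lemma graded_in_alg c : Rg 0 (in_alg R c).
Proof. by case: Rsg => _ _ _ [_ ->] _; exists c. Qed.

Lemma graded_scale i c u : Rg i u -> Rg i (c *: u).
Proof.
move=> hu; have := gradedM (graded_in_alg c) hu.
by rewrite add0r /= mulr_algl.
Qed.

Lemma graded_exp u i : Rg 1 u -> Rg i%:Z (u ^+ i).
Proof.
move=> hu; elim: i => [|i IH].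
  by rewrite expr0 -(scale1r 1); exact: graded_in_alg.
by rewrite exprS -addn1 addnC PoszD; exact: gradedM.
Qed.

Lemma component_mulr l j u v : Rg j u ->
  component Rg (j + l) (u * v) = u * component Rg l v.
Proof.
have [gs gd] := (graded_subgroup, graded_dsum).
have cD := componentD gs gd.
move=> hu; move: v; apply: (additive_map_homog gs gd).
- by move=> v w; rewrite mulrDr cD.
- by move=> v w; rewrite cD mulrDr.
move=> i v hv; have [->|li] := eqVneq l i.
  by rewrite !(component_id gs gd) //; exact: gradedM.
rewrite (component_neq gs gd hv li) mulr0.
rewrite (component_neq gs gd (gradedM hu hv)) //.
by rewrite (inj_eq (addrI _)).
Qed.

Section LinearForms.
Variables (n : nat) (x : 'I_n -> R).
Hypothesis x1 : forall i, Rg 1 (x i).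

Lemma alg_eval_monomial m : Rg (mdeg m) (alg_eval x 'X_[m]).
Proof.
rewrite /alg_eval mmapX /mmap1 mdegE.
rewrite (big_morph Posz PoszD (erefl 0)).
apply: (big_ind2 (fun (a : R) b => Rg b a)) => [||i _].
- by rewrite -(scale1r 1); exact: graded_in_alg.
- by move=> a b a' b' ha ha'; exact: gradedM.
- exact: graded_exp.
Qed.

Lemma alg_eval_homog t p : homog_of_degree t p -> Rg t (alg_eval x p).
Proof.
have gs := graded_subgroup.
case: t => m /=; last by move=> ->; rewrite alg_eval0; exact: (subgroup0 gs).
move=> /dhomogP hp; rewrite (mpolyE p) alg_eval_sum big_seq_cond.
apply: (subgroup_sum gs) => m'; rewrite andbT => /hp <-.
by rewrite alg_evalZ; apply: graded_scale; exact: alg_eval_monomial.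
Qed.

Lemma alg_eval_homog_lift t r : algebra_generators x -> Rg t r ->
  exists2 p, homog_of_degree t p & alg_eval x p = r.
Proof.
have [gs gd] := (graded_subgroup, graded_dsum).
move=> gen hr; have [p ep] := gen r.
exists (hpart t p); first exact: hpart_homog.
rewrite -(component_id gs gd hr) ep.
move: p {ep}; apply: (additive_map_homog (@homog_subgroup k n) (@homog_dsum k n)).
- by move=> p q; rewrite hpartD alg_evalD.
- by move=> p q; rewrite alg_evalD (componentD gs gd).
move=> i p hp; have [->|ti] := eqVneq t i.
  by rewrite (component_id gs gd) ?hpart_id //; exact: alg_eval_homog.
by rewrite (component_neq gs gd (alg_eval_homog hp)) // (hpart_neq hp) // alg_eval0.
Qed.

End LinearForms.

Lemma homog_max_ideal1 u : Rg 1 u -> homog_max_ideal Rg u.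
Proof. by move=> hu; apply: ideal_gen_sub; exists 1. Qed.

(** The monomials of degree at least [N0] lie in [J], so the finitely many others
    span [R/J]; a maximal subset of them that is independent modulo [J] will do. *)
Lemma basis_mod_ideal (J : set R) N0 : is_ideal J ->
  ideal_pow (homog_max_ideal Rg) N0 `<=` J ->
  exists (N : nat) (e : 'I_N -> R) (delta : 'I_N -> nat),
    [/\ forall s, Rg (delta s) (e s),
        forall c : 'I_N -> k, J (\sum_s c s *: e s) -> forall s, c s = 0
      & forall r, exists c : 'I_N -> k, J (r - \sum_s c s *: e s)].
Proof.
move=> [J0 JD JM] hJ.
have JZ c u : J u -> J (c *: u) by rewrite -mulr_algl; exact: JM.
have [n [x [x1 gen]]] : exists n (x : 'I_n -> R),
    (forall i, Rg 1 (x i)) /\ algebra_generators x by case: Rsg.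
pose mon (t : 'X_{1..n < N0}) := alg_eval x 'X_[t].
pose indep (B : {set 'X_{1..n < N0}}) := forall c : 'X_{1..n < N0} -> k,
  J (\sum_(t in B) c t *: mon t) -> forall t, t \in B -> c t = 0.
have ind0 : indep finset.set0 by move=> c _ t; rewrite inE.
have [B /maxsetP[/asboolP indB maxB]] :
    exists B, maxset (fun B => `[< indep B >]) B.
  have [|B hB] := @ex_maxset _ (fun B => `[< indep B >]); last by exists B.
  by exists finset.set0; apply/asboolP.
have span1 t : exists c : 'X_{1..n < N0} -> k, J (mon t - \sum_(t in B) c t *: mon t).
  have [tB|tB] := boolP (t \in B).
    exists (fun u => (u == t)%:R); rewrite (bigD1 t) //= eqxx scale1r big1 ?addr0 ?subrr //.
    by move=> u /andP[_ /negPf->]; rewrite scale0r.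
  have /asboolPn : ~~ `[< indep (t |: B)%SET >].
    apply/negP => /maxB /(_ (finset.subsetUr _ _)) e.
    by move: tB; rewrite -e !inE eqxx.
  move=> /existsNP[c] /not_implyP[Jc] /existsNP[u] /not_implyP[uB /eqP cu].
  move: Jc; rewrite big_setU1 //= => Jc.
  have ct : c t != 0.
    apply/negP => /eqP ct0; move: Jc; rewrite ct0 scale0r add0r => /indB h.
    move: cu; move: uB; rewrite !inE => /orP[/eqP->|/h->]; rewrite ?ct0 eqxx //.
  exists (fun u => - ((c t)^-1 * c u)).
  have -> : mon t - \sum_(u in B) - ((c t)^-1 * c u) *: mon u =
      (c t)^-1 *: (c t *: mon t + \sum_(u in B) c u *: mon u).
    rewrite scalerDr scalerA mulVf // scale1r scaler_sumr -sumrN.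
    by congr (_ + _); apply: eq_bigr => v _; rewrite scaleNr opprK scalerA.
  exact: JZ.
have span r : exists c : 'X_{1..n < N0} -> k, J (r - \sum_(t in B) c t *: mon t).
  have [p ->] := gen r; elim/mpoly_add_ind: p => [|p q [c hc] [c' hc']|c m].
  - by exists (fun=> 0); rewrite alg_eval0 big1 ?subrr // => t _; rewrite scale0r.
  - exists (fun t => c t + c' t).
    have -> : alg_eval x (p + q) - \sum_(t in B) (c t + c' t) *: mon t =
      (alg_eval x p - \sum_(t in B) c t *: mon t) +
      (alg_eval x q - \sum_(t in B) c' t *: mon t); last exact: JD.
    rewrite alg_evalD addrACA -opprD -big_split /=; congr (_ - _).
    by apply: eq_bigr => t _; rewrite scalerDl.
  - rewrite mul_mpolyC alg_evalZ.
    have [mN|mN] := ltnP (mdeg m) N0; last first.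
      exists (fun=> 0); rewrite big1 ?subr0; last by move=> t _; rewrite scale0r.
      apply/JZ/hJ/(ideal_pow_le mN)/ideal_pow_monomial => i.
      exact: homog_max_ideal1.
    have [c' hc'] := span1 (BMultinom mN).
    exists (fun t => c * c' t); under eq_bigr do rewrite -scalerA.
    by rewrite -scaler_sumr -scalerBr; exact: JZ.
exists #|B|, (fun s => mon (enum_val s)), (fun s => mdeg (enum_val s : 'X_{1..n < N0})).
split.
- by move=> s; exact: alg_eval_monomial.
- move=> c hc s.
  pose c' (t : 'X_{1..n < N0}) := c (enum_rank_in (enum_valP s) t).
  have c'E i : c' (enum_val i) = c i by rewrite /c' enum_valK_in.
  rewrite -c'E; apply: indB; last exact: enum_valP.
  rewrite big_enum_val /=.
  by under eq_bigr do rewrite c'E.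
- move=> r; have [c hc] := span r; exists (c \o enum_val).
  by rewrite big_enum_val in hc.
Qed.

End GradedRing.

Lemma mpoly_constant_split (k : fieldType) d (f : {mpoly k[d]}) :
  exists g : 'I_d -> {mpoly k[d]}, f = (f@_0)%:MP + \sum_p 'X_p * g p.
Proof.
elim/mpoly_add_ind: f => [|f f' [g {1}->] [g' {1}->]|c m].
- by exists (fun=> 0); rewrite mcoeff0 mpolyC0 big1 ?addr0 // => p _; rewrite mulr0.
- exists (fun p => g p + g' p); rewrite mcoeffD mpolyCD addrACA -big_split /=.
  by congr (_ + _); apply: eq_bigr => p _; rewrite mulrDr.
- have [->|m0] := eqVneq m 0%MM.
    exists (fun=> 0); rewrite mpolyX0 mulr1 mcoeffC eqxx mulr1.
    by rewrite big1 ?addr0 // => p _; rewrite mulr0.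
  have [i mi] : exists i, (0 < m i)%N.
    apply/existsP; apply: contraNT m0; rewrite negb_exists => /forallP h.
    rewrite -mdeg_eq0 mdegE big1 // => i _; apply/eqP.
    by rewrite -leqn0 leqNgt; exact: h.
  exists (fun p => if p == i then c%:MP * 'X_[m - U_(i)] else 0).
  rewrite mcoeffCM mcoeffX (negPf m0) mulr0 mpolyC0 add0r.
  rewrite (bigD1 i) //= eqxx big1 ?addr0; last by move=> p /negPf->; rewrite mulr0.
  by rewrite {1}(addm_subU mi) mpolyXD mulrCA.
Qed.

Section ParameterBasis.
Variables (k : fieldType) (R : comAlgType k) (Rg : int -> set R).
Variables (d N : nat) (y : 'I_d -> R).
Local Notation A := {mpoly k[d]}.

(** [cs s] is the coordinate function dual to [e s] for [R] as a module over
    the polynomial ring in the parameters. *)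
Definition parameter_basis (e : 'I_N -> R) (delta : 'I_N -> nat)
    (cs : 'I_N -> R -> A) :=
  [/\ forall s, Rg (delta s) (e s),
      forall r, r = \sum_s alg_eval y (cs s r) * e s
    & forall (a : 'I_N -> A) s, cs s (\sum_u alg_eval y (a u) * e u) = a s].

Hypothesis Rsg : standard_graded Rg.
Hypothesis y1 : forall p, Rg 1 (y p).
Let J := ideal_gen (range y).
Variables (e : 'I_N -> R) (delta : 'I_N -> nat).
Hypothesis e_homog : forall s, Rg (delta s) (e s).
Hypothesis e_indep : forall c : 'I_N -> k, J (\sum_s c s *: e s) -> forall s, c s = 0.
Hypothesis e_span : forall r, exists c : 'I_N -> k, J (r - \sum_s c s *: e s).

Let comb (a : 'rV[A]_N) : R := \sum_s alg_eval y (a 0 s) * e s.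

Let combD : additive_map comb.
Proof.
move=> a b; rewrite /comb -big_split; apply: eq_bigr => s _.
by rewrite mxE alg_evalD mulrDl.
Qed.

Let combZ f a : comb (f *: a) = alg_eval y f * comb a.
Proof.
by rewrite /comb mulr_sumr; apply: eq_bigr => s _; rewrite mxE alg_evalM mulrA.
Qed.

(** Graded Nakayama: the part of [r] in [J] has coefficients of smaller degree. *)
Lemma parameters_span r : exists a, comb a = r.
Proof.
have [gs gd] := (graded_subgroup Rsg, graded_dsum Rsg).
have cD := componentD gs gd.
have comb0 := additive_map0 combD.
have hgen m : forall l r, l < m%:Z -> Rg l r -> exists a, comb a = r.
  elim: m => [|m IH] l {}r lm hr.
    by exists 0; rewrite comb0 (graded_neg Rsg lm hr).
  have [c /ideal_gen_range[b hb]] := e_span r.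
  have [a ha] : exists a : 'I_d -> 'rV[A]_N, forall p, comb (a p) = component Rg (l - 1) (b p).
    have h p : exists a, comb a = component Rg (l - 1) (b p).
      by apply: (IH (l - 1)); [lia | exact: component_in].
    by have [a ha] := boolp.choice h; exists a.
  exists ((\row_s (if l == delta s then (c s)%:MP else 0)) + \sum_p 'X_p *: a p).
  rewrite combD (additive_map_sum _ _ _ combD) -[RHS](component_id gs gd hr).
  have -> : r = \sum_s c s *: e s + \sum_p b p * y p by rewrite -hb addrC subrK.
  rewrite cD !(additive_map_sum _ _ _ (cD l)); congr (_ + _).
    apply: eq_bigr => s _; rewrite mxE; case: eqVneq => [->|ls].
      rewrite alg_evalC /= mulr_algl (component_id gs gd) //.
      exact: graded_scale.
    rewrite alg_eval0 mul0r (component_neq gs gd _ ls) //.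
    exact: graded_scale.
  apply: eq_bigr => p _; rewrite combZ alg_evalX ha.
  by rewrite -(component_mulr Rsg _ _ (y1 p)) addrC subrK mulrC.
have [s [_ _ ->]] := component_split gs gd r.
elim: s => [|l s [a ha]]; first by exists 0; rewrite big_nil comb0.
have [b hb]   := hgen (`|l|%N.+1) l (component Rg l r) (ltac:(lia)) (component_in gs gd _ _).
by exists (b + a); rewrite combD hb ha big_cons.
Qed.

Hypothesis y_exact : forall z : kos R d, kos_in setT 1 z ->
  kos_diff (fun p v => oapp y 0 (insub p) * v) z = 0 ->
  exists2 w, kos_in setT 2 w & kos_diff (fun p v => oapp y 0 (insub p) * v) w = z.

(** A relation has no constant terms, so it is a boundary in the Koszul complex
    of the free module; exactness in degree one downstairs corrects the chain
    by a boundary so that its entries are relations again.  Hence the relations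
    lie in every power of the irrelevant ideal. *)
Lemma parameters_free a : comb a = 0 -> a = 0.
Proof.
have comb0 := additive_map0 combD.
pose TR := fun (p : nat) (v : R) => oapp y 0 (insub p) * v.
pose TA := fun (p : nat) (v : 'rV[A]_N) => oapp (fun i : 'I_d => 'X_i) 0 (insub p) *: v.
have TAD p : additive_map (TA p) by move=> u v; exact: scalerDr.
have TAC p q v : TA p (TA q v) = TA q (TA p v).
  by rewrite /TA !scalerA mulrC.
have TAE (p : 'I_d) v : TA p v = 'X_p *: v by rewrite /TA valK.
have combT p v : (p < d)%N -> comb (TA p v) = TR p (comb v).
  by move=> pd; rewrite /TA combZ /TR insubT /= alg_evalX.
have step b : comb b = 0 -> exists b' : 'I_d -> 'rV[A]_N,
    (forall p, comb (b' p) = 0) /\ b = \sum_p 'X_p *: b' p.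
  move=> hb.
  have b0 s : (b 0 s)@_0 = 0.
    apply: (e_indep (c := fun s => (b 0 s)@_0)); apply/ideal_gen_range.
    have [g hg] := boolp.choice (fun s => mpoly_constant_split (b 0 s)).
    exists (fun p => - \sum_s alg_eval y (g s p) * e s).
    apply/eqP; rewrite -subr_eq0; apply/eqP; rewrite -[RHS]hb /comb -sumrN.
    under [X in _ + X]eq_bigr do rewrite mulNr opprK mulr_suml.
    rewrite exchange_big -big_split; apply: eq_bigr => u _ /=.
    rewrite [in RHS](hg u) alg_evalD alg_evalC mulrDl /= mulr_algl; congr (_ + _).
    rewrite alg_eval_sum mulr_suml; apply: eq_bigr => p _.
    by rewrite alg_evalM alg_evalX mulrC mulrA.
  have [g hg] : exists g : nat -> 'rV[A]_N, b = \sum_(p < d) TA p (g p).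
    have [g hg] := boolp.choice (fun s => mpoly_constant_split (b 0 s)).
    exists (fun p => oapp (fun i => \row_s g s i) 0 (insub p)).
    apply/rowP => s; rewrite summxE (hg s) b0 mpolyC0 add0r.
    by apply: eq_bigr => p _; rewrite TAE mxE valK /= mxE.
  have [z hz dz] := kos_diff1_ex TAD d g.
  have [||w hw dw] := y_exact (z := kos_map comb z).
  - exact: kos_in_map hz.
  - rewrite -(kos_diff_map (T := TA)) // dz -hg kos_map_emb // hb.
    by rewrite (additive_map0 (@kos_embD _ _)).
  have [w' hw' ew] := kos_in_lift comb0 parameters_span hw.
  have hz' : kos_in [set v | comb v = 0] 1 (z - kos_diff TA w').
    have hk : kos_in setT 1 (z - kos_diff TA w').
      by apply: kos_inD => //; apply: kos_inN => //; exact: kos_in_diff hw'.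
    apply: (kos_in_preim (P := [set 0]) hk).
    rewrite (additive_mapB _ _ (kos_mapD combD)) (kos_diff_map (T' := TR)) //.
    by rewrite ew dw subrr; exact: kos_in0.
  have [b' hb' e'] := kos_diff1 TAD (P := [set v | comb v = 0]) comb0 hz'.
  exists (fun p => b' p); split; first by move=> p; exact: hb'.
  move: e'; rewrite (additive_mapB _ _ (@kos_diffD _ _ TAD _)) kos_diffK // subr0 dz -hg.
  move=> e'.
  have emb_inj m : injective (@kos_emb 'rV[A]_N m).
    by elim: m => [|m IH] //= u v [/IH].
  by rewrite {1}(emb_inj _ _ _ e'); apply: eq_bigr => p _; rewrite TAE.
have order m : forall b, comb b = 0 -> forall s t, (mdeg t < m)%N -> (b 0 s)@_t = 0.
  elim: m => [//|m IH] b /step[b' [hb' ->]] s t tm.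
  rewrite summxE raddf_sum big1 //= => p _; rewrite mxE.
  rewrite mcoeffXM; case: ifP => // tp; apply: IH => //.
  by move: tm; rewrite {1}(addm_subU tp) mdegD mdeg1.
move=> ha; apply/rowP => s; apply/mpolyP => t; rewrite mxE mcoeff0.
by rewrite (order (mdeg t).+1).
Qed.

Lemma parameter_basis_exists : exists cs, parameter_basis e delta cs.
Proof.
have [f hf] := boolp.choice parameters_span.
exists (fun s r => f r 0 s); split=> // [r|a s]; first by rewrite -[LHS]hf.
set r := \sum_u _; have : comb (f r - \row_u a u) = 0.
  rewrite (additive_mapB _ _ combD) hf /comb /r.
  by apply/eqP; rewrite subr_eq0; apply/eqP/eq_bigr => u _; rewrite mxE.
by move=> /parameters_free/eqP; rewrite subr_eq0 => /eqP ->; rewrite mxE.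
Qed.

End ParameterBasis.

Section Coordinates.
Variables (k : fieldType) (R : comAlgType k) (Rg : int -> set R) (d N : nat).
Variables (y : 'I_d -> R) (e : 'I_N -> R) (delta : 'I_N -> nat).
Variable cs : 'I_N -> R -> {mpoly k[d]}.
Hypothesis basis : parameter_basis Rg y e delta cs.

Lemma coord_unique r (a : 'I_N -> {mpoly k[d]}) :
  r = \sum_u alg_eval y (a u) * e u -> forall s, cs s r = a s.
Proof. by case: basis => _ _ free ->. Qed.

Lemma coord_expand r : r = \sum_u alg_eval y (cs u r) * e u.
Proof. by case: basis. Qed.

Lemma coordD s : additive_map (cs s).
Proof.
move=> r r'; apply: (@coord_unique _ (fun s => cs s r + cs s r')).
rewrite {1}[r]coord_expand {1}[r']coord_expand -big_split.
by apply: eq_bigr => u _; rewrite alg_evalD mulrDl.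
Qed.

Lemma coordM s a r : cs s (alg_eval y a * r) = a * cs s r.
Proof.
apply: (@coord_unique _ (fun s => a * cs s r)).
rewrite {1}[r]coord_expand mulr_sumr.
by apply: eq_bigr => u _; rewrite alg_evalM mulrA.
Qed.

Lemma coord_basis s u : cs s (e u) = (s == u)%:R.
Proof.
apply: (@coord_unique _ (fun s => (s == u)%:R)).
rewrite (bigD1 u) //= eqxx alg_eval1 mul1r big1 ?addr0 // => s' /negPf ->.
by rewrite alg_eval0 mul0r.
Qed.

Hypothesis Rsg : standard_graded Rg.
Hypothesis y1 : forall p, Rg 1 (y p).

Lemma coord_component l r s :
  cs s (component Rg l r) = hpart (l - (delta s)%:Z) (cs s r).
Proof.
have [gs gd] := (graded_subgroup Rsg, graded_dsum Rsg).
have [e_homog _ _] := basis.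
have cD := componentD gs gd.
have comp u a : component Rg l (alg_eval y a * e u) =
    alg_eval y (hpart (l - (delta u)%:Z) a) * e u.
  move: a; apply: (additive_map_homog (@homog_subgroup k d) (@homog_dsum k d)).
  - by move=> a a'; rewrite alg_evalD mulrDl cD.
  - by move=> a a'; rewrite hpartD alg_evalD mulrDl.
  move=> t a ha; have hae := gradedM Rsg (alg_eval_homog Rsg y1 ha) (e_homog u).
  have [lt|lt] := eqVneq (l - (delta u)%:Z) t.
    rewrite lt hpart_id // (component_id gs gd) // (_ : l = t + (delta u)%:Z) // -lt.
    by rewrite subrK.
  rewrite (hpart_neq ha) // alg_eval0 mul0r; apply: (component_neq gs gd hae).
  by apply: contraNneq lt => ->; rewrite addrK.
apply: (coord_unique (a := fun s => hpart (l - (delta s)%:Z) (cs s r))).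
rewrite {1}[r]coord_expand (additive_map_sum _ _ _ (cD l)).
by apply: eq_bigr => u _; rewrite comp.
Qed.

Lemma coord_homog l r s : Rg l r -> homog_of_degree (l - (delta s)%:Z) (cs s r).
Proof.
move=> hr; rewrite -(component_id (graded_subgroup Rsg) (graded_dsum Rsg) hr).
rewrite coord_component; exact: hpart_homog.
Qed.

End Coordinates.

Theorem free_over_parameters (k : fieldType) (R : comAlgType k)
    (Rg : int -> set R) (d : nat) (y : 'I_d -> R) :
  standard_graded Rg -> cohen_macaulay Rg -> krull_dim_is R d ->
  (forall p, Rg 1 (y p)) -> system_of_parameters Rg y ->
  exists N (e : 'I_N -> R) delta cs, parameter_basis Rg y e delta cs.
Proof.
move=> Rsg [d' hd' [[x xm [xreg _]] _]] hd y1 [_ _ [M hM]].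
have ed := krull_dim_unique hd' hd; subst d'.
have Jideal : is_ideal (ideal_gen (range y)).
  by split; [exact: ideal_gen0|exact: ideal_genD|exact: ideal_genM].
have [N [e [delta [e_homog e_indep e_span]]]] := basis_mod_ideal Rsg Jideal hM.
exists N, e, delta; apply: parameter_basis_exists => // z hz dz.
apply: (kos_exact (x := x)) hz dz => //.
exists M => i; have /ideal_gen_range[c ->] := hM _ (ideal_pow_exp M (xm i)).
exists (fun p => oapp c 0 (insub p)); apply: eq_bigr => p _.
by rewrite !valK.
Qed.

(** * Linear changes of coordinates *)

Lemma homog0_const (k : fieldType) n (p : {mpoly k[n]}) :
  homog_of_degree 0 p -> p = (p@_0)%:MP.
Proof.
move=> hp; apply/mpolyP => m; rewrite mcoeffC.
have [->|m0] := eqVneq m 0%MM; first by rewrite mulr1.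
rewrite mulr0; apply: (dhomog_nemf_coeff hp).
by rewrite mdeg_eq0.
Qed.

Lemma mpoly_standard_graded (k : fieldType) n :
  standard_graded (fun t => [set p : {mpoly k[n]} | homog_of_degree t p]).
Proof.
split.
- exact: homog_subgroup.
- exact: homog_dsum.
- by move=> i j u v; exact: homogM.
- split; first by move=> [] // i _; apply/seteqP; split=> [p|_ ->].
  apply/seteqP; split=> [p /homog0_const ->|_ [c _ <-]] /=.
    by exists p@_0 => //=; rewrite -mul_mpolyC mulr1.
  by rewrite -mul_mpolyC mulr1; exact: homogC.
exists n, (fun i => 'X_i); split=> [i /=|p].
  by rewrite dhomogX /= mdeg1.
exists p; apply/esym; elim/mpoly_ring_ind: p.
- by move=> c; rewrite alg_evalC /= -mul_mpolyC mulr1.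
- by move=> i; rewrite alg_evalX.
- by move=> p q hp hq; rewrite alg_evalD hp hq.
- by move=> p q hp hq; rewrite alg_evalM hp hq.
Qed.

Section AlgEvalMatrix.
Variables (k : fieldType) (R : comAlgType k) (n : nat) (x : 'I_n -> R).

Lemma alg_eval_mulmx m p q (M : 'M[{mpoly k[n]}]_(m, p)) (M' : 'M_(p, q)) :
  map_mx (alg_eval x) (M *m M') = map_mx (alg_eval x) M *m map_mx (alg_eval x) M'.
Proof.
apply/matrixP => i j; rewrite !mxE alg_eval_sum.
by apply: eq_bigr => l _; rewrite alg_evalM !mxE.
Qed.

Lemma alg_eval_map_mx0 m p :
  map_mx (alg_eval x) (0 : 'M[{mpoly k[n]}]_(m, p)) = 0.
Proof. by apply/matrixP => i j; rewrite !mxE alg_eval0. Qed.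

End AlgEvalMatrix.

Section LinearSubstitution.
Variables (k : fieldType) (n : nat).
Local Notation S := {mpoly k[n]}.

Definition lin_comb (V : lmodType k) (P : 'M[k]_n) (x : 'I_n -> V) : 'I_n -> V :=
  fun q => \sum_r P q r *: x r.

Definition lin_subst (P : 'M[k]_n) : S -> S :=
  alg_eval (lin_comb P (fun i => 'X_i : S)).

Lemma alg_eval_subst (R : comAlgType k) (x : 'I_n -> R) P f :
  alg_eval x (lin_subst P f) = alg_eval (lin_comb P x) f.
Proof.
elim/mpoly_ring_ind: f => [c|i|p q hp hq|p q hp hq].
- by rewrite /lin_subst !alg_evalC alg_evalZ alg_eval1.
- rewrite /lin_subst !alg_evalX alg_eval_sum; apply: eq_bigr => r _.
  by rewrite alg_evalZ alg_evalX.
- by rewrite /lin_subst !alg_evalD hp hq.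
- by rewrite /lin_subst !alg_evalM hp hq.
Qed.

Lemma lin_comb_mul (V : lmodType k) P Q (x : 'I_n -> V) q :
  lin_comb P (lin_comb Q x) q = lin_comb (P *m Q) x q.
Proof.
rewrite /lin_comb; under eq_bigr do rewrite scaler_sumr.
rewrite exchange_big; apply: eq_bigr => r _.
by rewrite mxE scaler_suml; apply: eq_bigr => l _; rewrite scalerA.
Qed.

Lemma lin_comb1 (V : lmodType k) (x : 'I_n -> V) q : lin_comb 1%:M x q = x q.
Proof.
rewrite /lin_comb (bigD1 q) //= mxE eqxx scale1r big1 ?addr0 // => r rq.
by rewrite mxE eq_sym (negPf rq) scale0r.
Qed.

Lemma eq_alg_eval (R : comAlgType k) (x x' : 'I_n -> R) f :
  x =1 x' -> alg_eval x f = alg_eval x' f.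
Proof. by move=> /boolp.funext ->. Qed.

Lemma alg_eval_id (f : S) : alg_eval (fun i => 'X_i : S) f = f.
Proof.
elim/mpoly_ring_ind: f => [c|i|p q hp hq|p q hp hq].
- by rewrite alg_evalC /= -mul_mpolyC mulr1.
- by rewrite alg_evalX.
- by rewrite alg_evalD hp hq.
- by rewrite alg_evalM hp hq.
Qed.

Lemma lin_substK P Q f : P *m Q = 1%:M -> lin_subst Q (lin_subst P f) = f.
Proof.
move=> PQ; rewrite {1}/lin_subst alg_eval_subst -[RHS]alg_eval_id.
by apply: eq_alg_eval => q; rewrite lin_comb_mul PQ lin_comb1.
Qed.

Lemma lin_subst_homog P t f : homog_of_degree t f -> homog_of_degree t (lin_subst P f).
Proof.
move=> hf; apply: (alg_eval_homog (mpoly_standard_graded k n)) hf => i /=.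
by apply: rpred_sum => r _; apply: rpredZ; rewrite dhomogX /= mdeg1.
Qed.

End LinearSubstitution.

Section ChangeOfCoordinates.
Variables (k : fieldType) (R : comAlgType k) (Rg : int -> set R) (n : nat).
Variables (x : 'I_n -> R) (F : graded_free_resolution Rg x).
Variables (P Q : 'M[k]_n).
Hypothesis (PQ : P *m Q = 1%:M) (QP : Q *m P = 1%:M).
Local Notation S := {mpoly k[n]}.
Local Notation phi := (lin_subst P).
Local Notation theta := (lin_subst Q).

Let phiK m p : cancel (map_mx phi : 'M_(m, p) -> _) (map_mx theta).
Proof. by move=> M; apply/matrixP => i j; rewrite !mxE lin_substK. Qed.
Let thetaK m p : cancel (map_mx theta : 'M_(m, p) -> _) (map_mx phi).
Proof. by move=> M; apply/matrixP => i j; rewrite !mxE lin_substK. Qed.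

(** Only the differentials move, by the inverse substitution: a linear change of
    variables respects degrees. *)
Definition change_resolution : graded_free_resolution Rg (lin_comb P x).
Proof.
refine (@GradedFreeResolution _ _ Rg n (lin_comb P x) (rk F) (@deg _ _ _ _ _ F)
  (fun i => map_mx theta (diff F i)) (@aug _ _ _ _ _ F) _ _ _ _ _).
- by move=> i p q; rewrite mxE; apply: lin_subst_homog; exact: diff_homog.
- exact: aug_homog.
- move=> r; have [v ->] := aug_surj F r; exists (map_mx theta v).
  by apply: eq_bigr => q _; rewrite mxE -alg_eval_subst lin_substK.
- move=> v.
  have -> : \sum_q alg_eval (lin_comb P x) (v 0 q) * @aug _ _ _ _ _ F q =
      \sum_q alg_eval x (map_mx phi v 0 q) * @aug _ _ _ _ _ F q.
    by apply: eq_bigr => q _; rewrite mxE alg_eval_subst.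
  rewrite exact_aug; split=> -[u e]; [exists (map_mx theta u)|exists (map_mx phi u)].
    by rewrite -alg_eval_mulmx -e phiK.
  by rewrite e alg_eval_mulmx thetaK.
- move=> i v; have -> : v *m map_mx theta (diff F i) =
      map_mx theta (map_mx phi v *m diff F i).
    by rewrite alg_eval_mulmx phiK.
  split=> [/(congr1 (map_mx phi))|[u ->]].
    rewrite thetaK alg_eval_map_mx0 => /exact_diff[u e]; exists (map_mx theta u).
    by rewrite -alg_eval_mulmx -e phiK.
  rewrite [map_mx phi _]alg_eval_mulmx thetaK.
  suff -> : map_mx phi u *m diff F i.+1 *m diff F i = 0 by rewrite alg_eval_map_mx0.
  by apply/exact_diff; exists (map_mx phi u).
Defined.

Lemma change_iso_Ext g (W : lmodType R) (Wg : int -> set W) :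
  graded_iso_Ext F g Wg -> graded_iso_Ext change_resolution g Wg.
Proof.
move=> [psi [psiL psiS psi0 psig]].
have coc (w : 'cV[S]_(rk F g)) : @cocycle _ _ _ _ _ change_resolution g w ->
    @cocycle _ _ _ _ _ F g (map_mx phi w).
  rewrite /cocycle /= => /(congr1 (map_mx phi)).
  by rewrite alg_eval_mulmx thetaK alg_eval_map_mx0.
have coc' (w : 'cV[S]_(rk F g)) : @cocycle _ _ _ _ _ F g w ->
    @cocycle _ _ _ _ _ change_resolution g (map_mx theta w).
  by rewrite /cocycle /= => h; rewrite -alg_eval_mulmx h alg_eval_map_mx0.
exists (fun w => psi (map_mx phi w)); split.
- move=> s w1 w2 h1 h2; rewrite -alg_eval_subst -psiL; [|exact: coc|exact: coc].
  by congr psi; apply/matrixP => i j; rewrite !mxE /lin_subst alg_evalD alg_evalM.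
- move=> v; have [w hw <-] := psiS v; exists (map_mx theta w); first exact: coc'.
  by rewrite thetaK.
- move=> w hw; rewrite (psi0 _ (coc _ hw)).
  case: (g) w {hw} => [|g'] /= w; rewrite /coboundary /=.
    split=> [/(congr1 (map_mx theta))|->]; last by rewrite alg_eval_map_mx0.
    by rewrite phiK alg_eval_map_mx0.
  split=> -[u e]; [exists (map_mx theta u)|exists (map_mx phi u)].
    by rewrite -alg_eval_mulmx -e phiK.
  by rewrite e alg_eval_mulmx thetaK.
- move=> t w hw hd; apply: psig; first exact: coc.
  by move=> p; rewrite mxE; apply: lin_subst_homog; exact: hd.
Qed.

End ChangeOfCoordinates.

(** Gaussian elimination writes [C] as a unit times [(1 0)] times a unit. *)
Lemma complete_row_free (k : fieldType) d g (C : 'M[k]_(d, d + g)) : row_free C ->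
  exists2 P : 'M_(d + g), P \in unitmx & usubmx P = C.
Proof.
move=> /eqP rC; exists (block_mx (col_ebase C) 0 0 1%:M *m row_ebase C).
  rewrite unitmx_mul row_ebase_unit andbT unitmxE det_ublock det1 mulr1 -unitmxE.
  exact: col_ebase_unit.
rewrite /block_mx mul_col_mx col_mxKu -[RHS]mulmx_ebase.
by rewrite rC pid_mx_row mul_mx_row mulmx1 mulmx0.
Qed.

Section AdaptedCoordinates.
Variables (k : fieldType) (R : comAlgType k) (Rg : int -> set R) (d : nat).
Variables (y : 'I_d -> R) (W : lmodType R) (Wg : int -> set W).
Hypothesis Rsg : standard_graded Rg.
Hypothesis y1 : forall p, Rg 1 (y p).
Hypothesis y_indep : forall v : 'rV[k]_d, \sum_p v 0 p *: y p = 0 -> v = 0.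

Lemma linear_forms_span n (x : 'I_n -> R) u : (forall i, Rg 1 (x i)) ->
  algebra_generators x -> Rg 1 u -> exists c : 'I_n -> k, u = \sum_q c q *: x q.
Proof.
move=> x1 gen hu; have [p /dhomogP hp <-] := alg_eval_homog_lift Rsg x1 gen hu.
rewrite (mpolyE p) alg_eval_sum big_seq_cond.
apply: (big_ind (fun v => exists c : 'I_n -> k, v = \sum_q c q *: x q)).
- by exists (fun=> 0); rewrite big1 // => q _; rewrite scale0r.
- move=> _ _ [c ->] [c' ->]; exists (fun q => c q + c' q).
  by rewrite -big_split; apply: eq_bigr => q _; rewrite scalerDl.
- move=> m; rewrite andbT => /hp /eqP/mdeg1P[i /eqP ->].
  exists (fun q => if q == i then p@_(U_(i)) else 0).
  rewrite (bigD1 i) //= eqxx alg_evalZ alg_evalX big1 ?addr0 // => q /negPf ->.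
  by rewrite scale0r.
Qed.

(** Linearly independent linear forms are part of a coordinate system, over which
    the polynomial ring becomes one over the ring in the parameters. *)
Lemma adapted_resolution : canonical_module Rg Wg ->
  exists (g : nat) (x : 'I_(d + g) -> R) (i : nat) (F : graded_free_resolution Rg x),
    [/\ forall q, Rg 1 (x q), algebra_generators x, forall p, x (lshift g p) = y p
      & graded_iso_Ext F i Wg].
Proof.
move=> [_ [n [x [i [F [x1 gen _ iso]]]]]].
have [c hc] := boolp.choice (fun p => linear_forms_span x1 gen (y1 p)).
pose C := \matrix_(p < d, q < n) c p q.
have Cfree : row_free C.
  apply: inj_row_free => v vC; apply: y_indep.
  under eq_bigr do rewrite hc scaler_sumr.
  rewrite exchange_big big1 // => q _; under eq_bigr do rewrite scalerA.
  rewrite -scaler_suml; have := congr1 (fun M : 'rV_n => M 0 q) vC.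
  rewrite !mxE; under eq_bigr do rewrite mxE; by move=> ->; rewrite scale0r.
have dn : (d <= n)%N by rewrite -(eqP Cfree) rank_leq_col.
have [g en] : exists g, n = (d + g)%N by exists (n - d)%N; rewrite subnKC.
subst n; have [P Pu PC] := complete_row_free Cfree.
have [PQ QP] := (mulmxV Pu, mulVmx Pu).
have x'1 q : Rg 1 (lin_comb P x q).
  apply: (subgroup_sum (graded_subgroup Rsg)) => r _; exact: graded_scale.
exists g, (lin_comb P x), i, (change_resolution F PQ QP); split=> //.
- move=> r; have [p ->] := gen r; exists (lin_subst (invmx P) p).
  by rewrite -alg_eval_subst lin_substK.
- move=> p; rewrite hc; apply: eq_bigr => q _; congr (_ *: _).
  have := congr1 (fun M : 'M_(d, d + g) => M p q) PC.
  by rewrite !mxE.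
- exact: change_iso_Ext.
Qed.

End AdaptedCoordinates.

(** A linear relation would be a nonzero element of the polynomial ring killing
    a basis element. *)
Lemma parameters_independent (k : fieldType) (R : comAlgType k) (Rg : int -> set R)
    d N (y : 'I_d -> R) (e : 'I_N -> R) delta cs (v : 'rV[k]_d) :
  parameter_basis Rg y e delta cs -> \sum_p v 0 p *: y p = 0 -> v = 0.
Proof.
move=> [_ gen free] v0.
have N0 : (0 < N)%N.
  case: (N) e cs delta gen {free} => // e cs delta gen.
  by have := oner_neq0 R; rewrite (gen 1) big_ord0 eqxx.
pose f : {mpoly k[d]} := \sum_p v 0 p *: 'X_p.
have f0 : f = 0.
  pose h u := if u == Ordinal N0 then f else 0.
  have := free h (Ordinal N0).
  have -> : \sum_u alg_eval y (h u) * e u = \sum_u alg_eval y 0 * e u.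
    apply: eq_bigr => u _; rewrite /h; case: ifP => // _; congr (_ * _).
    rewrite alg_eval0 alg_eval_sum -[RHS]v0.
    by apply: eq_bigr => p _; rewrite alg_evalZ alg_evalX.
  by rewrite (free (fun=> 0)) /h eqxx.
apply/rowP => p; rewrite mxE; have := congr1 (mcoeff U_(p)) f0.
rewrite mcoeff0 raddf_sum (bigD1 p) //= mcoeffZ mcoeffX eqxx mulr1.
rewrite big1 ?addr0 // => q qp; rewrite mcoeffZ mcoeffX eq_mnm1.
by rewrite (negPf qp) mulr0.
Qed.

(** * Maps linear in an initial segment of the variables *)

Section PartialLinearity.
Variables (k : fieldType) (n : nat).
Local Notation S := {mpoly k[n]}.

Definition const_linear (V V' : lmodType S) (v : V -> V') :=
  additive_map v /\ forall c u, v (c%:MP *: u) = c%:MP *: v u.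

(** Linearity over the polynomial ring in the first [t] variables. *)
Definition lin_upto (t : nat) (V V' : lmodType S) (v : V -> V') :=
  const_linear v /\ forall (q : 'I_n) u, (q < t)%N -> v ('X_q *: u) = 'X_q *: v u.

(** The obstruction for a map linear in the variables before [q] to be linear in
    [q] as well. *)
Definition var_comm (q : 'I_n) (V V' : lmodType S) (v : V -> V') : V -> V' :=
  fun u => 'X_q *: v u - v ('X_q *: u).

Lemma scale_comm (V : lmodType S) (p q : S) (u : V) : p *: (q *: u) = q *: (p *: u).
Proof. by rewrite !scalerA mulrC. Qed.

Section Closure.
Variables (V V' : lmodType S).
Implicit Types v w : V -> V'.

Lemma lin_uptoD t v w : lin_upto t v -> lin_upto t w ->
  lin_upto t (fun u => v u + w u).
Proof.
move=> [[vD vC] vX] [[wD wC] wX]; split; first split.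
- by move=> a b; rewrite vD wD addrACA.
- by move=> c u; rewrite vC wC scalerDr.
- by move=> q u qt; rewrite vX // wX // scalerDr.
Qed.

Lemma lin_uptoN t v : lin_upto t v -> lin_upto t (fun u => - v u).
Proof.
move=> [[vD vC] vX]; split; first split.
- by move=> a b; rewrite vD opprD.
- by move=> c u; rewrite vC scalerN.
- by move=> q u qt; rewrite vX // scalerN.
Qed.

Lemma lin_uptoB t v w : lin_upto t v -> lin_upto t w ->
  lin_upto t (fun u => v u - w u).
Proof. by move=> hv hw; apply: lin_uptoD => //; exact: lin_uptoN. Qed.

Lemma lin_upto0 t : lin_upto t (fun _ : V => 0 : V').
Proof.
split; first split.
- by move=> a b; rewrite addr0.
- by move=> c u; rewrite scaler0.
- by move=> q u qt; rewrite scaler0.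
Qed.

Lemma lin_uptoZ t p v : lin_upto t v -> lin_upto t (fun u => p *: v u).
Proof.
move=> [[vD vC] vX]; split; first split.
- by move=> a b; rewrite vD scalerDr.
- by move=> c u; rewrite vC !scalerA mulrC.
- by move=> q u qt; rewrite vX // !scalerA mulrC.
Qed.

Lemma lin_upto_scale t p v : lin_upto t v -> lin_upto t (fun u => v (p *: u)).
Proof.
move=> [[vD vC] vX]; split; first split.
- by move=> a b; rewrite scalerDr vD.
- by move=> c u; rewrite -(vC c) !scalerA mulrC.
- by move=> q u qt; rewrite -vX // !scalerA mulrC.
Qed.

Lemma lin_upto_comm t q v : lin_upto t v -> lin_upto t (var_comm q v).
Proof.
by move=> hv; apply: lin_uptoB; [exact: lin_uptoZ | exact: lin_upto_scale].
Qed.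

Lemma lin_upto_le t t' v : (t <= t')%N -> lin_upto t' v -> lin_upto t v.
Proof. by move=> tt' [vC vX]; split=> // q u qt; apply: vX; exact: leq_trans tt'. Qed.

Lemma lin_uptoS (q : 'I_n) v :
  lin_upto q v -> (forall u, var_comm q v u = 0) -> lin_upto q.+1 v.
Proof.
move=> [vC vX] v0; split=> // p u; rewrite ltnS leq_eqVlt => /orP[/eqP/val_inj->|]; last exact: vX.
by apply/esym/eqP; rewrite -subr_eq0; apply/eqP; exact: v0.
Qed.

Lemma var_comm_lin (q : 'I_n) v u : lin_upto q.+1 v -> var_comm q v u = 0.
Proof. by move=> [_ vX]; rewrite /var_comm vX ?subrr. Qed.

Lemma lin_upto_full v p u : lin_upto n v -> v (p *: u) = p *: v u.
Proof.
move=> [[vD vC] vX]; elim/mpoly_ring_ind: p u => [c|i|p q hp hq|p q hp hq] u.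
- exact: vC.
- exact: vX.
- by rewrite !scalerDl vD hp hq.
- by rewrite -!scalerA hp hq.
Qed.

End Closure.

Lemma lin_upto_comp t (V V' V'' : lmodType S) (v : V -> V') (w : V' -> V'') :
  lin_upto t v -> lin_upto t w -> lin_upto t (w \o v).
Proof.
move=> [[vD vC] vX] [[wD wC] wX]; split; first split.
- by move=> a b; rewrite /= vD wD.
- by move=> c u; rewrite /= vC wC.
- by move=> q u qt; rewrite /= vX // wX.
Qed.

Lemma var_commB q (V V' : lmodType S) (v w : V -> V') u :
  var_comm q (fun u => v u - w u) u = var_comm q v u - var_comm q w u.
Proof. by rewrite /var_comm scalerBr !opprD !opprK addrACA. Qed.

Definition strip_var (q : 'I_n) (a : 'X_{1..n}) : 'X_{1..n} :=
  [multinom (if i == q then 0 else a i)%N | i < n].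

Lemma strip_varU q (a : 'X_{1..n}) : strip_var q (a + U_(q))%MM = strip_var q a.
Proof.
apply/mnmP => i; rewrite !mnmE; case: eqP => // /eqP it.
by rewrite eq_sym (negPf it) addn0.
Qed.

Lemma strip_varX q q' (a : 'X_{1..n}) : q' != q ->
  strip_var q (a + U_(q'))%MM = (strip_var q a + U_(q'))%MM.
Proof.
move=> qt; apply/mnmP => i; rewrite !mnmE; case: eqP => // ->.
by rewrite (negPf qt).
Qed.

Lemma strip_varE q (a : 'X_{1..n}) : a = (U_(q) *+ a q + strip_var q a)%MM.
Proof.
apply/mnmP => i; rewrite mnmDE mulmnE mnm1E mnmE eq_sym.
by case: eqP => [->|_]; rewrite ?mul1n ?mul0n ?addn0.
Qed.

Section FreeModules.
Variable m : nat.
Local Notation E := 'rV[S]_m.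

Lemma const_linear_ext (V : lmodType S) (v w : E -> V) :
  const_linear v -> const_linear w ->
  (forall j a, v ('X_[a] *: delta_mx 0 j) = w ('X_[a] *: delta_mx 0 j)) -> v =1 w.
Proof.
move=> [vD vC] [wD wC] vw u; rewrite (row_sum_delta u).
rewrite (additive_map_sum _ _ _ vD) (additive_map_sum _ _ _ wD).
apply: eq_bigr => j _; elim/mpoly_add_ind: (u 0 j) => [|p q hp hq|c a].
- by rewrite scale0r !additive_map0.
- by rewrite scalerDl vD wD hp hq.
- by rewrite -scalerA vC wC vw.
Qed.

Lemma const_linear_extend (V : lmodType S) (f : 'I_m -> 'X_{1..n} -> V) :
  exists2 v : E -> V, const_linear v &
    forall j a, v ('X_[a] *: delta_mx 0 j) = f j a.
Proof.
pose G j (p : S) : V := \sum_(a <- msupp p) (p@_a)%:MP *: f j a.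
have GE j p K : (msize p <= K)%N -> G j p = \sum_(a : 'X_{1..n < K}) (p@_a)%:MP *: f j a.
  move=> pK; rewrite /G; pose I := 'X_{1..n < K}.
  rewrite (big_mksub I) ?msupp_uniq //=; last first.
    by move=> a /msize_mdeg_lt /leq_trans; apply.
  rewrite big_rmcond //= => a /memN_msupp_eq0 ->.
  by rewrite mpolyC0 scale0r.
have GD j : additive_map (G j).
  move=> p q; pose K := maxn (msize (p + q)) (maxn (msize p) (msize q)).
  rewrite !(GE _ _ K) ?leq_max ?leqnn ?orbT // -big_split.
  by apply: eq_bigr => a _; rewrite mcoeffD mpolyCD scalerDl.
have GC j c p : G j (c%:MP * p) = c%:MP *: G j p.
  pose K := maxn (msize (c%:MP * p)) (msize p).
  rewrite !(GE _ _ K) ?leq_max ?leqnn ?orbT // scaler_sumr.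
  by apply: eq_bigr => a _; rewrite mcoeffCM mpolyCM scalerA.
exists (fun u => \sum_j G j (u 0 j)).
  split=> [u v|c u]; first by rewrite -big_split; apply: eq_bigr => j _; rewrite mxE GD.
  by rewrite scaler_sumr; apply: eq_bigr => j _; rewrite mxE GC.
move=> j a; rewrite (bigD1 j) //= big1 ?addr0.
  by rewrite !mxE !eqxx mulr1 /G msuppX big_seq1 mcoeffX eqxx scale1r.
move=> i ij; rewrite !mxE (negPf ij) andbF mulr0.
exact: additive_map0.
Qed.

(** Integration: commutation with a variable is onto, since the free module is
    free over the polynomial ring in the other variables. *)
Lemma var_comm_surj (V : lmodType S) (t : 'I_n) (w : E -> V) : lin_upto t w ->
  exists2 v : E -> V, lin_upto t v & var_comm t v =1 w.
Proof.
move=> [[wD wC] wX].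
(* The antiderivative solving [X_t v(X_t^m u) - v(X_t^(m+1) u) = w(X_t^m u)]
   with [v = 0] on monomials free of [X_t]. *)
pose f j (a : 'X_{1..n}) : V := - \sum_(s < a t)
   'X_t ^+ (a t - s.+1) *: w ('X_t ^+ s *: ('X_[strip_var t a] *: delta_mx 0 j)).
have [v [vD vC] vf] := const_linear_extend f.
have XU q a j : 'X_q *: ('X_[a] *: delta_mx 0 j) = 'X_[(a + U_(q))%MM] *: delta_mx 0 j :> E.
  by rewrite scalerA addmC mpolyXD.
exists v.
  split=> // q u qt.
  have qt' : q != t by rewrite neq_ltn qt.
  apply: (const_linear_ext (v := fun u => v ('X_q *: u)) (w := fun u => 'X_q *: v u)).
  - split=> [a b|c a]; first by rewrite scalerDr vD.
    by rewrite -(vC c) !scalerA mulrC.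
  - split=> [a b|c a]; first by rewrite vD scalerDr.
    by rewrite vC !scalerA mulrC.
  move=> j a; rewrite XU !vf /f scalerN scaler_sumr strip_varX //; congr (- _).
  have -> : (a + U_(q))%MM t = a t by rewrite mnmDE mnm1E (negPf qt') addn0.
  apply: eq_bigr => s _; rewrite addmC mpolyXD -scalerA.
  rewrite (scale_comm ('X_t ^+ s)) [RHS](scale_comm 'X_q); congr (_ *: _).
  exact: wX.
apply: const_linear_ext => //.
  split=> [a b|c a]; rewrite /var_comm.
    by rewrite vD !scalerDr vD opprD addrACA.
  by rewrite scalerBr (scale_comm 'X_t) !vC (scale_comm 'X_t).
move=> j a; rewrite /var_comm XU !vf /f strip_varU.
have -> : (a + U_(t))%MM t = (a t).+1 by rewrite mnmDE mnm1E eqxx addn1.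
rewrite big_ord_recr /= subnn expr0 scale1r scalerN opprK scaler_sumr.
rewrite addrA -sumrN -big_split big1 ?add0r /=; last first.
  by move=> s _; rewrite subSS -(subnSK (ltn_ord s)) exprS -scalerA addNr.
by rewrite scalerA mpolyXn -mpolyXD -strip_varE.
Qed.

(** The free module is projective over the polynomial ring in the first [t]
    variables. *)
Lemma lin_upto_lift (V V' : lmodType S) t (D : V -> V') (w : E -> V') :
  lin_upto n D -> lin_upto t w -> (forall u, exists v, D v = w u) ->
  exists2 v : E -> V, lin_upto t v & forall u, D (v u) = w u.
Proof.
move=> DL [[wD wC] wX] wim; have [[DD DC] DX] := DL.
pose lo (a : 'X_{1..n}) := [multinom (if (i < t)%N then a i else 0)%N | i < n].
pose hi (a : 'X_{1..n}) := [multinom (if (i < t)%N then 0 else a i)%N | i < n].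
have split_lo (a : 'X_{1..n}) : a = (lo a + hi a)%MM.
  by apply/mnmP => i; rewrite !mnmE; case: ifP; rewrite ?addn0.
have loq a (q : 'I_n) : (q < t)%N -> lo (a + U_(q))%MM = (lo a + U_(q))%MM.
  move=> qt; apply/mnmP => i; rewrite !mnmE; case: ifPn => //.
  by case: eqP => // <-; rewrite qt.
have hiq a (q : 'I_n) : (q < t)%N -> hi (a + U_(q))%MM = hi a.
  move=> qt; apply/mnmP => i; rewrite !mnmE; case: ifPn => //.
  by case: eqP => [<-|_]; rewrite ?qt ?addn0.
have [l hl] := boolp.choice wim.
pose f j a := 'X_[lo a] *: l ('X_[hi a] *: delta_mx 0 j).
have [v [vD vC] vf] := const_linear_extend f.
have XU q a j : 'X_q *: ('X_[a] *: delta_mx 0 j) = 'X_[(a + U_(q))%MM] *: delta_mx 0 j :> E.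
  by rewrite scalerA addmC mpolyXD.
exists v.
  split=> // q u qt.
  apply: (const_linear_ext (v := fun u => v ('X_q *: u)) (w := fun u => 'X_q *: v u)).
  - split=> [a b|c a]; first by rewrite scalerDr vD.
    by rewrite -(vC c) !scalerA mulrC.
  - split=> [a b|c a]; first by rewrite vD scalerDr.
    by rewrite vC !scalerA mulrC.
  by move=> j a; rewrite XU !vf /f loq // hiq // addmC mpolyXD scalerA.
apply: const_linear_ext => //.
  split=> [a b|c a]; first by rewrite vD DD.
  by rewrite vC DC.
move=> j a; rewrite vf /f (lin_upto_full _ _ DL) hl.
rewrite [in RHS](split_lo a) mpolyXD -scalerA.
have mono (b : 'X_{1..n}) u : (forall i : 'I_n, (t <= i)%N -> b i = 0%N) ->
    w ('X_[b] *: u) = 'X_[b] *: w u.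
  move=> hb; rewrite mpolyXE_id.
  elim: (index_enum _) u => [|i r IH] u; first by rewrite big_nil !scale1r.
  rewrite big_cons -!scalerA -IH; have [it|it] := ltnP i t; last by rewrite hb // expr0 !scale1r.
  elim: (b i) => [|l' IHl]; first by rewrite expr0 !scale1r.
  by rewrite exprS -!scalerA wX // IHl.
by rewrite [in RHS]mono // => i it; rewrite mnmE ltnNge it.
Qed.

End FreeModules.

Section Coefficients.

Lemma const_linear_poly_ext (V : lmodType S) (v w : S^o -> V) :
  const_linear v -> const_linear w -> (forall a, v 'X_[a] = w 'X_[a]) -> v =1 w.
Proof.
move=> [vD vC] [wD wC] vw p; elim/mpoly_add_ind: p => [|p q hp hq|c a].
- by rewrite !additive_map0.
- by rewrite vD wD hp hq.
- by rewrite (vC c 'X_[a]) (wC c 'X_[a]) vw.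
Qed.

Lemma const_linear_poly_extend (V : lmodType S) (f : 'X_{1..n} -> V) :
  exists2 v : S^o -> V, const_linear v & forall a, v 'X_[a] = f a.
Proof.
have [v [vD vC] vf] := const_linear_extend (fun (_ : 'I_1) a => f a).
exists (fun p => v (p *: delta_mx 0 0)); last by move=> a; exact: vf.
split=> [p q|c p]; first by rewrite scalerDl vD.
by rewrite -vC scalerA.
Qed.

(** [c m] takes the coefficient of the [m]-th power of the [q]-th variable. *)
Lemma coefficients_in (q : 'I_n) : exists c : nat -> S^o -> S^o,
  [/\ forall m, const_linear (c m),
      forall m (q' : 'I_n) f, q' != q -> c m ('X_q' * f) = 'X_q' * c m f,
      forall m f, c m.+1 ('X_q * f) = c m f
    & forall f, exists M, forall M', (M <= M')%N -> f = \sum_(m < M') 'X_q ^+ m * c m f].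
Proof.
have ex m : exists c : S^o -> S^o, const_linear c /\
    forall a : 'X_{1..n}, c 'X_[a] = if a q == m then 'X_[strip_var q a] else 0.
  have [c ? ?] := @const_linear_poly_extend S^o
    (fun a => if a q == m then 'X_[strip_var q a] else 0).
  by exists c.
have [c hc] := boolp.choice ex.
have cC m : const_linear (c m) by case: (hc m).
have cX m (a : 'X_{1..n}) : c m 'X_[a] = if a q == m then 'X_[strip_var q a] else 0 by case: (hc m).
have XU q' (a : 'X_{1..n}) : 'X_q' * 'X_[a] = 'X_[(a + U_(q'))%MM] :> S.
  by rewrite -mpolyXD addmC.
have lin_mulr (v : S^o -> S^o) (p : S) : const_linear v -> const_linear (fun f : S^o => v (p * f)).
  move=> [vD vC]; split=> [f f'|a f]; first by rewrite mulrDr vD.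
  by rewrite -vC; congr v; exact: mulrCA.
have lin_mull (v : S^o -> S^o) (p : S) : const_linear v -> const_linear (fun f : S^o => p * v f : S^o).
  move=> [vD vC]; split=> [f f'|a f]; first by rewrite vD mulrDr.
  by rewrite vC; exact: mulrCA.
exists c; split=> // [m q' f q'q|m f|f].
- move: f; apply: (const_linear_poly_ext (lin_mulr _ _ (cC m)) (lin_mull _ _ (cC m))) => a.
  rewrite XU !cX mnmDE mnm1E (negPf q'q) addn0; case: eqP => _; last by rewrite mulr0.
  by rewrite strip_varX // XU.
- move: f; apply: (const_linear_poly_ext (lin_mulr _ _ (cC _)) (cC m)) => a.
  by rewrite XU !cX mnmDE mnm1E eqxx addn1 eqSS strip_varU.
elim/mpoly_add_ind: f => [|f f' [M1 h1] [M2 h2]|b a].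
- exists 0%N => M' _; rewrite big1 // => m _; have [cD _] := cC m.
  by rewrite additive_map0 // mulr0.
- exists (maxn M1 M2) => M'; rewrite geq_max => /andP[/h1 e1 /h2 e2].
  rewrite {1}e1 {1}e2 -big_split; apply: eq_bigr => m _ /=.
  by have [cD _] := cC m; rewrite cD mulrDr.
- exists (a q).+1 => M' aM; rewrite (bigD1 (Ordinal aM)) //= big1 ?addr0.
    have [_ cl] := cC (a q); rewrite (cl b 'X_[a]) cX eqxx.
    rewrite [RHS]mulrCA; congr (_ * _).
    by rewrite mpolyXn -mpolyXD -strip_varE.
  move=> m ma; have [_ cl] := cC m; rewrite (cl b 'X_[a]) cX ifN ?scaler0 ?mulr0 //.
  by apply: contraNneq ma => e; apply/eqP/val_inj.
Qed.

End Coefficients.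

End PartialLinearity.

(** * The cochain complex computing Ext *)

(** [R] as a module over the polynomial ring mapping to it. *)
Definition eval_module (k : fieldType) (R : comAlgType k) n (x : 'I_n -> R) : Type := R.
HB.instance Definition _ (k : fieldType) (R : comAlgType k) n (x : 'I_n -> R) :=
  GRing.Zmodule.copy (eval_module x) R.

Section EvalModule.
Variables (k : fieldType) (R : comAlgType k) (n : nat) (x : 'I_n -> R).
Definition eval_scale (p : {mpoly k[n]}) (r : eval_module x) : eval_module x :=
  alg_eval x p * (r : R).
Fact eval_scaleA p q r : eval_scale p (eval_scale q r) = eval_scale (p * q) r.
Proof. by rewrite /eval_scale alg_evalM mulrA. Qed.
Fact eval_scale1 : left_id 1 eval_scale.
Proof. by move=> r; rewrite /eval_scale alg_eval1 mul1r. Qed.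
Fact eval_scaleDr : right_distributive eval_scale +%R.
Proof. by move=> p r r'; rewrite /eval_scale; exact: mulrDr. Qed.
Fact eval_scaleDl r : {morph eval_scale^~ r : p q / p + q}.
Proof. by move=> p q; rewrite /eval_scale alg_evalD; exact: mulrDl. Qed.
HB.instance Definition _ := GRing.Zmodule_isLmodule.Build {mpoly k[n]}
  (eval_module x) eval_scaleA eval_scale1 eval_scaleDr eval_scaleDl.
End EvalModule.

Section ParamPolynomials.
Variables (k : fieldType) (d g : nat).
Local Notation S := {mpoly k[d + g]}.

Definition param_poly (a : {mpoly k[d]}) : S := alg_eval (fun p => 'X_(lshift g p)) a.

Lemma param_polyE (R : comAlgType k) (x : 'I_(d + g) -> R) a :
  alg_eval x (param_poly a) = alg_eval (fun p => x (lshift g p)) a.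
Proof.
elim/mpoly_ring_ind: a => [c|i|p q hp hq|p q hp hq].
- by rewrite /param_poly !alg_evalC alg_evalZ alg_eval1.
- by rewrite /param_poly !alg_evalX.
- by rewrite /param_poly !alg_evalD hp hq.
- by rewrite /param_poly !alg_evalM hp hq.
Qed.

Lemma lin_upto_param (V V' : lmodType S) (v : V -> V') a u :
  lin_upto d v -> v (param_poly a *: u) = param_poly a *: v u.
Proof.
move=> [[vD vC] vX]; elim/mpoly_ring_ind: a u => [c|i|p q hp hq|p q hp hq] u.
- rewrite /param_poly alg_evalC.
  have -> : in_alg S c = c%:MP by rewrite /= -mul_mpolyC mulr1.
  exact: vC.
- by rewrite /param_poly alg_evalX vX //=.
- by rewrite /param_poly alg_evalD !scalerDl vD hp hq.
- by rewrite /param_poly alg_evalM -!scalerA hp hq.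
Qed.

End ParamPolynomials.

Section ExtComplex.
Variables (k : fieldType) (R : comAlgType k) (Rg : int -> set R) (d g N : nat).
Variables (x : 'I_(d + g) -> R) (F : graded_free_resolution Rg x).
Let y p := x (lshift g p).
Variables (e : 'I_N -> R) (delta : 'I_N -> nat) (cs : 'I_N -> R -> {mpoly k[d]}).
Hypothesis basis : parameter_basis Rg y e delta cs.
Local Notation S := {mpoly k[d + g]}.
Local Notation M := (eval_module x).

(** Indices are shifted by one: [R] has index [0] and the free modules of the
    resolution start at index [1], which makes the augmentation one of the
    differentials. *)
Definition res_mod (i : nat) : lmodType S :=
  match i with 0 => M | i'.+1 => 'rV[S]_(rk F i') end.

Definition res_diff (i : nat) : res_mod i.+1 -> res_mod i :=
  match i return res_mod i.+1 -> res_mod i with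
  | 0 => fun v => \sum_q alg_eval x (v 0 q) * @aug _ _ _ _ _ F q : M
  | i'.+1 => fun v => v *m diff F i'
  end.

Definition res_cycle (i : nat) : set (res_mod i) :=
  match i return set (res_mod i) with
  | 0 => setT
  | i'.+1 => [set u | res_diff u = 0]
  end.

Lemma res_diff_lin i : lin_upto (d + g) (@res_diff i).
Proof.
have Z (V V' : lmodType S) (v : V -> V') : additive_map v ->
    (forall p u, v (p *: u) = p *: v u) -> lin_upto (d + g) v.
  by move=> vD vZ; split.
case: i => [|i]; apply: Z => /=.
- move=> u v; rewrite -[RHS]big_split; apply: eq_bigr => q _ /=.
  by rewrite mxE alg_evalD mulrDl.
- move=> p u; rewrite [RHS]mulr_sumr; apply: eq_bigr => q _ /=.
  by rewrite mxE alg_evalM mulrA.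
- by move=> u v; rewrite mulmxDl.
- by move=> p u; rewrite -scalemxAl.
Qed.

Lemma res_diffK i u : res_cycle (@res_diff i u).
Proof.
case: i u => [//|[|i]] u /=; first by apply/exact_aug; exists u.
by apply/exact_diff; exists u.
Qed.

Lemma res_exact i u : @res_cycle i u -> exists v, @res_diff i v = u.
Proof.
case: i u => [|[|i]] u /=.
- by move=> _; have [v ->] := aug_surj F u; exists v.
- by move=> /exact_aug[v ->]; exists v.
- by move=> /exact_diff[v ->]; exists v.
Qed.

Local Arguments res_diff : simpl never.

Lemma res_diff_comp i u : @res_diff i (res_diff u) = 0.
Proof. exact: (@res_diffK i.+1). Qed.

Lemma coord_lin s : lin_upto d (fun r : M => param_poly g (cs s r) : S^o).
Proof.
split; first split.
- by move=> r r'; rewrite (coordD basis) /param_poly alg_evalD.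
- move=> c r; have -> : c%:MP *: r = alg_eval y c%:MP * (r : R) :> R.
    by rewrite /GRing.scale /= /eval_scale !alg_evalC.
  rewrite (coordM basis) /param_poly alg_evalM alg_evalC.
  by rewrite /= -[c%:A]mul_mpolyC mulr1.
- move=> q r qd; have eq : q = lshift g (Ordinal qd) by apply: val_inj.
  have -> : 'X_q *: r = alg_eval y 'X_(Ordinal qd) * (r : R) :> R.
    by rewrite /GRing.scale /= /eval_scale !alg_evalX /y -eq.
  by rewrite (coordM basis) /param_poly alg_evalM alg_evalX -eq.
Qed.

(** The resolution splits over the polynomial ring in the parameters. *)
Lemma res_contraction i : exists2 h : res_mod i -> res_mod i.+1, lin_upto d h &
  forall u, @res_cycle i u -> res_diff (h u) = u.
Proof.
elim: i => [|i [h hL hd]].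
  have [l hl] := boolp.choice (fun s => @res_exact 0 (e s) I).
  exists (fun r : M => \sum_s param_poly g (cs s r) *: l s).
    split; first split.
    - move=> r r'; rewrite -big_split; apply: eq_bigr => s _ /=.
      by have [[pD _] _] := coord_lin s; rewrite pD scalerDl.
    - move=> c r; rewrite scaler_sumr; apply: eq_bigr => s _.
      by have [[_ pC] _] := coord_lin s; rewrite pC scalerA.
    - move=> q r qd; rewrite scaler_sumr; apply: eq_bigr => s _.
      by have [_ pX] := coord_lin s; rewrite pX // scalerA.
  move=> r _; have [[dD _] _] := res_diff_lin 0.
  rewrite (additive_map_sum _ _ _ dD) [RHS](coord_expand basis).
  apply: eq_bigr => s _; rewrite (lin_upto_full _ _ (res_diff_lin 0)) hl.
  by rewrite /GRing.scale /= /eval_scale param_polyE.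
have dL : lin_upto d (@res_diff i).
  by apply: lin_upto_le (res_diff_lin i); exact: leq_addr.
pose w (u : res_mod i.+1) := u - h (res_diff u).
have wL : lin_upto d w.
  by apply: lin_uptoB; [split; [split|]|exact: lin_upto_comp hL].
have wim u : exists v, res_diff (i := i.+1) v = w u.
  apply: (@res_exact i.+1); rewrite /res_cycle /= /w.
  have [[dD _] _] := dL; rewrite (additive_mapB _ _ dD) hd ?subrr //.
  exact: res_diffK.
have [h' h'L h'd] := lin_upto_lift (res_diff_lin i.+1) wL wim.
exists h' => // u hu; rewrite h'd /w (_ : res_diff u = 0) //.
by have [[hD _] _] := hL; rewrite (additive_map0 hD) subr0.
Qed.

Definition cochain i := res_mod i.+1 -> S^o.
Definition cocycleP i (w : cochain i) := forall u, w (@res_diff i.+1 u) = 0.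

Definition coboundaryP s i : cochain i -> Prop :=
  match i return cochain i -> Prop with
  | 0 => fun w => w = fun=> 0
  | i'.+1 => fun w => exists2 v : cochain i', lin_upto (d + s) v & w = v \o @res_diff i'.+1
  end.

(** Vanishing of the cohomology in degree [i] for cochains linear over the first
    [s] variables beyond the parameters. *)
Definition exact_at s i := forall w : cochain i,
  lin_upto (d + s) w -> cocycleP w -> coboundaryP s w.

Lemma var_comm_comp q i (v : cochain i) u :
  var_comm q (v \o @res_diff i.+1) u = var_comm q v (res_diff u).
Proof. by rewrite /var_comm /= (lin_upto_full _ _ (res_diff_lin _)). Qed.

Lemma cochain_comp_lin s i (v : cochain i) : (s <= g)%N -> lin_upto (d + s) v ->
  lin_upto (d + s) (v \o @res_diff i.+1).
Proof.
move=> sg; apply: lin_upto_comp; apply: lin_upto_le (res_diff_lin _).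
by rewrite leq_add2l.
Qed.

Lemma cochain_comp_cocycle i (v : cochain i) : additive_map v ->
  cocycleP (v \o @res_diff i.+1).
Proof. by move=> vD u; rewrite /= res_diff_comp additive_map0. Qed.

(** A cochain whose commutator with the next variable is a coboundary can be
    corrected by a coboundary so as to commute with that variable: the primitive
    of the commutator is integrated along the variable. *)
Lemma adjust_cochain s i (v : cochain i) (q : 'I_(d + g)) : q = (d + s)%N :> nat ->
  lin_upto (d + s) v -> coboundaryP s (var_comm q v) ->
  exists2 v' : cochain i, lin_upto (d + s).+1 v' &
    v' \o @res_diff i.+1 = v \o @res_diff i.+1.
Proof.
move=> qs vL.
have sg : (s <= g)%N by have := ltn_ord q; rewrite qs ltn_add2l; exact: ltnW.
have conclude (v' : cochain i) : lin_upto (d + s) v' ->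
    (forall u, var_comm q v' u = 0) -> lin_upto (d + s).+1 v'.
  by rewrite -qs; exact: lin_uptoS.
case: i v vL conclude => [|i] v vL conclude /=.
  by move=> v0; exists v => //; apply: conclude => // u; rewrite v0.
move=> [u uL eu].
have [c cL ec] := @var_comm_surj _ _ _ S^o q u (ltac:(by rewrite qs)).
have cL' : lin_upto (d + s) c by rewrite -qs.
exists (fun t => v t - c (res_diff t)).
  apply: conclude; first by apply: lin_uptoB => //; exact: cochain_comp_lin.
  by move=> t; rewrite var_commB eu (var_comm_comp q c) ec /= subrr.
have [[cD _] _] := cL.
by apply: boolp.funext => t; rewrite /= res_diff_comp (additive_map0 cD) subr0.
Qed.

Lemma coboundary_step s i (w : cochain i) (q : 'I_(d + g)) : q = (d + s)%N :> nat ->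
  (if i is i'.+1 then exact_at s i' else True) ->
  lin_upto (d + s).+1 w -> coboundaryP s w -> coboundaryP s.+1 w.
Proof.
move=> qs; case: i w => [//|i] w ex wL [v vL ew].
have dv : cocycleP (var_comm q v).
  by move=> u; rewrite -var_comm_comp -ew; apply: var_comm_lin; rewrite qs.
have [v' v'L ev'] := adjust_cochain qs vL (ex _ (lin_upto_comm q vL) dv).
by exists v'; rewrite ?addnS // ew ev'.
Qed.

(** Each further variable raises the top degree of the cohomology by at most
    one; without any, composing with a contraction gives primitives. *)
Lemma exact_gt s i : (s <= g)%N -> (s < i)%N -> exact_at s i.
Proof.
elim: s i => [|s IH] i sg si w wL wc.
  case: i si w wL wc => // i _ w wL wc.
  have [h hL hd] := res_contraction i.+1.
  rewrite addn0 in wL; exists (w \o h).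
    by rewrite addn0; exact: lin_upto_comp hL wL.
  apply: boolp.funext => u; have [[wD _] _] := wL.
  apply/eqP; rewrite -subr_eq0 /= -(additive_mapB _ _ wD); apply/eqP.
  have [t <-] : exists t, @res_diff i.+2 t = u - h (res_diff u).
    apply: (@res_exact i.+2); rewrite /res_cycle /=.
    have [[dD _] _] := res_diff_lin i.+1; rewrite (additive_mapB _ _ dD) hd ?subrr //.
    exact: res_diffK.
  exact: wc.
pose q : 'I_(d + g) := rshift d (Ordinal sg).
case: i si w wL wc => // i si w wL wc.
apply: (@coboundary_step _ _ _ q) => //; first by apply: IH => //; exact: ltnW.
  by rewrite -addnS.
apply: IH => //; [exact: ltnW|exact: ltnW|].
by apply: lin_upto_le wL; rewrite leq_add2l.
Qed.

(** Linear maps [R -> S] over the parameters; the top Ext turns out to be their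
    quotient by the commutators with the remaining variables. *)
Local Notation P := (M -> S^o).

(** The sum of the images of the commutators with the first [s] variables
    beyond the parameters. *)
Fixpoint comm_image (s : nat) : set P :=
  match s with
  | 0 => [set fun=> 0]
  | s'.+1 => [set h | exists (q : 'I_(d + g)) (h1 h2 : P),
      [/\ q = (d + s')%N :> nat, lin_upto d h1, comm_image s' h2
        & h = fun r => var_comm q h1 r + h2 r]]
  end.

Lemma comm_image_map s (T : P -> P) h :
  (forall a b, T (fun r => a r + b r) = fun r => T a r + T b r) ->
  (forall a, lin_upto d a -> lin_upto d (T a)) ->
  (forall (q : 'I_(d + g)) a, (d <= q)%N -> (q < d + s)%N -> T (var_comm q a) = var_comm q (T a)) ->
  comm_image s h -> comm_image s (T h).
Proof.
move=> TD TL; elim: s h => [|s IH] h TC.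
  move=> -> /=; apply: boolp.funext => r.
  have /(congr1 (@^~ r)) /= := TD (fun=> 0) (fun=> 0).
  under [X in T X]boolp.eq_fun do rewrite addr0.
  by move=> e0; apply: (@addrI _ (T (fun=> 0) r)); rewrite addr0 -e0.
move=> [q [h1 [h2 [eq L1 h2s ->]]]]; exists q, (T h1), (T h2); split=> //.
- exact: TL.
- by apply: IH => // q' a dq qs; apply: TC => //; rewrite addnS ltnS ltnW.
- by rewrite TD TC //; rewrite eq ?leq_addr ?addnS.
Qed.

Lemma comm_imageD s h h' : comm_image s h -> comm_image s h' ->
  comm_image s (fun r => h r + h' r).
Proof.
elim: s h h' => [_ _ -> ->|s IH h h']; first by apply: boolp.funext => r /=; rewrite addr0.
move=> [q [h1 [h2 [eq L1 h2s ->]]]] [q' [h1' [h2' [eq' L1' h2s' ->]]]].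
have ->  : q' = q by apply: val_inj; rewrite /= eq eq'.
exists q, (fun r => h1 r + h1' r), (fun r => h2 r + h2' r); split=> //.
- exact: lin_uptoD.
- exact: IH.
- apply: boolp.funext => r; rewrite addrACA; congr (_ + _).
  by rewrite /var_comm scalerDr opprD addrACA.
Qed.

Lemma comm_imageZ s p h : comm_image s h -> comm_image s (fun r => p *: h r).
Proof.
apply: (@comm_image_map _ (fun h r => p *: h r)).
- by move=> a b; apply: boolp.funext => r; rewrite scalerDr.
- by move=> a; exact: lin_uptoZ.
- by move=> q a _ _; apply: boolp.funext => r; rewrite /var_comm scalerBr; congr (_ - _); exact: mulrCA.
Qed.

Lemma comm_image_scale s p h : comm_image s h -> comm_image s (fun r => h (p *: r)).
Proof.
apply: (@comm_image_map _ (fun h r => h (p *: r))) => //.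
- by move=> a; exact: lin_upto_scale.
- move=> q a _ _; apply: boolp.funext => r; congr (_ - a _).
  by rewrite !scalerA mulrC.
Qed.

Lemma comm_image0 s : (s <= g)%N -> comm_image s (fun=> 0).
Proof.
elim: s => //= s IH sg; exists (rshift d (Ordinal sg)), (fun=> 0), (fun=> 0).
split=> //; [exact: lin_upto0 | by apply: IH; exact: ltnW|].
by apply: boolp.funext => r; rewrite /var_comm scaler0 subrr addr0.
Qed.

Lemma param_expand (V : lmodType S) (v : M -> V) r : lin_upto d v ->
  v r = \sum_u param_poly g (cs u r) *: v (e u).
Proof.
move=> vL; have [[vD _] _] := vL; rewrite {1}[r](coord_expand basis).
rewrite (additive_map_sum (V := M) _ _ _ vD); apply: eq_bigr => u _.
rewrite -(lin_upto_param (V := M) _ _ vL); congr v.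
by rewrite /GRing.scale /= /eval_scale param_polyE.
Qed.

(** Compare coefficients of the powers of the variable, from the top degree
    downwards: multiplication by the variable raises degrees by one while
    precomposition does not change them. *)
Lemma comm_image_inj s (q : 'I_(d + g)) h : (s < g)%N -> q = (d + s)%N :> nat ->
  lin_upto d h -> comm_image s (var_comm q h) -> comm_image s h.
Proof.
move=> sg qs hL hs.
have [c [cC cX cS cE]] := coefficients_in k q.
have cD m : additive_map (c m) by case: (cC m).
have cL m : lin_upto d (c m).
  split=> // q' f q'd; apply: cX.
  by apply: contraTneq q'd => ->; rewrite qs ltnNge leq_addr.
have [K hK] : exists K, forall m r, (K <= m)%N -> c m (h r) = 0.
  have [B hB] := boolp.choice (fun u => cE (h (e u))).
  exists (\max_u B u)%N => m r Km; rewrite (param_expand r hL).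
  rewrite (additive_map_sum _ _ _ (cD m)) big1 // => u _.
  rewrite lin_upto_param //.
  have Bm : (B u <= m)%N by apply: leq_trans Km; exact: leq_bigmax.
  have := hB u _ (leqW Bm); rewrite big_ord_recr /= -(hB u _ Bm).
  move=> /eqP; rewrite addrC -subr_eq subrr eq_sym mulf_eq0.
  rewrite expf_eq0 -msupp_eq0 msuppX andbF /= => /eqP ->.
  exact: scaler0.
have hE r : h r = \sum_(m < K) 'X_q ^+ m * c m (h r).
  have [B hB] := cE (h r).
  have e1 := hB _ (leq_maxl B K); rewrite {1}e1.
  rewrite -!(big_mkord xpredT (fun m => 'X_q ^+ m * c m (h r))).
  rewrite (big_cat_nat (leq0n K) (leq_maxr B K)) /= [X in _ + X]big_nat [X in _ + X]big1 ?addr0 //.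
  by move=> m /andP[Km _]; rewrite hK // mulr0.
have top j : comm_image s (fun r => c (K - j)%N (h r)).
  elim: j => [|j IH].
    rewrite subn0 (_ : (fun _ => _) = fun=> 0); last first.
      by apply: boolp.funext => r; rewrite hK.
    by apply: comm_image0; exact: ltnW.
  have [jK|jK] := ltnP j K; last by rewrite (_ : K - j.+1 = K - j)%N //; lia.
  have eK : (K - j = (K - j.+1).+1)%N by lia.
  have h1 : comm_image s (fun r => c (K - j)%N (var_comm q h r)).
    apply: (@comm_image_map _ (fun h r => c (K - j)%N (h r))) hs.
    - by move=> a b; apply: boolp.funext => r; rewrite cD.
    - by move=> a aL; exact: lin_upto_comp aL (cL _).
    - move=> q' a dq q's; apply: boolp.funext => r; rewrite /var_comm.
      by rewrite (additive_mapB _ _ (cD _)) [in LHS]cX //; apply: contraTneq q's => ->; rewrite -qs ltnn.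
  have := comm_imageD h1 (comm_image_scale 'X_q IH).
  congr comm_image; apply: boolp.funext => r.
  by rewrite (additive_mapB _ _ (cD _)) subrK {1}eK cS.
have part l : (l <= K)%N ->
    comm_image s (fun r => \sum_(m < l) 'X_q ^+ m *: (c m (h r) : S^o)).
  elim: l => [|l IH] lK.
    rewrite (_ : (fun _ => _) = fun=> 0); last by apply: boolp.funext => r; rewrite big_ord0.
    by apply: comm_image0; exact: ltnW.
  have := comm_imageD (IH (ltnW lK)) (comm_imageZ ('X_q ^+ l) (top (K - l)%N)).
  rewrite subKn; last exact: ltnW.
  by congr comm_image; apply: boolp.funext => r; rewrite big_ord_recr.
have := part K (leqnn K).
by congr comm_image; apply: boolp.funext => r; apply/esym; exact: hE.
Qed.

(** The iterated connecting map, from maps [R -> S] to cocycles of degree [s]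
    linear over the first [s] variables beyond the parameters.  It is a relation,
    as each step chooses a primitive [v] for the commutator: if the commutator of
    [v] is a cocycle, the boundary of [v] is linear over one more variable. *)
Fixpoint connecting (s : nat) : cochain s -> P -> Prop :=
  match s return cochain s -> P -> Prop with
  | 0 => fun w h => lin_upto d h /\ w = h \o @res_diff 0
  | s'.+1 => fun w h => exists (q : 'I_(d + g)) (v : cochain s'),
      [/\ q = (d + s')%N :> nat, lin_upto (d + s') v, w = v \o @res_diff s'.+1
        & connecting (var_comm q v) h]
  end.

Lemma connecting_cocycle s w h : (s <= g)%N -> @connecting s w h ->
  lin_upto (d + s) w /\ cocycleP w.
Proof.
elim: s w h => [|s IH] w h sg.
  move=> [hL ->]; rewrite addn0; split.
    by apply: lin_upto_comp hL; apply: lin_upto_le (res_diff_lin _); exact: leq_addr.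
  move=> u; rewrite /= res_diff_comp; have [[hD _] _] := hL.
  exact: additive_map0.
move=> [q [v [qs vL -> /(IH _ _ (ltnW sg))[_ vc]]]].
split; last by have [[vD _] _] := vL; exact: cochain_comp_cocycle.
rewrite addnS -qs; apply: lin_uptoS.
  by rewrite qs; apply: cochain_comp_lin => //; exact: ltnW.
by move=> u; rewrite var_comm_comp vc.
Qed.

Lemma connecting_lin s w h : @connecting s w h -> lin_upto d h.
Proof. by elim: s w h => [|s IH] w h; [case | move=> [q [v [_ _ _ /IH]]]]. Qed.

Lemma connectingB s w h w' h' : @connecting s w h -> @connecting s w' h' ->
  connecting (fun u => w u - w' u) (fun r => h r - h' r).
Proof.
elim: s w h w' h' => [|s IH] w h w' h'.
  by move=> [hL ->] [hL' ->]; split=> //; exact: lin_uptoB.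
move=> [q [v [qs vL -> hv]]] [q' [v' [qs' vL' -> hv']]].
have eq : q' = q by apply: val_inj; rewrite /= qs qs'.
subst q'; exists q, (fun u => v u - v' u); split=> //; first exact: lin_uptoB.
have := IH _ _ _ _ hv hv'.
by congr connecting; apply: boolp.funext => u; rewrite var_commB.
Qed.

Lemma connectingZ s p w h : @connecting s w h ->
  connecting (fun u => p *: w u) (fun r => p *: h r).
Proof.
elim: s w h => [|s IH] w h.
  by move=> [hL ->]; split=> //; exact: lin_uptoZ.
move=> [q [v [qs vL -> hv]]]; exists q, (fun u => p *: v u); split=> //.
  exact: lin_uptoZ.
have -> : var_comm q (fun u => p *: v u) = fun u => p *: var_comm q v u.
  apply: boolp.funext => u; rewrite /var_comm scalerBr.
  by congr (_ - _); exact: mulrCA.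
exact: IH.
Qed.

Lemma connecting_scale s p w h : @connecting s w h ->
  connecting (fun u => w (p *: u)) (fun r => h (p *: r)).
Proof.
elim: s w h => [|s IH] w h.
  move=> [hL ->]; split; first exact: lin_upto_scale.
  by apply: boolp.funext => u; rewrite /= (lin_upto_full _ _ (res_diff_lin _)).
move=> [q [v [qs vL -> hv]]]; exists q, (fun u => v (p *: u)); split=> //.
- exact: lin_upto_scale.
- by apply: boolp.funext => u; rewrite /= (lin_upto_full _ _ (res_diff_lin _)).
have -> : var_comm q (fun u => v (p *: u)) = fun u => var_comm q v (p *: u).
  have pq u : p *: ('X_q *: u) = 'X_q *: (p *: u) by rewrite !scalerA mulrC.
  by apply: boolp.funext => u; rewrite /var_comm pq.
exact: IH.
Qed.

Lemma connecting_comm s q w h : @connecting s w h ->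
  connecting (var_comm q w) (var_comm q h).
Proof. by move=> c; apply: connectingB; [exact: connectingZ | exact: connecting_scale]. Qed.

Lemma connecting_surj s h : (s <= g)%N -> lin_upto d h -> exists w, @connecting s w h.
Proof.
move=> + hL; elim: s => [|s IH] sg; first by exists (h \o @res_diff 0).
have [w hw] := IH (ltnW sg); have [wL _] := connecting_cocycle (ltnW sg) hw.
pose q : 'I_(d + g) := rshift d (Ordinal sg).
have [v vL ev] := @var_comm_surj _ _ _ S^o q w wL.
exists (v \o @res_diff s.+1), q, v; split=> //.
by have -> : var_comm q v = w by apply: boolp.funext.
Qed.

(** Cocycles in degree above the number of variables already have primitives,
    whose commutators are the cocycles one step earlier. *)
Lemma connecting_total s (w : cochain s) : (s <= g)%N -> lin_upto (d + s) w ->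
  cocycleP w -> exists h, connecting w h.
Proof.
elim: s w => [|s IH] w sg wL wc.
  rewrite addn0 in wL.
  have [l hl] := boolp.choice (fun r => @res_exact 0 r I).
  have [[wD wC] wX] := wL.
  have [[dD dC] dX] := res_diff_lin 0.
  have wE u r : res_diff u = r -> w u = w (l r).
    move=> ur; apply/eqP; rewrite -subr_eq0 -(additive_mapB _ _ wD).
    have [t <-] : exists t, @res_diff 1 t = u - l r; last by rewrite wc.
    apply: (@res_exact 1).
    by rewrite /res_cycle /= (additive_mapB _ _ dD) hl ur subrr.
  exists (w \o l); split; last by apply: boolp.funext => u /=; exact: wE.
  split; first split.
  - by move=> r r'; rewrite /= -wD; apply/esym/wE; rewrite dD !hl.
  - by move=> c r; rewrite /= -wC; apply/esym/wE; rewrite dC hl.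
  - by move=> q r qd; rewrite /= -wX //; apply/esym/wE; rewrite dX ?hl.
have wL' : lin_upto (d + s) w by apply: lin_upto_le wL; rewrite leq_add2l.
have [v vL ew] := exact_gt (ltnW sg) (ltnSn s) wL' wc.
pose q : 'I_(d + g) := rshift d (Ordinal sg).
have [||h hv] := IH (var_comm q v) (ltnW sg).
- exact: lin_upto_comm.
- by move=> u; rewrite -var_comm_comp -ew; apply: var_comm_lin; rewrite /= -addnS.
by exists h, q, v.
Qed.

(** Two primitives of the same cocycle, one of them linear over the new variable,
    differ by a cocycle of the previous step; its commutator is what enters the
    image. *)
Lemma connecting_kernel s w h : (s <= g)%N ->
  @connecting s w h -> (coboundaryP s w <-> comm_image s h).
Proof.
elim: s w h => [|s IH] w h sg.
  move=> [hL ->] /=; split=> [e0|->]; last by apply: boolp.funext.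
  apply: boolp.funext => r; have [v <-] := @res_exact 0 r I.
  exact: (congr1 (@^~ v) e0).
have sg' := ltnW sg.
move=> [q [v [qs vL ew hv]]]; split.
  move=> [v' v'L ew']; rewrite addnS -qs in v'L.
  have v'L' : lin_upto (d + s) v' by rewrite -qs; exact: lin_upto_le v'L.
  pose v2 u := v u - v' u.
  have [||h' hv2] := @connecting_total s v2 sg'.
  - exact: lin_uptoB.
  - move=> u; apply/eqP; rewrite subr_eq0; apply/eqP.
    by have := congr1 (@^~ u) ew; rewrite ew' => /= ->.
  have e2 : var_comm q v2 = var_comm q v.
    by apply: boolp.funext => u; rewrite /v2 var_commB (var_comm_lin _ v'L) subr0.
  have := connecting_comm q hv2; rewrite e2 => hv2'.
  have /(IH _ _ sg')[+ _] := connectingB hv hv2'.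
  rewrite (_ : (fun u => _ - _) = fun=> 0); last by apply: boolp.funext => u; rewrite subrr.
  have cob0 : coboundaryP s ((fun=> 0) : cochain s).
    case: (s) => //= s'; exists (fun=> 0); first exact: lin_upto0.
    by apply: boolp.funext.
  move=> /(_ cob0) hs; exists q, h', (fun r => h r - var_comm q h' r); split=> //.
    exact: connecting_lin hv2.
  by apply: boolp.funext => r; rewrite addrC subrK.
move=> [q' [h1 [h2 [qs' h1L h2s eh]]]].
have eq : q' = q by apply: val_inj; rewrite /= qs qs'.
subst q'; have [v1 hv1] := connecting_surj sg' h1L.
have [v1L v1c] := connecting_cocycle sg' hv1.
pose v2 u := v u - v1 u.
have v2L : lin_upto (d + s) v2 by exact: lin_uptoB.
have hv2 : connecting (var_comm q v2) h2.
  have := connectingB hv (connecting_comm q hv1).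
  congr connecting; apply: boolp.funext => u; first by rewrite /v2 var_commB.
  by rewrite eh addrAC subrr add0r.
have [v3 v3L ev3] := adjust_cochain qs v2L ((IH _ _ sg' hv2).2 h2s).
exists v3; first by rewrite addnS.
by rewrite ev3 ew; apply: boolp.funext => u; rewrite /= /v2 v1c subr0.
Qed.

(** In degree [s] a cocycle over [s] variables that is linear over one more has
    zero commutator, so injectivity of commutators makes it a coboundary. *)
Lemma exact_lt s i : (s <= g)%N -> (i < s)%N -> exact_at s i.
Proof.
elim: s i => [//|s IH] i sg; rewrite ltnS => si w wL wc.
pose q : 'I_(d + g) := rshift d (Ordinal sg).
have sg' := ltnW sg.
have wL' : lin_upto (d + s) w by apply: lin_upto_le wL; rewrite leq_add2l.
apply: (@coboundary_step _ _ _ q) => //.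
- by case: (i) si => // i' i's; apply: IH.
- by rewrite -addnS.
move: si; rewrite leq_eqVlt => /orP[/eqP ei|si]; last exact: IH.
subst i; have [h hw] := connecting_total sg' wL' wc.
apply/(connecting_kernel sg' hw).
apply: (@comm_image_inj _ q) => //; first exact: connecting_lin hw.
have /(connecting_kernel sg')[+ _] := connecting_comm q hw; apply.
rewrite (_ : var_comm q w = fun=> 0).
  case: (s) => //= s'; exists (fun=> 0); first exact: lin_upto0.
  by apply: boolp.funext.
by apply: boolp.funext => u; apply: var_comm_lin; rewrite /= -addnS.
Qed.

Lemma exact_neq i : i != g -> exact_at g i.
Proof. by rewrite neq_ltn => /orP[|]; [exact: exact_lt | exact: exact_gt]. Qed.


(** * The duality with maps to the parameter ring *)

(** The map [S (x) H -> H] given by the action of [S] on [H = Hom_A(R, A)] through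
    [R], applied to [h] expanded in the dual basis with coefficients [h (e s)]. *)
Definition dual_eval (h : P) (r : R) : {mpoly k[d]} :=
  \sum_s cs s (alg_eval x (h (e s)) * r).

Lemma comm_image_var s (q : 'I_(d + g)) h : (s <= g)%N ->
  (d <= q < d + s)%N -> lin_upto d h -> comm_image s (var_comm q h).
Proof.
move=> + + hL; elim: s => [|s IH] sg; first by rewrite addn0 => /andP[/leq_ltn_trans lt /lt]; rewrite ltnn.
move=> /andP[dq]; rewrite addnS ltnS leq_eqVlt => /orP[/eqP qs|qs].
  exists q, h, (fun=> 0); split=> //; first by apply: comm_image0; exact: ltnW.
  by apply: boolp.funext => r; rewrite addr0.
exists (rshift d (Ordinal sg)), (fun=> 0), (var_comm q h); split=> //.
- exact: lin_upto0.
- by apply: IH; [exact: ltnW | rewrite dq].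
- by apply: boolp.funext => r; rewrite [in RHS]/var_comm scaler0 subrr add0r.
Qed.

(** Moving a polynomial from the values to the argument costs commutators, one
    variable at a time. *)
Lemma comm_image_poly p h : lin_upto d h ->
  comm_image g (fun r => p *: h r - h (p *: r)).
Proof.
elim/mpoly_ring_ind: p h => [c|q|p p' IH IH'|p p' IH IH'] h hL.
- have [[_ hC] _] := hL.
  rewrite (_ : (fun r => _) = fun=> 0); first exact: comm_image0.
  by apply: boolp.funext => r; rewrite hC subrr.
- have [qd|dq] := ltnP q d; last by apply: comm_image_var => //; rewrite dq ltn_ord.
  have [_ hX] := hL.
  rewrite (_ : (fun r => _) = fun=> 0); first exact: comm_image0.
  by apply: boolp.funext => r; rewrite hX // subrr.
- have := comm_imageD (IH _ hL) (IH' _ hL); congr comm_image.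
  have [[hD _] _] := hL.
  by apply: boolp.funext => r; rewrite !scalerDl hD opprD addrACA.
- have := comm_imageD (comm_imageZ p (IH' _ hL)) (IH _ (lin_upto_scale p' hL)).
  congr comm_image; apply: boolp.funext => r.
  by rewrite scalerBr !scalerA addrA subrK [p' * p]mulrC.
Qed.

Lemma comm_image_sum s I (r : seq I) (h : I -> P) : (s <= g)%N ->
  (forall i, comm_image s (h i)) -> comm_image s (fun u => \sum_(i <- r) h i u).
Proof.
move=> sg hs; elim: r => [|i r IH].
  rewrite (_ : (fun u => _) = fun=> 0); first exact: comm_image0.
  by apply: boolp.funext => u; rewrite big_nil.
rewrite (_ : (fun u => _) = fun u => h i u + \sum_(j <- r) h j u).
  exact: comm_imageD.
by apply: boolp.funext => u; rewrite big_cons.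
Qed.

Lemma dual_evalD h h' r : dual_eval (fun r => h r + h' r) r = dual_eval h r + dual_eval h' r.
Proof.
rewrite -big_split; apply: eq_bigr => s _.
by rewrite alg_evalD mulrDl (coordD basis).
Qed.

Lemma dual_evalZ p h r : dual_eval (fun r => p *: h r) r = dual_eval h (alg_eval x p * r).
Proof.
apply: eq_bigr => s _; congr (cs s _).
by rewrite [p *: _]/(p * _) alg_evalM mulrCA mulrA.
Qed.

(** Both terms are the matrix of multiplication by [x q] applied to the
    coordinates of the elements that the values of [h] name in [R]. *)
Lemma dual_eval_comm (q : 'I_(d + g)) h r : lin_upto d h -> dual_eval (var_comm q h) r = 0.
Proof.
move=> hL.
have -> : dual_eval (var_comm q h) r =
    dual_eval (fun r => 'X_q *: h r) r - dual_eval (fun r => h ('X_q *: r)) r.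
  rewrite -sumrB; apply: eq_bigr => s _.
  by rewrite -(additive_mapB _ _ ((coordD basis) s)) -mulrBl -alg_evalB.
rewrite dual_evalZ; apply/eqP; rewrite subr_eq0; apply/eqP.
pose a u := alg_eval x (h (e u)).
have -> : dual_eval (fun r => h ('X_q *: r)) r =
    \sum_s \sum_u cs u (x q * e s) * cs s (a u * r).
  apply: eq_bigr => s _.
  have -> : 'X_q *: (e s : M) = x q * e s by rewrite /GRing.scale /= /eval_scale alg_evalX.
  rewrite (param_expand _ hL) alg_eval_sum mulr_suml (additive_map_sum _ _ _ ((coordD basis) s)).
  apply: eq_bigr => u _.
  by rewrite [_ *: _]/(_ * _) alg_evalM param_polyE -mulrA (coordM basis).
rewrite exchange_big; apply: eq_bigr => u _ /=.
rewrite alg_evalX mulrCA {1}[a u * r](coord_expand basis) mulr_sumr.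
rewrite (additive_map_sum _ _ _ ((coordD basis) u)); apply: eq_bigr => s _.
by rewrite mulrCA (coordM basis) mulrC.
Qed.

Lemma dual_eval_image s h r : comm_image s h -> dual_eval h r = 0.
Proof.
elim: s h => [|s IH] h.
  by move=> ->; rewrite /dual_eval big1 // => s _; rewrite alg_eval0 mul0r (additive_map0 ((coordD basis) s)).
move=> [q [h1 [h2 [_ h1L /IH h20 ->]]]].
by rewrite dual_evalD h20 dual_eval_comm // addr0.
Qed.

(** A map vanishes modulo commutators as soon as its evaluation does: it is a
    combination of the coordinate maps, and multiplying those by an element of
    [S] agrees modulo commutators with acting on them through [R]. *)
Lemma dual_eval_kernel h : lin_upto d h -> (forall r, dual_eval h r = 0) ->
  comm_image g h.
Proof.
move=> hL h0; pose f s (r : M) : S^o := param_poly g (cs s r).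
have := @comm_image_sum g _ (index_enum 'I_N)
  (fun s r => h (e s) *: f s r - f s (h (e s) *: r)) (leqnn g)
  (fun s => comm_image_poly (h (e s)) (coord_lin s)).
congr comm_image; apply: boolp.funext => r; rewrite sumrB.
have -> : \sum_s f s (h (e s) *: r) = 0.
  rewrite -[RHS](alg_eval0 (fun p => 'X_(lshift g p) : S)) -(h0 r).
  by rewrite /dual_eval alg_eval_sum.
rewrite subr0 (param_expand r hL); apply: eq_bigr => s _.
exact: mulrC.
Qed.

Lemma dual_eval_coord a s r :
  dual_eval (fun r => param_poly g (a * cs s r)) r = a * cs s r.
Proof.
rewrite /dual_eval (bigD1 s) //= (coord_basis basis) eqxx mulr1 param_polyE (coordM basis).
rewrite big1 ?addr0 // => u us; rewrite (coord_basis basis) eq_sym (negPf us) mulr0.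
by rewrite param_polyE alg_eval0 mul0r (additive_map0 ((coordD basis) u)).
Qed.

(** * Gradings *)

Hypothesis Rsg : standard_graded Rg.
Hypothesis x1 : forall q, Rg 1 (x q).

Definition res_grade (i : nat) (l : int) : set (res_mod i) :=
  match i return set (res_mod i) with
  | 0 => Rg l
  | i'.+1 => [set v : 'rV[S]_(rk F i') | forall p q,
       homog_of_degree (l + (fun _ => - deg q) p) (v p q)]
  end.

Lemma res_grade_subgroup i l : is_add_subgroup (@res_grade i l).
Proof.
case: i => [|i]; first exact: graded_subgroup.
apply: (@subgroup_matrix _ (fun t => [set p : S | homog_of_degree t p])).
exact: homog_subgroup.
Qed.

Lemma res_grade_dsum i : is_direct_sum setT (@res_grade i).
Proof.
case: i => [|i]; first exact: graded_dsum.
apply: (@dsum_matrix _ (fun t => [set p : S | homog_of_degree t p])).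
- exact: homog_subgroup.
- exact: homog_dsum.
Qed.

Lemma res_grade_diff i l u : @res_grade i.+1 l u -> res_grade l (@res_diff i u).
Proof.
have [hs gs] := (@homog_subgroup k (d + g), graded_subgroup Rsg).
case: i u => [|i] u hu.
  apply: (subgroup_sum gs) => q _.
  have := gradedM Rsg (alg_eval_homog Rsg x1 (hu 0 q)) (aug_homog q).
  by rewrite subrK.
move=> p q /=; rewrite mxE; apply: (subgroup_sum hs) => j _ /=.
have := homogM (hu p j) (diff_homog j q).
by rewrite addrA subrK.
Qed.

Lemma res_grade_var i l (q : 'I_(d + g)) u :
  @res_grade i l u -> res_grade (l + 1) ('X_q *: u).
Proof.
case: i u => [|i] u hu.
  rewrite /GRing.scale /= /eval_scale alg_evalX addrC.
  exact: gradedM.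
move=> p q'; rewrite mxE addrAC addrC; apply: homogM (hu p q').
by rewrite /= dhomogX /= mdeg1.
Qed.

Lemma res_grade_const i l c u : @res_grade i l u -> res_grade l (c%:MP *: u).
Proof.
case: i u => [|i] u hu.
  rewrite /GRing.scale /= /eval_scale alg_evalC -[l]add0r.
  by apply: gradedM => //; exact: graded_in_alg.
move=> p q'; rewrite mxE -[_ + _]add0r; apply: homogM (hu p q').
exact: homogC.
Qed.

(** The component of degree [c] of a map, pinned down on homogeneous elements. *)
Definition graded_part i (c : int) (v v' : res_mod i -> S^o) :=
  additive_map v' /\ forall l u, res_grade l u -> v' u = hpart (l + c) (v u).

Lemma graded_part_exists i c (v : res_mod i -> S^o) : additive_map v ->
  exists v', graded_part c v v'.
Proof.
move=> vD; have [|v' v'D v'E] := @additive_map_glue _ _ _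
  (@res_grade_subgroup i) (@res_grade_dsum i) S (fun l u => hpart (l + c) (v u)).
  by move=> l u u'; rewrite vD hpartD.
by exists v'.
Qed.

Lemma graded_part_unique i (v v' : res_mod i -> S^o) :
  additive_map v -> additive_map v' ->
  (forall l u, res_grade l u -> v u = v' u) -> v = v'.
Proof.
move=> vD v'D vv'; apply: boolp.funext.
exact: (additive_map_homog (@res_grade_subgroup i) (@res_grade_dsum i) vD v'D vv').
Qed.

Lemma graded_part_lin i t c (v v' : res_mod i -> S^o) :
  lin_upto t v -> graded_part c v v' -> lin_upto t v'.
Proof.
move=> [[vD vC] vX] [v'D v'E]; split; first split=> //.
- move=> b; apply: (additive_map_homog (@res_grade_subgroup i) (@res_grade_dsum i)).
  + by move=> u u'; rewrite scalerDr v'D.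
  + by move=> u u'; rewrite v'D scalerDr.
  move=> l u hu; rewrite (v'E l) ?(v'E l u) //; last exact: res_grade_const.
  rewrite vC; have := hpartM (l + c) (v u) (homogC (d + g) b).
  by rewrite add0r.
- move=> q u qt; move: u.
  apply: (additive_map_homog (@res_grade_subgroup i) (@res_grade_dsum i)).
  + by move=> u u'; rewrite scalerDr v'D.
  + by move=> u u'; rewrite v'D scalerDr.
  move=> l u hu; rewrite (v'E (l + 1)) ?(v'E l u) //; last exact: res_grade_var.
  rewrite vX // addrAC addrC; apply: hpartM.
  by rewrite /= dhomogX /= mdeg1.
Qed.

(** The variables have degree one, so each connecting step lowers degrees by one. *)
Lemma connecting_graded s c w h w' h' : @connecting s w h ->
  graded_part (c - s%:Z) w w' -> @graded_part 0 c h h' -> connecting w' h'.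
Proof.
move=> + + hp; elim: s w w' => [|s IH] w w'.
  move=> [hL ->] [w'D w'E]; split; first exact: graded_part_lin hp.
  have [h'D h'E] := hp; have [[dD _] _] := res_diff_lin 0.
  apply: graded_part_unique => // [u u'|l u hu]; first by rewrite /= dD h'D.
  rewrite (w'E l) //= (h'E l); last exact: (@res_grade_diff 0).
  by rewrite subr0.
move=> [q [v [qs vL -> hv]]] [w'D w'E].
have [[vD _] _] := vL; have [v' vp] := graded_part_exists (c - s.+1%:Z) vD.
have [v'D v'E] := vp; have [[dD _] _] := res_diff_lin s.+1.
exists q, v'; split=> //.
- exact: graded_part_lin vp.
- apply: graded_part_unique => // [u u'|l u hu]; first by rewrite /= dD v'D.
  by rewrite (w'E l) //= (v'E l) //; exact: res_grade_diff.
apply: (IH _ _ hv); split.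
  by move=> u u'; rewrite /var_comm scalerDr !v'D scalerDr opprD addrACA.
move=> l u hu; rewrite /var_comm (v'E l) // (v'E (l + 1)); last exact: res_grade_var.
rewrite (additive_mapB _ _ (@hpartD _ _ _)); congr (_ - hpart _ _).
  rewrite (_ : l + (c - s%:Z) = 1 + (l + (c - s.+1%:Z))); last by lia.
  by apply/esym/hpartM; rewrite /= dhomogX /= mdeg1.
by lia.
Qed.


(** Homomorphisms from a free module are given by column vectors. *)
Definition col_cochain i (w : 'cV[S]_(rk F i)) : cochain i := fun u => (u *m w) 0 0.

Lemma col_cochain_lin i t w : lin_upto t (@col_cochain i w).
Proof.
split; first split.
- by move=> u u'; rewrite /col_cochain mulmxDl mxE.
- by move=> c u; rewrite /col_cochain -scalemxAl mxE.
- by move=> q u _; rewrite /col_cochain -scalemxAl mxE.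
Qed.

Lemma col_cochain_inj i : injective (@col_cochain i).
Proof.
move=> w w' ww'; apply/colP => q.
have := congr1 (fun f => f (delta_mx 0 q)) ww'.
by rewrite /col_cochain -!rowE !mxE.
Qed.

Lemma col_cochain_surj i (v : cochain i) : lin_upto (d + g) v ->
  exists w, v = col_cochain w.
Proof.
move=> vL; exists (\col_q v (delta_mx 0 q)); apply: boolp.funext => u.
have [[vD _] _] := vL.
rewrite /col_cochain mxE {1}(row_sum_delta u) (additive_map_sum _ _ _ vD).
by apply: eq_bigr => q _; rewrite (lin_upto_full _ _ vL) mxE.
Qed.

Lemma col_cochain_diff i w :
  col_cochain (diff F i *m w) = col_cochain w \o @res_diff i.+1.
Proof. by apply: boolp.funext => u; rewrite /col_cochain /= /res_diff mulmxA. Qed.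

Lemma col_cochain0 i : col_cochain 0 = (fun=> 0) :> cochain i.
Proof. by apply: boolp.funext => u; rewrite /col_cochain mulmx0 mxE. Qed.

Lemma cocycle_col i w : @cocycle _ _ _ _ _ F i w <-> cocycleP (col_cochain w).
Proof.
rewrite /cocycle /=; split=> [e0 u|c0].
  by have := congr1 (fun f => f u) (col_cochain_diff w); rewrite e0 col_cochain0 /= => <-.
apply: col_cochain_inj; rewrite col_cochain_diff col_cochain0.
by apply: boolp.funext => u; exact: c0.
Qed.

Lemma coboundary_col i w : @coboundary _ _ _ _ _ F i w <-> coboundaryP g (col_cochain w).
Proof.
case: i w => [|i] w; rewrite /coboundary /=.
  by split=> [->|e0]; [rewrite col_cochain0 | apply: col_cochain_inj; rewrite e0 col_cochain0].
split=> [[u ->]|[v vL ev]].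
  by exists (col_cochain u); [exact: col_cochain_lin | exact: col_cochain_diff].
have [u eu] := col_cochain_surj vL; exists u; apply: col_cochain_inj.
by rewrite ev eu col_cochain_diff.
Qed.

Lemma hom_degree_col i t w : @hom_degree _ _ _ _ _ F i t w <->
  graded_part (t - (d + g)%:Z) (@col_cochain i w) (col_cochain w).
Proof.
have hs := @homog_subgroup k (d + g).
split=> [hw|[_ hw] p].
  split; first by have [[]] := col_cochain_lin 0 w.
  move=> l u hu; rewrite hpart_id //= /col_cochain mxE.
  apply: (subgroup_sum hs) => q _ /=; have := homogM (hu 0 q) (hw q).
  by congr homog_of_degree; lia.
have hd : @res_grade i.+1 (deg p) (delta_mx 0 p).
  move=> a q; rewrite mxE ord1 eqxx /=; case: eqVneq => [->|_].
    by rewrite subrr; exact: dhomog1.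
  exact: (subgroup0 hs).
have := hw _ _ hd; rewrite /col_cochain -rowE mxE => ->.
by rewrite (_ : t + deg p - (d + g)%:Z = deg p + (t - (d + g)%:Z)); [exact: hpart_homog | lia].
Qed.

Section CanonicalDual.
Variables (W : lmodType R) (Wg : int -> set W).
Hypothesis Wgr : graded_module Rg Wg.
Lemma hom_degree_dsum i : is_direct_sum setT (@hom_degree _ _ _ _ _ F i).
Proof.
have := @dsum_matrix S (fun t => [set p : S | homog_of_degree t p]) (rk F i) 1
  (fun p _ => deg p - (d + g)%:Z) (@homog_subgroup k (d + g)) (@homog_dsum k (d + g)).
congr is_direct_sum; apply: boolp.funext => t; apply/seteqP; split=> w hw p /=.
  by have := hw p 0; rewrite /= addrA.
by move=> q; rewrite ord1 addrA; exact: hw.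
Qed.

Lemma hom_degree_diff i t w : @hom_degree _ _ _ _ _ F i t w ->
  @hom_degree _ _ _ _ _ F i.+1 t (diff F i *m w).
Proof.
move=> hw p; rewrite mxE; apply: (subgroup_sum (@homog_subgroup k (d + g))) => q _ /=.
by have := homogM (diff_homog p q) (hw q); congr homog_of_degree; lia.
Qed.

(** The homogeneous components of a cocycle are cocycles, and passing to the
    module commutes with taking components. *)
Lemma canonical_rep i0 (psi : 'cV[S]_(rk F i0) -> W) t v :
  (forall s w1 w2, @cocycle _ _ _ _ _ F i0 w1 -> @cocycle _ _ _ _ _ F i0 w2 ->
     psi (s *: w1 + w2) = alg_eval x s *: psi w1 + psi w2) ->
  (forall v, exists2 w, @cocycle _ _ _ _ _ F i0 w & psi w = v) ->
  (forall t w, @cocycle _ _ _ _ _ F i0 w -> @hom_degree _ _ _ _ _ F i0 t w -> Wg t (psi w)) ->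
  Wg t v -> exists w, [/\ @cocycle _ _ _ _ _ F i0 w, @hom_degree _ _ _ _ _ F i0 t w & psi w = v].
Proof.
move=> psiL psiS psig hv; have [Wsub Wdsum _] := Wgr.
have c0 : @cocycle _ _ _ _ _ F i0 0 by rewrite /cocycle /= mulmx0.
have psi0 : psi 0 = 0.
  have := psiL 1 0 0 c0 c0; rewrite scaler0 addr0 alg_eval1 scale1r.
  by move=> /eqP; rewrite -subr_eq subrr eq_sym => /eqP.
have [w wc ew] := psiS v.
have [s [f [us fB fE]]] := ((hom_degree_dsum i0).1 w).1 I.
have fc j : j \in s -> @cocycle _ _ _ _ _ F i0 (f j).
  move=> js; apply: ((hom_degree_dsum i0.+1).2 s (fun j => diff F i0 *m f j)) => //.
    by move=> j' js'; apply: hom_degree_diff; exact: fB.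
  by rewrite -mulmx_sumr -fE.
have psi_sum (r : seq int) : {subset r <= s} ->
    @cocycle _ _ _ _ _ F i0 (\sum_(j <- r) f j) /\
    psi (\sum_(j <- r) f j) = \sum_(j <- r) psi (f j).
  elim: r => [|j r IH] rs; first by rewrite !big_nil.
  have [|rc er] := IH; first by move=> j' jr; apply: rs; rewrite inE jr orbT.
  have jc : @cocycle _ _ _ _ _ F i0 (f j) by apply: fc; apply: rs; rewrite inE eqxx.
  have := psiL 1 _ _ jc rc; rewrite !scale1r alg_eval1 scale1r !big_cons er => ->.
  split=> //; move: jc rc; rewrite /cocycle /= mulmxDr => -> ->.
  by rewrite addr0.
have [_ es] := psi_sum s (fun j js => js).
have := component_id Wsub Wdsum hv; rewrite -{1}ew fE es.
rewrite (componentE Wsub Wdsum t us); last by move=> j js; apply: psig; [exact: fc|exact: fB].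
case: ifP => ts <-; first by exists (f t); split=> //; [exact: fc|exact: fB].
exists 0; split=> // p; rewrite mxE.
exact: (subgroup0 (@homog_subgroup k (d + g))).
Qed.

Variable i0 : nat.
Hypothesis Wiso : graded_iso_Ext F i0 Wg.
Hypothesis W_neq0 : exists v : W, v <> 0.

(** In every other degree the cohomology vanishes. *)
Lemma ext_degree : i0 = g.
Proof.
apply/eqP/negPn/negP => ig; have [v v0] := W_neq0; apply: v0.
have [psi [_ psiS psi0 _]] := Wiso; have [w wc <-] := psiS v.
apply/(psi0 _ wc)/coboundary_col; apply: exact_neq ig _ _ _.
  exact: col_cochain_lin.
exact/cocycle_col.
Qed.

Hypothesis x_gen : algebra_generators x.
Hypothesis d_gt0 : (0 < d)%N.

(** The canonical module is the graded dual of [R] over the parameters; in degree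
    [t] it contains a nonzero multiple of the dual basis element of [e s] exactly
    when [delta s] is at least [d - t], and it is spanned by such multiples. *)
Lemma annihilator_criterion l r t : Rg l r ->
  (forall v, Wg t v -> r *: v = 0) <->
  (forall s, d%:Z - t <= (delta s)%:Z -> forall u, cs s (r * u) = 0).
Proof.
have ei := ext_degree; subst i0.
move=> hr; have [psi [psiL psiS psi0 psig]] := Wiso.
have [p ep] := x_gen r.
have c0 : @cocycle _ _ _ _ _ F g 0 by rewrite /cocycle /= mulmx0.
have psi00 : psi 0 = 0.
  have := psiL 1 0 0 c0 c0; rewrite scaler0 addr0 alg_eval1 scale1r.
  by move=> /eqP; rewrite -subr_eq subrr eq_sym => /eqP.
have key w h : @cocycle _ _ _ _ _ F g w -> connecting (col_cochain w) h ->
    (r *: psi w = 0 <-> forall u, dual_eval h (r * u) = 0).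
  move=> wc hw; have hpw := connectingZ p hw.
  have cpw : (fun u => p *: col_cochain w u) = col_cochain (p *: w).
    by apply: boolp.funext => u; rewrite /col_cochain -scalemxAr [RHS]mxE.
  have pwc : @cocycle _ _ _ _ _ F g (p *: w).
    by move: wc; rewrite /cocycle /= -scalemxAr => ->; rewrite scaler0.
  have -> : r *: psi w = psi (p *: w).
    by have := psiL p _ _ wc c0; rewrite psi00 !addr0 -ep.
  rewrite cpw in hpw.
  have ev0 u : dual_eval (fun r => p *: h r) u = dual_eval h (r * u).
    by rewrite dual_evalZ -ep.
  rewrite (psi0 _ pwc) coboundary_col (connecting_kernel (leqnn g) hpw); split.
    by move=> hs u; rewrite -ev0; exact: dual_eval_image hs.
  move=> h0; apply: dual_eval_kernel; last by move=> u; rewrite ev0.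
  exact: connecting_lin hpw.
have [e_homog _ _] := basis.
split=> [rW s ds u|rs v hv].
  (* The [m]-th power of a parameter moves the dual basis element of [e s] into
     degree [t] of the canonical module. *)
  have [m em] : exists m : nat, m%:Z = (delta s)%:Z + t - d%:Z.
    by exists (absz ((delta s)%:Z + t - d%:Z)%R); lia.
  pose X0 : {mpoly k[d]} := 'X_(Ordinal d_gt0).
  pose h0 : P := fun r => param_poly g (X0 ^+ m * cs s r).
  have h0L : lin_upto d h0.
    have := lin_uptoZ (param_poly g (X0 ^+ m)) (coord_lin s).
    by congr (lin_upto _); apply: boolp.funext => r'; rewrite /h0 /param_poly alg_evalM.
  have h0g : @graded_part 0 (t - d%:Z) h0 h0.
    split; first by have [[]] := h0L.
    move=> l' r' hr'; rewrite hpart_id // /h0 /param_poly.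
    apply: (alg_eval_homog (mpoly_standard_graded k (d + g))) => [q|].
      by rewrite /= dhomogX /= mdeg1.
    have <- : m%:Z + (l' - (delta s)%:Z) = l' + (t - d%:Z) by rewrite em; lia.
    apply: homogM (coord_homog basis Rsg (fun p => x1 _) s hr'); rewrite /=.
    have := @dhomogMn _ _ mdeg 1 X0 m.
    by rewrite mul1n; apply; rewrite dhomogX /= mdeg1.
  have [v hv] := connecting_surj (leqnn g) h0L.
  have [vL vc] := connecting_cocycle (leqnn g) hv.
  have [[vD _] _] := vL.
  have [v' vp] := graded_part_exists (t - d%:Z - g%:Z) vD.
  have hv' := connecting_graded hv vp h0g.
  have [v'L v'c] := connecting_cocycle (leqnn g) hv'.
  have [w ew] := col_cochain_surj v'L; subst v'.
  have wc : @cocycle _ _ _ _ _ F g w by apply/cocycle_col.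
  have wt : @hom_degree _ _ _ _ _ F g t w.
    apply/hom_degree_col; have [cD cE] := vp; split=> // l' u' hu'.
    rewrite (_ : t - (d + g)%:Z = t - d%:Z - g%:Z); last by lia.
    rewrite (cE _ _ hu'); apply/esym/hpart_id; exact: hpart_homog.
  have /(_ u) := (key _ _ wc hv').1 (rW _ (psig _ _ wc wt)).
  rewrite /h0 dual_eval_coord => /eqP; rewrite mulf_eq0 expf_eq0.
  by rewrite -msupp_eq0 msuppX andbF => /eqP.
have [w [wc wt <-]] := canonical_rep psiL psiS psig hv.
have [h hw] := connecting_total (leqnn g) (col_cochain_lin _ w) ((cocycle_col w).1 wc).
have [[hD _] _] := connecting_lin hw.
have [h' hp] := @graded_part_exists 0 (t - d%:Z) h hD.
have wp := (hom_degree_col t w).1 wt.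
rewrite PoszD opprD addrA in wp.
have hw' := connecting_graded hw wp hp.
apply/(key _ _ wc hw') => u; rewrite /dual_eval big1 // => s _.
have [ds|ds] := lerP (d%:Z - t) (delta s)%:Z.
  by rewrite mulrCA; exact: rs.
have [_ h'E] := hp; rewrite (h'E (delta s)); last exact: e_homog.
rewrite (@homog_neg _ _ _ (hpart _ _) _ (hpart_homog _ _)); last by lia.
by rewrite alg_eval0 mul0r (additive_map0 ((coordD basis) s)).
Qed.

End CanonicalDual.
End ExtComplex.

(** * Powers of the ideals and their colons *)

Section Powers.
Variables (k : fieldType) (R : comAlgType k) (Rg : int -> set R).
Hypothesis Rsg : standard_graded Rg.
Let gs := graded_subgroup Rsg.
Let gd := graded_dsum Rsg.
Let cD := componentD gs gd.

Lemma ideal_powz_ideal I i : is_ideal (@ideal_powz R I i).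
Proof. by case: i => n //=; exact: ideal_pow_ideal. Qed.

Lemma ideal_sum (I : set R) T (r : seq T) (f : T -> R) : is_ideal I ->
  (forall i, I (f i)) -> I (\sum_(i <- r) f i).
Proof. by move=> [I0 ID _] If; apply: (big_ind I). Qed.

Definition order_ge (j : int) : set R :=
  [set u | forall l, l < j -> component Rg l u = 0].

Lemma order_ge_homog j l u : j <= l -> Rg l u -> order_ge j u.
Proof.
move=> jl hu l' l'j; apply: (component_neq gs gd hu).
by apply: contraTneq l'j => ->; rewrite -leNgt.
Qed.

Lemma order_geD j u v : order_ge j u -> order_ge j v -> order_ge j (u + v).
Proof. by move=> hu hv l lj; rewrite cD hu // hv // addr0. Qed.

Lemma order_geM i j u v : order_ge i u -> order_ge j v -> order_ge (i + j) (u * v).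
Proof.
move=> hu hv; have [s [_ _ ->]] := component_split gs gd u.
have [s' [_ _ ->]] := component_split gs gd v.
rewrite mulr_suml; apply: (big_ind (order_ge (i + j))).
- by move=> l _; exact: additive_map0.
- by move=> a b; exact: order_geD.
move=> l _; rewrite mulr_sumr; apply: (big_ind (order_ge (i + j))).
- by move=> l' _; exact: additive_map0.
- by move=> a b; exact: order_geD.
move=> l' _; have [li|il] := ltP l i.
  by rewrite hu // mul0r => t _; exact: additive_map0.
have [lj|jl] := ltP l' j.
  by rewrite (hv l') // mulr0 => t _; exact: additive_map0.
apply: (order_ge_homog (l := l + l')); first exact: lerD.
by apply: (gradedM Rsg); exact: component_in.
Qed.

Lemma order_ge_neg j u : j <= 0 -> order_ge j u.
Proof.
move=> j0 l lj; apply: (graded_neg Rsg (i := l)); last exact: component_in.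
exact: lt_le_trans lj j0.
Qed.

(** [R] is generated in degree one, so elements of degree [l] are combinations of
    products of [l] elements of the maximal ideal. *)
Lemma max_power_order j u : ideal_powz (homog_max_ideal Rg) j u <-> order_ge j u.
Proof.
have max1 : homog_max_ideal Rg `<=` order_ge 1.
  apply: ideal_gen_ind.
  - by move=> l _; exact: additive_map0.
  - by move=> a b; exact: order_geD.
  move=> r v [i i0 hv]; rewrite -[1]add0r; apply: order_geM.
    exact: order_ge_neg.
  by apply: order_ge_homog hv; lia.
have [I0 ID IM] := ideal_powz_ideal (homog_max_ideal Rg) j.
split=> [|hu].
  case: j {I0 ID IM} => n /=; last by move=> _; apply: order_ge_neg.
  elim: n u => [|n IH] u; first by move=> _; exact: order_ge_neg.
  move: u; apply: ideal_gen_ind.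
  - by move=> l _; exact: additive_map0.
  - by move=> a b; exact: order_geD.
  move=> r _ [a [b [ha hb ->]]]; rewrite -[n.+1%:Z]add0r; apply: order_geM.
    exact: order_ge_neg.
  by rewrite -addn1 addnC PoszD; apply: order_geM; [exact: max1 | exact: IH].
have [s [_ _ ->]] := component_split gs gd u.
apply: ideal_sum => [|l]; first exact: ideal_powz_ideal.
have [lj|jl] := ltP l j; first by rewrite hu.
have := component_in gs gd l u; move: (component Rg l u) => v hv.
case: j {I0 ID IM hu} jl => n //= nl.
have [N [x [x1 gen]]] : exists n (x : 'I_n -> R),
    (forall i, Rg 1 (x i)) /\ algebra_generators x by case: Rsg.
case: l nl hv => // l nl hv.
have [p /dhomogP hp <-] := alg_eval_homog_lift Rsg x1 gen hv.
have [I0 ID IM] := ideal_pow_ideal (homog_max_ideal Rg) n.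
rewrite (mpolyE p) alg_eval_sum big_seq_cond.
apply: (big_ind (ideal_pow (homog_max_ideal Rg) n)) => // m; rewrite andbT => /hp hm.
rewrite alg_evalZ -mulr_algl; apply: (IM).
apply: (ideal_pow_le (j := mdeg m)); first by move: nl; rewrite -hm lez_nat.
by apply: ideal_pow_monomial => q; exact: homog_max_ideal1.
Qed.

Variables (d N : nat) (y : 'I_d -> R) (e : 'I_N -> R) (delta : 'I_N -> nat).
Variable cs : 'I_N -> R -> {mpoly k[d]}.
Hypothesis basis : parameter_basis Rg y e delta cs.
Hypothesis y1 : forall p, Rg 1 (y p).
Let J := ideal_gen (range y).

(** As [R] is free over the parameters, powers of the parameter ideal are
    detected on coordinates. *)
Lemma param_power_coord i r : ideal_powz J i r <->
  forall s m, (mdeg m)%:Z < i -> (cs s r)@_m = 0.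
Proof.
have cs0 s : cs s 0 = 0 by rewrite (additive_map0 (coordD basis s)).
case: i => n /=; last by split=> // _ s m; lia.
split.
  elim: n r => [|n IH]; first by move=> r _ s m; lia.
  apply: ideal_gen_ind.
  - by move=> s m _; rewrite cs0 mcoeff0.
  - by move=> a b ha hb s m mn; rewrite (coordD basis) mcoeffD ha // hb // addr0.
  move=> r _ [u [v [/ideal_gen_range[c ->] hv ->]]] s m mn.
  have [I0 ID IM] := ideal_pow_ideal J n.
  rewrite mulr_suml mulr_sumr (additive_map_sum _ _ _ (coordD basis s)) raddf_sum big1 //= => p _.
  have -> : r * (c p * y p * v) = alg_eval y 'X_p * (r * c p * v).
    by rewrite alg_evalX; ring.
  rewrite (coordM basis) mcoeffXM; case: ifP => // mp; apply: IH; first exact: IM.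
  by move: mn; rewrite {1}(addm_subU mp) mdegD mdeg1; lia.
move=> hr; have [I0 ID IM] := ideal_pow_ideal J n.
rewrite (coord_expand basis r); apply: (big_ind (ideal_pow J n)) => // s _.
rewrite mulrC; apply: (IM).
rewrite (mpolyE (cs s r)) alg_eval_sum big_seq_cond.
apply: (big_ind (ideal_pow J n)) => // m; rewrite andbT mcoeff_msupp => hm.
rewrite alg_evalZ -mulr_algl; apply: (IM).
apply: (ideal_pow_le (j := mdeg m)); last first.
  by apply: ideal_pow_monomial => q; apply: ideal_gen_sub; exists q.
by rewrite leqNgt; apply: contra hm => mn; rewrite hr.
Qed.

Lemma param_power_component i l r : ideal_powz J i r ->
  ideal_powz J i (component Rg l r).
Proof.
move=> /param_power_coord hr; apply/param_power_coord => s m mi.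
rewrite (coord_component basis Rsg y1).
case: (_ - _) => t //=; last by rewrite mcoeff0.
have [tm|tm] := eqVneq (mdeg m) t.
  rewrite pihomogE raddf_sum big1_seq //= => m' /andP[/eqP ht hm'].
  rewrite mcoeffZ mcoeffX; case: eqP => [e'|]; last by rewrite mulr0.
  by rewrite e' hr // mul0r.
by rewrite (dhomog_nemf_coeff (pihomogP _ _ _) tm).
Qed.

Lemma param_power_homog i l r : Rg l r -> ideal_powz J i r <->
  forall s, l - (delta s)%:Z < i -> cs s r = 0.
Proof.
move=> hr; rewrite param_power_coord; split=> h s.
  move=> li; apply/mpolyP => m; rewrite mcoeff0.
  have := coord_homog basis Rsg y1 s hr.
  case: (l - _) li => t li /=; last by move=> ->; rewrite mcoeff0.
  move=> ht; have [tm|tm] := eqVneq (mdeg m) t; last exact: dhomog_nemf_coeff tm.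
  by apply: h; rewrite tm.
move=> m mi; have := coord_homog basis Rsg y1 s hr.
have [li|li] := ltP (l - (delta s)%:Z) i; first by rewrite h // mcoeff0.
case: (l - _) li => t li /=; last by move=> ->; rewrite mcoeff0.
move=> ht; apply: (dhomog_nemf_coeff ht).
by apply: contraTneq mi => ->; rewrite -leNgt.
Qed.

Variables i j : int.
Let U := colon (ideal_powz J i) (ideal_powz (homog_max_ideal Rg) j).

Lemma colon_sum T (r : seq T) (f : T -> R) : (forall t, U (f t)) -> U (\sum_(t <- r) f t).
Proof.
move=> Uf u hu; rewrite mulr_suml; apply: ideal_sum; first exact: ideal_powz_ideal.
by move=> t; exact: Uf.
Qed.

(** Both ideals are homogeneous. *)
Lemma colon_component l r : U r -> U (component Rg l r).
Proof.
move=> Ur u /max_power_order hu; have [s [_ _ ->]] := component_split gs gd u.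
rewrite mulr_sumr; apply: ideal_sum; first exact: ideal_powz_ideal.
move=> t; have [tj|jt] := ltP t j.
  by rewrite hu // mulr0; have [] := ideal_powz_ideal J i.
have hc := component_in gs gd t u.
rewrite mulrC -(component_mulr Rsg _ _ hc); apply: param_power_component.
rewrite mulrC; apply: Ur; apply/max_power_order.
exact: order_ge_homog hc.
Qed.

Hypothesis d_gt0 : (0 < d)%N.
Hypothesis delta_le : forall s, (delta s)%:Z <= j.

(** Multiplying the basis elements into degree [j] by powers of a parameter
    tests a homogeneous [r] against all of [R] rather than against high degrees. *)
Lemma colon_homog l r : Rg l r -> U r <->
  forall s, l + j - i < (delta s)%:Z -> forall u, cs s (r * u) = 0.
Proof.
move=> hr; have [e_homog _ _] := basis; split=> [Ur s ls u|h u /max_power_order hu].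
  have zero s' : cs s (r * e s') = 0.
    have [m em] : exists m : nat, m%:Z = j - (delta s')%:Z.
      by exists (absz (j - (delta s')%:Z)%R); have := delta_le s'; lia.
    pose v := y (Ordinal d_gt0) ^+ m * e s'.
    have hv : Rg j v.
      have := gradedM Rsg (graded_exp Rsg m (y1 (Ordinal d_gt0))) (e_homog s').
      by rewrite em subrK.
    have Iv : ideal_powz (homog_max_ideal Rg) j v.
      by apply/max_power_order; exact: order_ge_homog hv.
    have := (param_power_homog i (gradedM Rsg hr hv)).1 (Ur _ Iv) s.
    have -> : r * v = alg_eval y ('X_(Ordinal d_gt0) ^+ m) * (r * e s').
      rewrite /v mulrCA; congr (_ * _).
      by elim: (m) => [|q IH]; rewrite ?expr0 ?alg_eval1 // !exprS alg_evalM alg_evalX IH.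
    rewrite (coordM basis) => /(_ (ltac:(lia))) /eqP; rewrite mulf_eq0 expf_eq0.
    by rewrite -msupp_eq0 msuppX andbF => /eqP.
  rewrite (coord_expand basis u) mulr_sumr (additive_map_sum _ _ _ (coordD basis s)).
  by apply: big1 => s' _; rewrite mulrCA (coordM basis) zero mulr0.
have [s [_ _ ->]] := component_split gs gd u.
rewrite mulr_sumr; apply: ideal_sum; first exact: ideal_powz_ideal.
move=> t; have [tj|jt] := ltP t j.
  by rewrite hu // mulr0; have [] := ideal_powz_ideal J i.
apply/(param_power_homog i (gradedM Rsg hr (component_in gs gd t u))) => s' hs'.
by apply: h; lia.
Qed.

End Powers.

(** * Assembling the decomposition *)

Lemma canonical_duality (k : fieldType) (R : comAlgType k) (Rg : int -> set R)
    (d : nat) (W : lmodType R) (Wg : int -> set W) (y : 'I_d -> R) :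
  standard_graded Rg -> cohen_macaulay Rg -> krull_dim_is R d -> (0 < d)%N ->
  canonical_module Rg Wg -> (exists v : W, v <> 0) ->
  (forall p, Rg 1 (y p)) -> system_of_parameters Rg y ->
  exists N (e : 'I_N -> R) (delta : 'I_N -> nat) cs,
    parameter_basis Rg y e delta cs /\
    forall l r t, Rg l r ->
      (forall v, Wg t v -> r *: v = 0) <->
      (forall s, d%:Z - t <= (delta s)%:Z -> forall u, cs s (r * u) = 0).
Proof.
move=> Rsg Rcm Rd d0 Wcan W0 y1 ysop.
have [N [e [delta [cs basis]]]] := free_over_parameters Rsg Rcm Rd y1 ysop.
have y_indep (v : 'rV_d) : \sum_p v 0 p *: y p = 0 -> v = 0 := parameters_independent basis.
have [g [x [i [F [x1 gen xy iso]]]]] := adapted_resolution Rsg y1 y_indep Wcan.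
have ey : y = fun p => x (lshift g p) by apply: boolp.funext => p; rewrite xy.
exists N, e, delta, cs; split=> // l r t hr.
have [Wgr _] := Wcan; rewrite ey in basis.
exact: (annihilator_criterion basis Rsg x1 Wgr iso W0 gen d0 t hr).
Qed.

Lemma ann_submodule_gen (k : fieldType) (A : comAlgType k) (V : lmodType A) (X : set V) r :
  ann (submodule_gen X) r <-> forall v, X v -> r *: v = 0.
Proof.
split=> [h v Xv|h _ [m [c [u [Xu ->]]]]].
  apply: h; exists 1%N, (fun=> 1), (fun=> v); split=> //.
  by rewrite big_ord1 scale1r.
rewrite scaler_sumr big1 // => p _.
by rewrite scalerA mulrC -scalerA h ?scaler0.
Qed.

Theorem corollary2p14 (k : fieldType) (R : comAlgType k) (Rg : int -> set R)
    (d : nat) (W : lmodType R) (Wg : int -> set W) (a b : int)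
    (y : 'I_d -> R) (i j : int) :
  standard_graded Rg ->
  cohen_macaulay Rg ->
  krull_dim_is R d ->
  (1 <= d)%N ->
  canonical_module Rg Wg ->
  a_invariant_is Wg a ->
  b_invariant_is Wg b ->
  (forall p, Rg 1 (y p)) ->
  system_of_parameters Rg y ->
  a + d%:Z <= j ->
  let m := homog_max_ideal Rg in
  let J := ideal_gen (range y) in
  is_direct_sum (colon (ideal_powz J i) (ideal_powz m j))
    (fun o : option {l : int | i - j + b + d%:Z <= l <= i - j + a + d%:Z - 1} =>
       if o is Some l then
         ann (submodule_gen (Wg (i - j - val l + d%:Z - 1))) `&` Rg (val l)
       else ideal_powz m (i - j + a + d%:Z)).
Proof.
move=> Rsg Rcm Rd d0 Wcan Wa Wb y1 ysop aj m J.
have [gs gd] := (graded_subgroup Rsg, graded_dsum Rsg).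
have cD := componentD gs gd.
have [[Wsub _ _] _] := Wcan.
have W0 : exists v : W, v <> 0.
  apply: contrapT => /forallNP h; case: Wa => Wa _; apply: Wa.
  apply/seteqP; split=> [v _|_ ->]; first by apply: contrapT; exact: h.
  exact: (subgroup0 Wsub).
have [N [e [delta [cs [basis criterion]]]]] :=
  canonical_duality Rsg Rcm Rd d0 Wcan W0 y1 ysop.
have [e_homog _ _] := basis.
have W_small t : t < - a -> forall v, Wg t v -> v = 0.
  move=> ta v hv; apply: contrapT => v0; have [_ /(_ t)] := Wa.
  rewrite leNgt ta /= => h; suff : false by [].
  by apply: h => e0; move: hv; rewrite e0.
have R0 : Rg 0 1 by rewrite -(scale1r 1); exact: graded_in_alg.
(* The dual basis element of [e s] sits in degree [d - delta s] of the canonical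
   module, which vanishes below [- a]. *)
have delta_le s : (delta s)%:Z <= a + d%:Z.
  rewrite leNgt; apply/negP => ds.
  have /(criterion _ _ (d%:Z - (delta s)%:Z) R0) : forall v, Wg (d%:Z - (delta s)%:Z) v -> (1 : R) *: v = 0.
    by move=> v hv; rewrite (W_small _ _ v hv) ?scaler0 //; lia.
  move=> /(_ s _ (e s)); rewrite mul1r (coord_basis basis) eqxx => h.
  by have /eqP := h (ltac:(lia)); rewrite oner_eq0.
have delta_j s : (delta s)%:Z <= j by apply: le_trans aj.
set U := colon _ _.
have UC l r : Rg l r -> U r <->
    forall s, l + j - i < (delta s)%:Z -> forall u, cs s (r * u) = 0.
  exact: (colon_homog Rsg basis y1 i d0 delta_j).
have U_high l r : i - j + a + d%:Z <= l -> Rg l r -> U r.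
  move=> le hr; apply/(UC _ _ hr) => s ls u.
  by have := delta_le s; lia.
(* [delta s >= d - t] means [delta s > l + j - i] for [t = i - j - l + d - 1]. *)
have U_ann l r : Rg l r -> U r <-> ann (submodule_gen (Wg (i - j - l + d%:Z - 1))) r.
  move=> hr; rewrite ann_submodule_gen (criterion _ _ _ hr) (UC _ _ hr).
  by split=> h s hs; apply: h; lia.
have U_low l r : l < i - j + b + d%:Z -> Rg l r -> U r -> r = 0.
  move=> lb hr /(U_ann _ _ hr)/ann_submodule_gen/(criterion _ _ _ hr) h.
  have [Wfaith _] := Wb; rewrite /faithful /= in Wfaith.
  have : ann (submodule_gen (Wg (- b))) r; last by rewrite Wfaith.
  apply/ann_submodule_gen/(criterion _ _ _ hr) => s hs; apply: h; lia.
set lo := i - j + b + d%:Z in U_low *.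
set hi := i - j + a + d%:Z - 1.
set top := i - j + a + d%:Z in U_high *.
pose B (o : option {l : int | lo <= l <= hi}) : set R :=
  if o is Some l then
    ann (submodule_gen (Wg (i - j - val l + d%:Z - 1))) `&` Rg (val l)
  else ideal_powz m top.
change (is_direct_sum U B).
have lhi (l : {l : int | lo <= l <= hi}) : val l < top.
  by have := valP l; rewrite /hi /top; lia.
have B_comp (o : option {l : int | lo <= l <= hi}) l r : B o r ->
    component Rg (val l) r = if o == Some l then r else 0.
  case: o => [l'|] /=; last by move=> /(max_power_order Rsg) h; exact: h (lhi l).
  move=> [_ hr]; rewrite (inj_eq (@Some_inj _)); have [<-|ne] := eqVneq l' l.
    exact: (component_id gs gd).
  apply: (component_neq gs gd hr); apply: contra_neq ne => e0.
  exact: val_inj.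
have BU o r : B o r -> U r.
  case: o => [l [hA hr]|/(max_power_order Rsg) h]; first exact/(U_ann _ _ hr).
  have [s [_ _ ->]] := component_split gs gd r.
  apply: colon_sum => l; have [lt|tl] := ltP l top.
    by rewrite h // => u _; rewrite mul0r; have [] := ideal_powz_ideal J i.
  by apply: (U_high l) => //; exact: component_in.
split; last first.
  move=> s f us Bf f0.
  have fS l : Some l \in s -> f (Some l) = 0.
    move=> ls; have := congr1 (component Rg (val l)) f0.
    rewrite (additive_map_sum _ _ _ (cD _)) (additive_map0 (cD _)).
    rewrite (bigD1_seq (Some l)) //= (B_comp _ l _ (Bf _ ls)) eqxx.
    rewrite big_seq_cond big1 ?addr0 // => o /andP[os /negPf ol].
    by rewrite (B_comp _ l _ (Bf _ os)) ol.
  case=> [l|]; first exact: fS.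
  move=> ns; move: f0; rewrite (bigD1_seq None) //= big_seq_cond big1 ?addr0 //.
  by move=> [l|] /andP[os //] _; exact: fS.
move=> v; split; last first.
  move=> [s [f [us Bf ->]]] u hu; rewrite mulr_suml big_seq_cond.
  have [I0 ID _] := ideal_powz_ideal J i.
  apply: (big_ind (ideal_powz J i)) => // o; rewrite andbT => /Bf/BU; exact.
move=> Uv; have [S [uS S0 _]] := component_split gs gd v.
pose s := pmap (insub : int -> option {l : int | lo <= l <= hi}) S.
have us : uniq s by exact: pmap_sub_uniq.
(* What remains after the middle components has no component below [top]. *)
pose f (o : option {l : int | lo <= l <= hi}) : R :=
  if o is Some l then component Rg (val l) v
  else v - \sum_(l <- s) component Rg (val l) v.
exists (None :: map Some s), f; split.
- rewrite /= map_inj_uniq; last by move=> ? ? [].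
  by rewrite us andbT; apply/mapP => -[].
- move=> o; rewrite inE => /orP[/eqP ->|/mapP[l ls ->]] /=; last first.
    have hr := component_in gs gd (val l) v; split=> //.
    apply/(U_ann _ _ hr).
    exact: (colon_component Rsg basis y1).
  apply/(max_power_order Rsg) => l lt.
  rewrite (additive_mapB _ _ (cD l)) (additive_map_sum _ _ _ (cD l)).
  have [lS|lS] := boolP ((lo <= l <= hi) && (l \in S)).
    have /andP[lr lS'] := lS.
    have sl : Sub l lr \in s by rewrite mem_pmap_sub SubK.
    rewrite (bigD1_seq _ sl us) /= (component_id gs gd (component_in gs gd l v)).
    rewrite big1 ?addr0 ?subrr // => l' l'l.
    apply: (component_neq gs gd (component_in gs gd _ v)).
    by apply: contra_neq l'l => e0; apply: val_inj; rewrite /= e0.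
  have -> : component Rg l v = 0.
    have [lr|lr] := boolP (lo <= l <= hi).
      by apply: S0; move: lS; rewrite lr.
    apply: (U_low l); last exact: (colon_component Rsg basis y1).
      by move: lr lt; rewrite /hi /top negb_and -!ltNge => /orP[//|]; lia.
    exact: component_in.
  rewrite big_seq_cond big1 ?subrr // => l' /andP[l's _].
  apply: (component_neq gs gd (component_in gs gd _ v)).
  apply: contraNneq lS => ->; rewrite (valP l') /=.
  by move: l's; rewrite mem_pmap_sub.
- by rewrite big_cons big_map /= subrK.
Qed.
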